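(* Let $p\in(1,\infty)$ and let $\psi_m^D$ and $\psi_m^S$ be the Daubechies orthonormal wavelet and the semiorthogonal spline wavelet of order $m$, respectively. Then $$\lim_{m\to\infty}\left(C_{m,p}(\psi_m^D)\right)^{1/m}=\frac12,\qquad \lim_{m\to\infty}\left(C_{m,p}(\psi_m^S)\right)^{1/m}=\frac{16}{\lambda_2\pi^4},$$ and $$\lim_{m\to\infty}\left(\frac{C_{m,p}(\psi_m^S)}{C_{m,p}(\psi_m^D)}\right)^{1/m}=\frac{32}{\lambda_2\pi^4}=0.47128\ldots,$$ where $\lambda_2=\frac{\sin^2(\xi_2-\pi/2)\sin^2(\xi_2)}{(\pi/2-\xi_2)\xi_2^2}=0.69706\ldots$ and $\xi_2=0.2853\ldots$ is the unique solution of $(2\pi\xi_2-4\xi_2^2)\cos(2\xi_2)+(3\xi_2-\pi)\sin(2\xi_2)=0$ in $(0,\pi/2)$.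
   Context: The Fourier transform is $\widehat f(\omega)=\frac{1}{\sqrt{2\pi}}\int_{\mathbb{R}}f(x)e^{-i x\omega}\,dx$; $\|\cdot\|_p$ is the $L_p(\mathbb{R})$ norm. For an integer $k$, ${}_kf$ denotes the function with $\widehat{{}_kf}(\omega)=(i\omega)^{-k}\widehat f(\omega)$, and $C_{k,p}(f)=\|\widehat{{}_kf}\|_p/\|\widehat f\|_p$. Daubechies wavelets: $H_m$ is the Daubechies orthonormal low-pass mask of order $m$, a $2\pi$-periodic trigonometric polynomial $H_m(t)=\sum_{\nu=0}^L h_\nu e^{-i\nu t}$ with $|H_m(t)|^2=1-c_m\int_0^t\sin^{2m-1}\omega\,d\omega$, $c_m=\left(\int_0^\pi\sin^{2m-1}\omega\,d\omega\right)^{-1}$ (equivalently $|H_m(t)|^2=\cos^{2m}(t/2)\sum_{\nu=0}^{m-1}\binom{m-1+\nu}{\nu}\sin^{2\nu}(t/2)$), normalized by $H_m(0)=1$; and $\widehat{\psi_m^D}(\omega)=\frac{1}{\sqrt{2\pi}}H_m(\omega/2+\pi)\prod_{\ell=1}^\infty H_m(2^{-\ell-1}\omega)$. Spline wavelets: $N_m(x)=\frac{1}{(m-1)!}\sum_{\nu=0}^m(-1)^\nu\binom{m}{\nu}(x-\nu)_+^{m-1}$ is the B-spline of order $m$, and $\psi_m^S(x)=\sum_{\nu=0}^{2m-2}\frac{(-1)^\nu}{2^{m-1}}N_{2m}(\nu+1)N_{2m}^{(m)}(2x-\nu)$, where $N_{2m}^{(m)}$ is the $m$-th derivative of $N_{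2m}$.
   Formalization: The decimal 0.47128… is read as a rounding (error at most 0.000005), since 32/(λ₂π⁴) = 0.471277… does not begin with the digits 0.47128. *)

(* Defs.v *)
From mathcomp Require Import all_boot all_order all_algebra.
From mathcomp Require Import complex.
From mathcomp Require Import all_classical all_reals all_analysis.
Set Implicit Arguments.
Unset Strict Implicit.
Unset Printing Implicit Defensive.
Import Order.TTheory GRing.Theory Num.Theory.
Import numFieldNormedType.Exports.
Local Open Scope classical_set_scope.
Local Open Scope complex_scope.
Local Open Scope ring_scope.

Definition expi (R : realType) (t : R) : R[i] := cos t +i* sin t.

(* Integral of a complex-valued function over the real line, componentwise. *)
Definition Cintegral (R : realType) (f : R -> R[i]) : R[i] :=
  (\int[lebesgue_measure]_x complex.Re (f x))
    +i* (\int[lebesgue_measure]_x complex.Im (f x)).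

Definition fourier (R : realType) (f : R -> R[i]) (w : R) : R[i] :=
  ((Num.sqrt (2 * pi))^-1)%:C * Cintegral (fun x => f x * expi (- (x * w))).

(* Real-valued L_p norm; [fine] sends an infinite norm to 0. *)
Definition LpnormC (R : realType) (p : R) (g : R -> R[i]) : R :=
  fine (Lnorm lebesgue_measure p%:E (fun w => (Normc.normc (g w))%:E)).

(* C_{k,p}(f), as a function of g, the Fourier transform of f: both f and its
   k-th primitive {}_k f enter C_{k,p}(f) only through their Fourier
   transforms, and that of {}_k f is (i w)^{-k} g(w).  The value at w = 0
   (where 0^-1 = 0) is irrelevant to the norm. *)
Definition Cft (R : realType) (k : int) (p : R) (g : R -> R[i]) : R :=
  LpnormC p (fun w => (0 +i* w) ^ (- k) * g w) / LpnormC p g.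

(* The oriented integral of f from 0 to t. *)
Definition int0 (R : realType) (f : R -> R) (t : R) : R :=
  if 0 <= t then \int[lebesgue_measure]_(x in `[0, t]) f x
  else - \int[lebesgue_measure]_(x in `[t, 0]) f x.

(* The masks of order m >= 1.  They are determined only up to the choice of a
   spectral factor of |H|^2, hence a predicate rather than a function of m. *)
Definition is_daubechies_mask (R : realType) (m : nat) (H : R -> R[i]) : Prop :=
  let s (w : R) := sin w ^+ (2 * m).-1 in
  [/\ exists (L : nat) (h : nat -> R[i]),
        forall t, H t = \sum_(0 <= nu < L.+1) h nu * expi (- (nu%:R * t)),
      forall t, Normc.normc (H t) ^+ 2 = 1 - (int0 s pi)^-1 * int0 s t
    & H 0 = 1].

(* Limit of a complex sequence, componentwise. *)
Definition Clim (R : realType) (u : nat -> R[i]) : R[i] :=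
  lim ((fun n => complex.Re (u n)) @ \oo)
    +i* lim ((fun n => complex.Im (u n)) @ \oo).

(* The wavelet is given by its Fourier transform in terms of the mask H. *)
Definition daubechies_wavelet_ft (R : realType) (H : R -> R[i]) (w : R) : R[i] :=
  ((Num.sqrt (2 * pi))^-1)%:C * H (w / 2 + pi) *
  Clim (fun n => \prod_(1 <= l < n.+1) H (2 ^- l.+1 * w)).

(* Truncated power (x)_+^n, with (x)_+^0 the indicator function of [0, +oo[. *)
Definition tpow (R : realType) (n : nat) (x : R) : R :=
  if 0 <= x then x ^+ n else 0.

Definition Bspline (R : realType) (m : nat) (x : R) : R :=
  (m.-1`!%:R)^-1 *
  \sum_(0 <= nu < m.+1) (-1) ^+ nu * 'C(m, nu)%:R * tpow m.-1 (x - nu%:R).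

(* The sum over 0 <= nu <= 2m-2. *)
Definition spline_wavelet (R : realType) (m : nat) (x : R) : R :=
  \sum_(0 <= nu < (2 * m).-1)
    (-1) ^+ nu / 2 ^+ m.-1 * Bspline (2 * m) (nu.+1%:R : R) *
    derive1n m (@Bspline R (2 * m)) (2 * x - nu%:R).

Definition C_daubechies (R : realType) (p : R) (m : nat) (H : R -> R[i]) : R :=
  Cft m%:Z p (daubechies_wavelet_ft H).

Definition C_spline (R : realType) (p : R) (m : nat) : R :=
  Cft m%:Z p (fourier (fun x => (spline_wavelet m x)%:C)).

Definition is_xi2 (R : realType) (x : R) : Prop :=
  0 < x < pi / 2 /\
  (2 * pi * x - 4 * x ^+ 2) * cos (2 * x) + (3 * x - pi) * sin (2 * x) = 0.

Definition lambda (R : realType) (x : R) : R :=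
  sin (x - pi / 2) ^+ 2 * sin x ^+ 2 / ((pi / 2 - x) * x ^+ 2).

(* decimal [:: d1; ...; dn] is the number 0.d1...dn *)
Definition decimal (R : realType) (ds : seq nat) : R :=
  \sum_(0 <= i < size ds) (nth 0%N ds i)%:R / 10 ^+ i.+1.

(* Main.v *)
Require Import Defs.
From mathcomp Require Import all_boot all_order all_algebra.
From mathcomp Require Import complex.
From mathcomp Require Import all_classical all_reals all_analysis.
From mathcomp Require Import ring lra zify.
Set Implicit Arguments.
Unset Strict Implicit.
Unset Printing Implicit Defensive.
Import Order.TTheory GRing.Theory Num.Theory.
Import numFieldNormedType.Exports.
Local Open Scope classical_set_scope.
Local Open Scope complex_scope.
Local Open Scope ring_scope.

(* If c l^m <= u_m <= C L^m for every l < L and large m, then u_m^(1/m) -> L.  An L_p norm inherits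
   such bounds from its integrand as soon as the latter has a uniform w^-2 tail, so both limits are
   maxima of exponential rates.
   Daubechies: |H_m(w/2 + pi)| behaves like |sin (w/2)|^m for |w| <= pi, and the infinite product is
   bounded and decays uniformly, by |H_m(t)|^2 <= e(cos t)^m with
   e(cos t) e(cos 2t) <= 10 cos(t/2)^2 cos(t)^2 and Viete's product; hence the rate is 1 for psi^ and
   sup |sin (w/2) / w| = 1/2 for w^-m psi^.
   Splines: |psi^(w)| = (2 pi)^(-1/2) |w|^-m (2 |sin (w/4)|)^(2m) |E(- e^(iw/2))| with E the
   Euler-Frobenius polynomial of order 2m.  The two-scale relation says that E / (1 - z)^(2m) at e^(it)
   is, up to a factor 2^(2m), the sum of its values at the two square roots of e^(it); iterating it, all
   but one of the terms are negligible and |E(e^(it))| is (2 sin (t/2) / t)^(2m) up to constants.  With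
   x = pi/2 - |w|/4 this gives the rate sin(2x)^2 / (4 (pi/2 - x) x^2) for psi^, maximal at xi_2, while
   the rate of w^-m psi^ is maximal at x = pi/4, where it is 16 / pi^4. *)

(** * Derivatives and trigonometric inequalities *)

(** The m-th root forgives constants and powers of m, but the constants must not depend on m, and
    this shapes both halves. For Daubechies masks no single factor of the product can give decay:
    its modulus tends to 1 as m grows wherever cos t > 0. The factors at t and 2t are therefore
    estimated together; squaring Viete's product gains 16 per pair, so any constant below 16 could
    stand in place of 10, and each quadrupling of |w| gains 5/8. For splines the infinite sum over t
    + 2 pi k behind the Euler-Frobenius polynomial is never formed. At each level N the iterated
    relation is a finite identity; 1/(2 sin (s/2))^2 satisfies the analogous one exactly, so two of
    the 2m powers are enough to control every tail, and N goes to infinity only in the final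
    inequalities. The transform itself comes from truncated powers by parts: high differences of
    polynomials vanish, which removes the boundary terms. Frequencies |w| >= 2 pi need only trivial
    bounds, because their rates 2/pi and 1/pi^2 stay below lambda_2 and 16/pi^4. *)

Section Derivatives.
Context (R : realType).
Implicit Types (f g : R -> R) (a b c x : R).

Lemma dconst c x : is_derive x 1 (fun=> c) 0. Proof. exact: is_derive_cst. Qed.
Lemma did x : is_derive x 1 (fun y => y) 1. Proof. exact: is_derive_id. Qed.
Lemma dD f g (a b x : R) : is_derive x 1 f a -> is_derive x 1 g b ->
  is_derive x 1 (fun y => f y + g y) (a + b).
Proof. by move=> df dg; exact: is_deriveD. Qed.
Lemma dN f (a x : R) : is_derive x 1 f a -> is_derive x 1 (fun y => - f y) (- a).
Proof. by move=> df; exact: is_deriveN. Qed.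
Lemma dM f g (a b x : R) : is_derive x 1 f a -> is_derive x 1 g b ->
  is_derive x 1 (fun y => f y * g y) (a * g x + f x * b).
Proof.
move=> df dg.
apply: (@is_derive_eq _ _ _ (f * g) x 1 _ _ (is_deriveM df dg)).
by rewrite /GRing.scale /= addrC mulrC.
Qed.
Lemma dX f (a x : R) n : is_derive x 1 f a ->
  is_derive x 1 (fun y => f y ^+ n) (n%:R * f x ^+ n.-1 * a).
Proof.
move=> df; elim: n => [|n IH].
  by under eq_fun do rewrite expr0; rewrite !mul0r; exact: dconst.
under eq_fun do rewrite exprS.
apply: (is_derive_eq (dM df IH)).
case: n {IH} => [|n] /=; first by rewrite expr0; ring.
by rewrite -[n.+2]add1n natrD exprS; ring.
Qed.
Lemma dV f (a x : R) : is_derive x 1 f a -> f x != 0 ->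
  is_derive x 1 (fun y => (f y)^-1) (- a / f x ^+ 2).
Proof.
move=> df fx.
apply: (@is_derive_eq _ _ _ _ x 1 _ _ (is_deriveV fx df)).
by rewrite /GRing.scale /= mulrC mulrN mulNr.
Qed.
Lemma dcompose f g (a b x : R) : is_derive x 1 f a -> is_derive (f x) 1 g b ->
  is_derive x 1 (fun y => g (f y)) (b * a).
Proof. by move=> df dg; exact: is_derive1_comp. Qed.
Lemma dsin f (a x : R) : is_derive x 1 f a ->
  is_derive x 1 (fun y => sin (f y)) (cos (f x) * a).
Proof. by move=> df; apply: dcompose. Qed.
Lemma dcos f (a x : R) : is_derive x 1 f a ->
  is_derive x 1 (fun y => cos (f y)) (- sin (f x) * a).
Proof. by move=> df; apply: dcompose. Qed.

Lemma derive_within_continuous f (df : R -> R) a b :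
  (forall x, a <= x <= b -> is_derive x 1 f (df x)) ->
  {within `[a, b], continuous f}.
Proof.
move=> fd; apply: continuous_in_subspaceT => x; rewrite inE/= in_itv/= => xab.
apply: differentiable_continuous; apply/derivable1_diffP.
by have [] := fd x xab.
Qed.

Lemma derive_ge0_le f (df : R -> R) a b : a <= b ->
  (forall x, a <= x <= b -> is_derive x 1 f (df x)) ->
  (forall x, a < x < b -> 0 <= df x) -> f a <= f b.
Proof.
rewrite le_eqVlt => /predU1P[->//|ab] fd df0.
have cf := derive_within_continuous fd.
have [x|c cab E] := @MVT _ f df a b ab _ cf.
  by rewrite in_itv/= => /andP[ax xb]; apply: fd; rewrite !ltW.
move: cab; rewrite -subr_ge0 E in_itv/= => cab.
by rewrite mulr_ge0 ?df0// subr_ge0 ltW.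
Qed.

Lemma derive_gt0_lt f (df : R -> R) a b : a < b ->
  (forall x, a <= x <= b -> is_derive x 1 f (df x)) ->
  (forall x, a < x < b -> 0 < df x) -> f a < f b.
Proof.
move=> ab fd df0.
have cf := derive_within_continuous fd.
have [x|c cab E] := @MVT _ f df a b ab _ cf.
  by rewrite in_itv/= => /andP[ax xb]; apply: fd; rewrite !ltW.
move: cab; rewrite -subr_gt0 E in_itv/= => cab.
by rewrite mulr_gt0 ?df0// subr_gt0.
Qed.

End Derivatives.

Ltac dstep := lazymatch goal with
  | |- is_derive _ _ (fun y => y) _ => exact: did
  | |- is_derive _ _ (fun _ => ?c) _ => exact: dconst
  | |- is_derive _ _ (fun y => @?f y + @?g y) _ =>
      simple notypeclasses refine (@dD _ f g _ _ _ _ _)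
  | |- is_derive _ _ (fun y => - @?f y) _ =>
      simple notypeclasses refine (@dN _ f _ _ _)
  | |- is_derive _ _ (fun y => @?f y * @?g y) _ =>
      simple notypeclasses refine (@dM _ f g _ _ _ _ _)
  | |- is_derive _ _ (fun y => @?f y ^+ ?n) _ =>
      simple notypeclasses refine (@dX _ f _ _ n _)
  | |- is_derive _ _ (fun y => (@?f y)^-1) _ =>
      simple notypeclasses refine (@dV _ f _ _ _ _)
  | |- is_derive _ _ (fun y => sin (@?f y)) _ =>
      simple notypeclasses refine (@dsin _ f _ _ _)
  | |- is_derive _ _ (fun y => cos (@?f y)) _ =>
      simple notypeclasses refine (@dcos _ f _ _ _)
  | |- is_derive _ _ _ _ => typeclasses eauto
  end.
Ltac deriv :=
  simple notypeclasses refine (is_derive_eq _ _); [|repeat dstep|rewrite /=].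

Section Trig.
Context (R : realType).
Implicit Types x y : R.

(* (-1)^n / (2n)! *)
Fixpoint ccoef (n : nat) : R :=
  if n is k.+1 then - (ccoef k / (k.*2.+1%:R * k.*2.+2%:R)) else 1.
Fixpoint csum (n : nat) x : R :=
  if n is k.+1 then csum k x + ccoef k * x ^+ k.*2 else 0.
Fixpoint ssum (n : nat) x : R :=
  if n is k.+1 then ssum k x + ccoef k / k.*2.+1%:R * x ^+ k.*2.+1 else 0.

#[local] Instance deriv_ssum n x : is_derive x 1 (ssum n) (csum n x).
Proof.
elim: n => [|n IH] /=; first exact: dconst.
deriv.
by rewrite mul0r add0r mulr1 mulrA divfK ?pnatr_eq0.
Qed.

#[local] Instance deriv_csum n x : is_derive x 1 (csum n.+1) (- ssum n x).
Proof.
elim: n => [|n IH]; first by change (is_derive x 1 (fun y : R => 0 + 1 * y ^+ 0) (- 0)); deriv; rewrite /= ; ring.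
change (is_derive x 1 (fun y => csum n.+1 y + ccoef n.+1 * y ^+ n.+1.*2) (- ssum n.+1 x)).
deriv.
rewrite doubleS.
set m := n.*2.
have h k : (k.+1%:R : R) != 0 by rewrite pnatr_eq0.
rewrite mul0r add0r mulr1 opprD mulNr; congr (_ - _).
by rewrite invfM -!mulrA mulKf.
Qed.

Lemma csum0 n : csum n.+1 0 = 1.
Proof.
elim: n => [|n IH]; first by rewrite /= mul1r expr0 add0r.
by rewrite -[LHS]/(csum n.+1 0 + ccoef n.+1 * 0 ^+ n.+1.*2) IH doubleS expr0n mulr0 addr0.
Qed.

Lemma ssum0 n : ssum n 0 = 0.
Proof. by elim: n => [|n IH]//=; rewrite IH expr0n mulr0 addr0. Qed.

(** Integration from 0 alternates between the two remainders: the cosine remainder is the derivative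
    of the sine remainder, and the sine remainder is minus the derivative of the next cosine
    remainder. The start is cos <= 1. *)
Lemma taylor_cos_sin n x : 0 <= x ->
  0 <= (-1) ^+ n.+1 * (cos x - csum n.+1 x) /\ 0 <= (-1) ^+ n.+1 * (sin x - ssum n.+1 x).
Proof.
elim: n x => [|n IH] x x0.
  have c y : 0 <= (-1) ^+ 1 * (cos y - csum 1 y).
    by rewrite /= expr1 expr0; have := cos_le1 y; lra.
  split=> //.
  pose f y := (-1) ^+ 1 * (sin y - ssum 1 y).
  have -> : 0 = f 0 by rewrite /f sin0 ssum0 subrr mulr0.
  apply: (@derive_ge0_le _ f (fun y => (-1) ^+ 1 * (cos y - csum 1 y))).
  - exact: x0.
  - by move=> y _; exact: c.
have c y : 0 <= y -> 0 <= (-1) ^+ n.+2 * (cos y - csum n.+2 y).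
  move=> y0; pose f y := (-1) ^+ n.+2 * (cos y - csum n.+2 y).
  have -> : 0 = f 0 by rewrite /f cos0 csum0 subrr mulr0.
  apply: (@derive_ge0_le _ f (fun y => (-1) ^+ n.+1 * (sin y - ssum n.+1 y))) => //.
    move=> z _; rewrite /f; deriv.
    by rewrite [(-1) ^+ n.+2]exprS; ring.
  by move=> z /andP[/ltW z0 _]; have [] := IH z z0.
split; first exact: c.
pose f y := (-1) ^+ n.+2 * (sin y - ssum n.+2 y).
have -> : 0 = f 0 by rewrite /f sin0 ssum0 subrr mulr0.
apply: (@derive_ge0_le _ f (fun y => (-1) ^+ n.+2 * (cos y - csum n.+2 y))) => //.
by move=> z /andP[/ltW z0 _]; exact: c.
Qed.

(** The difference has y-derivative sin x - x cos y, at least sin x - x cos x >= 0 since cosine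
    decreases. This is the monotonicity of sin y / y, cleared of denominators. *)
Lemma sin_div_nincr x y : 0 < x -> x <= y <= pi -> x * sin y <= sin x * y.
Proof.
move=> x0 /andP[xy ypi].
have tan_ge (z : R) : 0 <= z <= pi -> 0 <= sin z - z * cos z.
  move=> /andP[z0 zpi]; have -> : 0 = sin 0 - 0 * cos 0 :> R by rewrite sin0; ring.
  apply: (@derive_ge0_le _ (fun z => sin z - z * cos z) (fun z => z * sin z)) => //.
    move=> t _; by deriv; ring.
  move=> t /andP[t0 tz]; rewrite mulr_ge0 ?(ltW t0)// sin_ge0_pi// (ltW t0)/=.
  by rewrite (le_trans (ltW tz)).
rewrite -subr_ge0; have -> : 0 = sin x * x - x * sin x by ring.
apply: (@derive_ge0_le _ (fun y => sin x * y - x * sin y)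
  (fun y => sin x - x * cos y)) => //.
  by move=> t _; deriv; ring.
move=> t /andP[xt ty].
have := tan_ge x; rewrite (ltW x0) (le_trans xy) // => /(_ isT).
suff : x * cos t <= x * cos x by lra.
rewrite ler_pM2l// ltW// ltr_cos ?in_itv/= ?(ltW x0) ?(le_trans xy)//.
by rewrite (le_trans (ltW x0) (ltW xt)) (le_trans (ltW ty)).
Qed.

Lemma sin_ge_chord x : 0 <= x <= pi / 2 -> 2 / pi * x <= sin x.
Proof.
move=> /andP[]; rewrite le_eqVlt => /predU1P[<-|x0 xpi]; first by rewrite sin0 mulr0.
have p0 := pi_gt0 R.
have := @sin_div_nincr x (pi / 2) x0; rewrite xpi sin_pihalf => /(_ ltac:(lra)).
rewrite mulr1 mulrA ler_pdivlMr// => h.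
by rewrite mulrAC ler_pdivrMr//; lra.
Qed.

(** About the midpoint, sin u = 1 - 2 sin^2 y with y = |u - pi/2| / 2 at most pi/4, and sin y / y is
    at least its value at pi/4. Equality at u = pi/2 is what makes the constant 16/pi^4 sharp
    later. *)
Lemma sin_le_parabola (u : R) : 0 <= u <= pi -> sin u <= 4 * u * (pi - u) / pi ^+ 2.
Proof.
move=> /andP[u0 upi]; have p0 := pi_gt0 R.
pose y := `|u - pi / 2| / 2.
have -> : sin u = 1 - 2 * sin y ^+ 2.
  have : cos (`|u - pi / 2|) = 1 - 2 * sin y ^+ 2.
    have -> : `|u - pi / 2| = y *+ 2 by rewrite /y -mulr_natr; field.
    by rewrite cos_mulr2n cos2sin2; ring.
  by rewrite cos_norm cosBpihalf => ->.
have -> : 4 * u * (pi - u) / pi ^+ 2 = 1 - 16 * y ^+ 2 / pi ^+ 2.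
  rewrite /y expr_div_n real_normK ?num_real//.
  by move: (pi : R) p0 => P P0; field; rewrite gt_eqF.
have y0 : 0 <= y by rewrite /y divr_ge0.
have y1 : y <= pi / 4 by rewrite /y ler_pdivrMr// ler_norml; apply/andP; split; lra.
rewrite lerD2l lerN2 ler_pdivrMr ?exprn_gt0//.
move: y0; rewrite le_eqVlt => /predU1P[<-|y0]; first by rewrite sin0; lra.
have := @sin_div_nincr y (pi / 4) y0; rewrite y1 => /(_ ltac:(lra)) h.
have s4 : sin (pi / 4) ^+ 2 = 1 / 2 :> R.
  have := cos_mulr2n (pi / 4 : R).
  have -> : (pi / 4) *+ 2 = pi / 2 :> R by rewrite -mulr_natr; field.
  by rewrite cos_pihalf cos2sin2; lra.
have : (y * sin (pi / 4)) ^+ 2 <= (sin y * (pi / 4)) ^+ 2.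
  have sy : 0 <= sin y by rewrite sin_ge0_pi// (ltW y0)/=; lra.
  have s4' : 0 <= sin (pi / 4 : R) by rewrite sin_ge0_pi//; apply/andP; split; lra.
  by rewrite lerXn2r ?nnegrE ?mulr_ge0// ltW//; lra.
by rewrite !exprMn s4; lra.
Qed.


(** The truncated cosine series is positive at half the lower bound and negative at half the upper
    one, so pi/2 lies between them. The nested base-100 notation keeps all numerals small. *)
Lemma pi_bounds : (314 + (15 + (92 + 65 / 100) / 100) / 100) / 100 < (pi : R)
  < (314 + (15 + (92 + 66 / 100) / 100) / 100) / 100.
Proof.
have p2 := pi_ge2 R.
apply/andP; split; rewrite ltNge; apply/negP => hpi.
- pose a : R := (157 + (7 + (96 + (32 + 50 / 100) / 100) / 100) / 100) / 100.
  have a0 : 0 <= a by rewrite /a; lra.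
  have [+ _] := taylor_cos_sin 9 a0; rewrite -signr_odd expr0 mul1r subr_ge0.
  have : 0 < csum 10 a by rewrite /= !doubleS !double0 /a; lra.
  have : cos a <= cos (pi / 2).
    rewrite leNgt ltr_cos ?in_itv/= -?leNgt; first by rewrite /a; lra.
      by rewrite a0/= /a; lra.
    by apply/andP; split; lra.
  by rewrite cos_pihalf; lra.
- pose b : R := (157 + (7 + (96 + 33 / 100) / 100) / 100) / 100.
  have b0 : 0 <= b by rewrite /b; lra.
  have [+ _] := taylor_cos_sin 8 b0; rewrite -signr_odd expr1 mulN1r opprB subr_ge0.
  have : csum 9 b < 0 by rewrite /= !doubleS !double0 /b; lra.
  have : 0 <= cos b by apply: cos_ge0_pihalf; apply/andP; split; rewrite /b; lra.
  by lra.
Qed.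

(** For u = 2z this is the negativity of the derivative of [logd] at z, cleared of denominators. The
    leading terms of both sides agree at u = 0, so small u needs a Taylor bound; beyond 1 the
    parabola is enough. *)
Lemma sin_sqr_key (u : R) : 0 < u < pi ->
  sin u ^+ 2 * (u ^+ 2 + 2 * (pi - u) ^+ 2) < 2 * (u ^+ 2 * (pi - u) ^+ 2).
Proof.
have /andP[p1 p2] := pi_bounds; move=> /andP[u0 upi].
have su : 0 < sin u by rewrite sin_gt0_pi// u0.
have [u1|u1] := leP u 1.
  have [_] := taylor_cos_sin 2 (ltW u0).
  rewrite -signr_odd expr1 mulN1r opprB subr_ge0 => h.
  (* For u <= 1 the term u^5 / 120 is at most u^3 / 120, and 1/6 - 1/120 = 19/120. *)
  have {h} h : sin u <= u * (1 - 19 / 120 * u ^+ 2).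
    apply: le_trans h _; rewrite /= !doubleS !double0 -subr_ge0.
    have -> : u * (1 - 19 / 120 * u ^+ 2) -
      (0 + 1 / 1 * u ^+ 1 + - (1 / (1 * 2)) / 3 * u ^+ 3 +
       - (- (1 / (1 * 2)) / (3 * 4)) / 5 * u ^+ 5) = u ^+ 3 * (1 - u ^+ 2) / 120.
      by field.
    by rewrite !mulr_ge0 ?exprn_ge0 ?(ltW u0)// subr_ge0 exprn_ile1 ?(ltW u0).
  have {}h : sin u ^+ 2 <= u ^+ 2 * (1 - 19 / 120 * u ^+ 2) ^+ 2.
    rewrite -exprMn lerXn2r ?nnegrE ?(ltW su)//; exact: le_trans (ltW su) h.
  set v := u ^+ 2 in h *; set w := (pi - u) ^+ 2.
  have v0 : 0 < v by rewrite exprn_gt0.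
  have v1 : v <= 1 by rewrite exprn_ile1 ?(ltW u0).
  have w4 : 4 <= w.
    have -> : 4 = 2 ^+ 2 :> R by ring.
    by rewrite lerXn2r ?nnegrE; lra.
  apply: (@le_lt_trans _ _ (v * (1 - 19 / 120 * v) ^+ 2 * (v + 2 * w))).
    by apply: ler_wpM2r h; lra.
  rewrite -mulrA [ltRHS]mulrCA ltr_pM2l//.
  have hq : 29 / 100 <= 2 * (19 / 120) - (19 / 120) ^+ 2 * v by lra.
  have : (29 / 100) * 8 <= (2 * (19 / 120) - (19 / 120) ^+ 2 * v) * (v + 2 * w).
    by apply: ler_pM => //; lra.
  move=> hh.
  have : 0 < v * ((2 * (19 / 120) - (19 / 120) ^+ 2 * v) * (v + 2 * w) - 1).
    by rewrite mulr_gt0//; lra.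
  rewrite -subr_gt0.
  suff -> : 2 * w - (1 - 19 / 120 * v) ^+ 2 * (v + 2 * w) = v * ((2 * (19 / 120) - (19 / 120) ^+ 2 * v) * (v + 2 * w) - 1) by [].
  by field.
have p0 := pi_gt0 R.
have h := @sin_le_parabola u; rewrite (ltW u0) (ltW upi) in h.
have {h} := h isT.
rewrite ler_pdivlMr ?exprn_gt0// => h.
have {}h : (sin u * pi ^+ 2) ^+ 2 <= (4 * u * (pi - u)) ^+ 2.
  rewrite lerXn2r ?nnegrE ?mulr_ge0 ?exprn_ge0 ?(ltW su) ?(ltW p0)//; last by lra.
  by rewrite ltW.
(* The left side is convex in u and on [1, pi] it is largest at u = 1. *)
have q : u ^+ 2 + 2 * (pi - u) ^+ 2 <= 3 - 4 * pi + 2 * pi ^+ 2.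
  have : 0 <= (u - 1) * (3 * (pi - u) + (pi - 3)) by rewrite mulr_ge0//; lra.
  by rewrite -subr_ge0 => H; rewrite -subr_ge0; move: H; lra.
have p4 : 16 * (3 - 4 * pi + 2 * pi ^+ 2) < 2 * pi ^+ 4 :> R.
  have : 0 < (pi - 3) * ((pi + 3) * (pi ^+ 2 - 7)) :> R.
    by rewrite !mulr_gt0//; nra.
  by move: (pi : R) p1 p2 => P; nra.
have uu : 0 < u ^+ 2 * (pi - u) ^+ 2 by rewrite mulr_gt0 ?exprn_gt0// subr_gt0.
rewrite -(@ltr_pM2r _ (pi ^+ 4)) ?exprn_gt0//.
apply: (@le_lt_trans _ _ ((4 * u * (pi - u)) ^+ 2 * (u ^+ 2 + 2 * (pi - u) ^+ 2))).
  have -> : sin u ^+ 2 * (u ^+ 2 + 2 * (pi - u) ^+ 2) * pi ^+ 4 = (sin u * pi ^+ 2) ^+ 2 * (u ^+ 2 + 2 * (pi - u) ^+ 2) by move: (pi : R) => P; ring.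
  apply: ler_wpM2r h.
  by rewrite addr_ge0 ?sqr_ge0// mulr_ge0 ?sqr_ge0.
have -> : (4 * u * (pi - u)) ^+ 2 * (u ^+ 2 + 2 * (pi - u) ^+ 2) = u ^+ 2 * (pi - u) ^+ 2 * (16 * (u ^+ 2 + 2 * (pi - u) ^+ 2)) by move: (pi : R) => P; ring.
have -> : 2 * (u ^+ 2 * (pi - u) ^+ 2) * pi ^+ 4 = u ^+ 2 * (pi - u) ^+ 2 * (2 * pi ^+ 4) by move: (pi : R) => P; ring.
by rewrite ltr_pM2l//; lra.
Qed.

End Trig.

(** * The critical point *)

Section CriticalPoint.
Context (R : realType).
Implicit Types x y : R.

Definition crit x : R :=
  (2 * pi * x - 4 * x ^+ 2) * cos (2 * x) + (3 * x - pi) * sin (2 * x).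

(* [logd] is the logarithmic derivative of [profile]. *)
Definition logd x : R :=
  4 * (cos (2 * x) / sin (2 * x)) + (pi / 2 - x)^-1 - 2 / x.

Definition profile x : R :=
  sin (2 * x) ^+ 2 / (4 * (pi / 2 - x) * x ^+ 2).

Lemma lambdaE x : lambda x = profile x.
Proof.
rewrite /lambda /profile sinBpihalf sqrrN.
have -> : 2 * x = x *+ 2 by rewrite mulr_natl.
rewrite sin_mulr2n -exprMn.
rewrite (_ : (cos x * sin x *+ 2) ^+ 2 = 4 * (cos x * sin x) ^+ 2); last by ring.
move: (pi / 2 - x) (cos x * sin x) => w t.
by rewrite -(mulrA 4 w) -(mulf_div 4 4) divff ?mul1r.
Qed.

Lemma critE x : 0 < x < pi / 2 ->
  crit x = logd x * (sin (2 * x) * (x * (pi / 2 - x))).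
Proof.
move=> /andP[x0 xp]; rewrite /crit /logd.
have : sin (2 * x) != 0 by rewrite gt_eqF// sin_gt0_pi//; apply/andP; split; lra.
have : x != 0 by rewrite gt_eqF.
have [w wE] : exists w, pi / 2 - x = w by eexists.
have : w != 0 by rewrite -wE gt_eqF// subr_gt0.
have piE : pi = 2 * (w + x) by rewrite -wE; lra.
rewrite wE piE; move: (sin _) (cos _) => s c wn xn sn; field.
by rewrite xn wn sn.
Qed.

Lemma deriv_logd x : 0 < x < pi / 2 -> is_derive x 1 logd
  (- 8 / sin (2 * x) ^+ 2 + (pi / 2 - x) ^- 2 + 2 / x ^+ 2).
Proof.
move=> /andP[x0 xp]; rewrite /logd.
have s0 : sin (2 * x) != 0 by rewrite gt_eqF// sin_gt0_pi//; apply/andP; split; lra.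
have p0 : pi / 2 - x != 0 by rewrite gt_eqF// subr_gt0.
have x0' : x != 0 by rewrite gt_eqF.
deriv => //.
have := cos2sin2 (2 * x); move: s0 p0; move: (sin _) (cos _) (pi / 2 - x) => s c w sn pn c2.
have -> : 4 * (- s * (0 * x + 2 * 1) / s + c * (- (c * (0 * x + 2 * 1)) / s ^+ 2)) = - 8 / s ^+ 2.
  rewrite (_ : _ / s + _ = - 2 - 2 * (c ^+ 2 / s ^+ 2)); last by field.
  by rewrite c2; field.
by field; rewrite ?x0' ?sn ?pn.
Qed.

(** [sin_sqr_key] at twice the point makes the derivative negative. Hence [logd] has at most one
    zero, and there [profile] turns from increasing to decreasing. *)
Lemma logd_lt x y : 0 < x -> x < y -> y < pi / 2 -> logd y < logd x.
Proof.
move=> x0 xy yp; rewrite -ltrN2.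
have dl (z : R) : x <= z <= y -> is_derive z 1 (fun t => - logd t)
    (- (- 8 / sin (2 * z) ^+ 2 + (pi / 2 - z) ^- 2 + 2 / z ^+ 2)).
  move=> /andP[xz zy]; apply: dN; apply: deriv_logd.
  by rewrite (lt_le_trans x0)// (le_lt_trans zy).
apply: (derive_gt0_lt xy dl) => z /andP[xz zy].
have z0 : 0 < z by exact: lt_trans xz.
have zp : z < pi / 2 by exact: lt_trans yp.
have u0 : 0 < 2 * z < pi by apply/andP; split; lra.
have s0 : 0 < sin (2 * z) ^+ 2 by rewrite exprn_gt0// sin_gt0_pi.
have := sin_sqr_key u0.
have w0 : 0 < pi / 2 - z by rewrite subr_gt0.
rewrite (_ : pi - 2 * z = 2 * (pi / 2 - z)); last by lra.
move: (sin _ ^+ 2) s0 (pi / 2 - z) w0 => s s0 w w0 h.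
rewrite (_ : - _ = (2 * (4 * z ^+ 2 * w ^+ 2) - s * (z ^+ 2 + 2 * w ^+ 2)) / (s * w ^+ 2 * z ^+ 2)); last first.
  by field; rewrite !gt_eqF.
rewrite divr_gt0// ?mulr_gt0 ?exprn_gt0//.
by move: h; lra.
Qed.

Lemma crit_eq0 x : 0 < x < pi / 2 -> (crit x == 0) = (logd x == 0).
Proof.
move=> xp; rewrite critE//; move/andP: xp => [x0 xp].
have s0 : sin (2 * x) != 0 by rewrite gt_eqF// sin_gt0_pi//; apply/andP; split; lra.
have p0 : pi / 2 - x != 0 by rewrite gt_eqF// subr_gt0.
by rewrite !mulf_eq0 (negbTE s0) (negbTE p0) (gt_eqF x0) !orbF.
Qed.

Lemma xi2_unique x y : is_xi2 x -> is_xi2 y -> x = y.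
Proof.
move=> [x0 /eqP xc] [y0 /eqP yc]; move: xc yc.
rewrite -!/(crit _) !crit_eq0// => /eqP xl /eqP yl.
move: x0 y0 => /andP[x0 xp] /andP[y0 yp].
have [xy|yx|//] := ltgtP x y.
- by have := logd_lt x0 xy yp; rewrite xl yl ltxx.
- by have := logd_lt y0 yx xp; rewrite xl yl ltxx.
Qed.

Lemma deriv_profile x : 0 < x < pi / 2 ->
  is_derive x 1 profile (profile x * logd x).
Proof.
move=> /andP[x0 xp]; rewrite /logd /profile.
have s0 : sin (2 * x) != 0 by rewrite gt_eqF// sin_gt0_pi//; apply/andP; split; lra.
have p0 : pi / 2 - x != 0 by rewrite gt_eqF// subr_gt0.
have x0' : x != 0 by rewrite gt_eqF.
have d0 : 4 * (pi / 2 - x) * x ^+ 2 != 0.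
  by rewrite !mulf_neq0 ?expf_neq0 ?pnatr_eq0.
deriv => //.
move: s0 p0 {d0}; move: (sin _) (cos _) (pi / 2 - x) => s c w sn pn.
by field; rewrite ?x0' ?sn ?pn.
Qed.

Lemma profile_le x y : is_xi2 x -> 0 < y < pi / 2 -> profile y <= profile x.
Proof.
move=> [x0 /eqP xc] /andP[y0 yp]; move: xc; rewrite -/(crit x) crit_eq0// => /eqP xl.
move/andP: x0 => [x0 xp].
have pos (z : R) : 0 < z -> z < pi / 2 -> 0 <= profile z.
  move=> z0 zp; by rewrite /profile divr_ge0 ?sqr_ge0// mulr_ge0 ?sqr_ge0// mulr_ge0// subr_ge0 ltW.
have [yx|xy|->//] := ltgtP y x.
- have dp (z : R) : y <= z <= x -> is_derive z 1 profile (profile z * logd z).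
    move=> /andP[yz zx]; apply: deriv_profile.
    by rewrite (lt_le_trans y0)// (le_lt_trans zx).
  apply: (derive_ge0_le (ltW yx) dp) => z /andP[yz zx]; rewrite mulr_ge0 ?pos ?(lt_trans y0)// ?(lt_trans zx)//.
  by rewrite -xl ltW// logd_lt// (lt_trans y0).
- rewrite -lerN2.
  have dp (z : R) : x <= z <= y ->
      is_derive z 1 (fun t => - profile t) (- (profile z * logd z)).
    move=> /andP[xz zy]; apply: dN; apply: deriv_profile.
    by rewrite (lt_le_trans x0)// (le_lt_trans zy).
  apply: (derive_ge0_le (ltW xy) dp) => z /andP[xz zy]; rewrite -mulrN mulr_ge0 ?pos ?(lt_trans x0)// ?(lt_trans zy)//.
  by rewrite oppr_ge0 -xl ltW// logd_lt// (lt_trans zy).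
Qed.

(** The ends of an interval of length 3 * 10^-7 over which [crit] changes sign, short enough for the
    digits of lambda_2 that are derived from it. *)
Let xa : R := (28 + (53 + (29 + 60 / 100) / 100) / 100) / 100.
Let xb : R := (28 + (53 + (29 + 90 / 100) / 100) / 100) / 100.

(** In [crit] the coefficient of the cosine is positive here and that of the sine negative, so
    cosine is bounded below and sine above; the parity of the Taylor order selects the side. *)
Lemma crit_xa : 0 < crit xa.
Proof.
have /andP[p1 p2] := pi_bounds R.
have a0 : 0 <= 2 * xa by rewrite /xa; lra.
have [hc _] := taylor_cos_sin 5 a0; have [_ hs] := taylor_cos_sin 4 a0.
move: hc hs; rewrite -signr_odd expr0 mul1r subr_ge0.
rewrite -signr_odd expr1 mulN1r opprB subr_ge0 /crit.
set c := cos _; set s := sin _ => hc hs.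
have {hc}c1 : (84 + (15 + (45 + (6 + 60 / 100) / 100) / 100) / 100) / 100 <= c.
  by apply: le_trans hc; rewrite /= !doubleS !double0 /xa; lra.
have {hs}s1 : s <= (54 + (1 + (86 + (91 + 40 / 100) / 100) / 100) / 100) / 100.
  by apply: le_trans hs _; rewrite /= !doubleS !double0 /xa; lra.
have hc : 0 <= (2 * pi * xa - 4 * xa ^+ 2) * (c - (84 + (15 + (45 + (6 + 60 / 100) / 100) / 100) / 100) / 100).
  by rewrite mulr_ge0 ?subr_ge0// /xa; lra.
have hs : 0 <= (pi - 3 * xa) * ((54 + (1 + (86 + (91 + 40 / 100) / 100) / 100) / 100) / 100 - s).
  by rewrite mulr_ge0 ?subr_ge0// /xa; lra.
by move: hc hs; rewrite /xa; move: (pi : R) p1 p2 => P p1 p2; lra.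
Qed.

Lemma crit_xb : crit xb < 0.
Proof.
have /andP[p1 p2] := pi_bounds R.
have b0 : 0 <= 2 * xb by rewrite /xb; lra.
have [hc _] := taylor_cos_sin 4 b0; have [_ hs] := taylor_cos_sin 5 b0.
move: hc hs; rewrite -signr_odd expr1 mulN1r opprB subr_ge0.
rewrite -signr_odd expr0 mul1r subr_ge0 /crit.
set c := cos _; set s := sin _ => hc hs.
have {hc}c1 : c <= (84 + (15 + (44 + (74 + 50 / 100) / 100) / 100) / 100) / 100.
  by apply: le_trans hc _; rewrite /= !doubleS !double0 /xb; lra.
have {hs}s1 : (54 + (1 + (87 + (41 + 60 / 100) / 100) / 100) / 100) / 100 <= s.
  by apply: le_trans hs; rewrite /= !doubleS !double0 /xb; lra.
have hc : 0 <= (2 * pi * xb - 4 * xb ^+ 2) * ((84 + (15 + (44 + (74 + 50 / 100) / 100) / 100) / 100) / 100 - c).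
  by rewrite mulr_ge0 ?subr_ge0// /xb; lra.
have hs : 0 <= (pi - 3 * xb) * (s - (54 + (1 + (87 + (41 + 60 / 100) / 100) / 100) / 100) / 100).
  by rewrite mulr_ge0 ?subr_ge0// /xb; lra.
by move: hc hs; rewrite /xb; move: (pi : R) p1 p2 => P p1 p2; lra.
Qed.

Lemma crit_root : exists2 x, is_xi2 x & xa <= x <= xb.
Proof.
have xab : xa <= xb by rewrite /xa /xb; lra.
have cc : continuous crit.
  move=> x; apply: differentiable_continuous; apply/derivable1_diffP.
  have [] : is_derive x 1 crit ((2 * pi - 8 * x) * cos (2 * x)
     - (2 * pi * x - 4 * x ^+ 2) * (2 * sin (2 * x))
     + 3 * sin (2 * x) + (3 * x - pi) * (2 * cos (2 * x))); last by [].
  by rewrite /crit; deriv; move: (sin _) (cos _) (pi : R) => s c P; ring.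
have cs : {within `[xa, xb], continuous crit} by exact: continuous_subspaceT.
have ab : Num.min (crit xa) (crit xb) <= 0 <= Num.max (crit xa) (crit xb).
  by rewrite ge_min le_max (ltW crit_xa) (ltW crit_xb) orbT.
have [x] := IVT xab cs ab.
rewrite in_itv/= => xI x0; exists x => //; split; last exact: x0.
have /andP[p1 p2] := pi_bounds R; move/andP: xI.
by rewrite /xa /xb => -[x1 x2]; apply/andP; split; lra.
Qed.

(** At the root the equation reads 4 x (pi/2 - x) cos 2x = (pi - 3x) sin 2x, which together with
    cos^2 + sin^2 = 1 determines sin^2 2x rationally. The value is then enclosed from bounds on x
    and pi alone. *)
Lemma lambda2E x : is_xi2 x ->
  profile x = 4 * (pi / 2 - x) / ((pi - 3 * x) ^+ 2 + (4 * (x * (pi / 2 - x))) ^+ 2).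
Proof.
move=> [/andP[x0 xp] xc]; rewrite /profile.
have s0 : 0 < sin (2 * x) by rewrite sin_gt0_pi//; apply/andP; split; lra.
have w0 : 0 < pi / 2 - x by rewrite subr_gt0.
have E : (sin (2 * x) * (pi - 3 * x)) ^+ 2 = (4 * (x * (pi / 2 - x))) ^+ 2 * (1 - sin (2 * x) ^+ 2).
  rewrite -cos2sin2 -exprMn; congr (_ ^+ 2); apply/eqP; rewrite -subr_eq0; apply/eqP.
  by rewrite -oppr0 -xc; move: (sin _) (cos _) (pi : R) => s c P; field.
have {}E : sin (2 * x) ^+ 2 * ((pi - 3 * x) ^+ 2 + (4 * (x * (pi / 2 - x))) ^+ 2) = (4 * (x * (pi / 2 - x))) ^+ 2.
  by rewrite mulrDr -exprMn E; ring.
have D0 : 0 < (pi - 3 * x) ^+ 2 + (4 * (x * (pi / 2 - x))) ^+ 2.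
  by rewrite ltr_wpDl ?sqr_ge0// exprn_gt0// mulr_gt0// mulr_gt0.
have n0 : 4 * (pi / 2 - x) * x ^+ 2 != 0.
  by rewrite !mulf_neq0 ?expf_neq0 ?gt_eqF.
have d0 := lt0r_neq0 D0.
apply/eqP; rewrite (eqr_div _ _ n0 d0); apply/eqP.
by rewrite E; move: (pi / 2 - x) => w; ring.
Qed.

Lemma xw_bounds x w : xa <= x <= xb ->
  (128 + (54 + (66 + 40 / 100) / 100) / 100) / 100 <= w
    <= (128 + (54 + (66 + 80 / 100) / 100) / 100) / 100 ->
  (36 + (67 + (81 + 60 / 100) / 100) / 100) / 100 <= x * w
    <= (36 + (67 + (82 + 20 / 100) / 100) / 100) / 100.
Proof.
set wa := (X in X <= w); set wb := (X in _ <= w <= X).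
have xa0 : 0 <= xa by rewrite /xa; lra.
have wa0 : 0 <= wa by rewrite /wa; lra.
have h1 : (36 + (67 + (81 + 60 / 100) / 100) / 100) / 100 <= xa * wa.
  by rewrite /xa /wa; lra.
have h2 : xb * wb <= (36 + (67 + (82 + 20 / 100) / 100) / 100) / 100.
  by rewrite /xb /wb; lra.
move=> /andP[x1 x2] /andP[w1 w2]; apply/andP; split.
- by apply: (le_trans h1); apply: ler_pM.
- by apply: le_trans h2; apply: ler_pM; rewrite ?(le_trans xa0 x1) ?(le_trans wa0 w1).
Qed.

Lemma lambda2_bounds x : is_xi2 x -> xa <= x <= xb ->
  (69 + (70 + 63 / 100) / 100) / 100 < profile x < (69 + (70 + 68 / 100) / 100) / 100.
Proof.
move=> xx; rewrite (lambda2E xx) /xa /xb => /andP[x1 x2].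
have /andP[p1 p2] := pi_bounds R.
have [w wE] : exists w, pi / 2 - x = w by eexists.
have [A AE] : exists A, pi - 3 * x = A by eexists.
rewrite wE AE.
have w1 : (128 + (54 + (66 + 40 / 100) / 100) / 100) / 100 <= w by rewrite -wE; lra.
have w2 : w <= (128 + (54 + (66 + 80 / 100) / 100) / 100) / 100 by rewrite -wE; lra.
have A1 : (228 + (56 + (2 + 90 / 100) / 100) / 100) / 100 <= A by rewrite -AE; clear -p1 x2; lra.
have A2 : A <= (228 + (56 + (3 + 90 / 100) / 100) / 100) / 100 by rewrite -AE; clear -p2 x1; lra.
have /andP[r1 r2] := xw_bounds (introT andP (conj x1 x2)) (introT andP (conj w1 w2)).
move: (x * w) r1 r2 => r r1 r2.
have A0 : 0 <= A by clear -A1; lra.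
have r0 : 0 <= r by clear -r1; lra.
clear p1 p2 x1 x2 wE AE xx.
have sq (a b : R) : 0 <= a -> a <= b -> a ^+ 2 <= b ^+ 2.
  by move=> a0 ab; rewrite lerXn2r ?nnegrE// (le_trans a0).
have R2 := sq _ _ r0 r2; have B2 := sq _ _ A0 A2.
have R1 : ((36 + (67 + (81 + 60 / 100) / 100) / 100) / 100) ^+ 2 <= r ^+ 2.
  by apply: (sq _ _ _ r1); clear -r0; lra.
have B1 : ((228 + (56 + (2 + 90 / 100) / 100) / 100) / 100) ^+ 2 <= A ^+ 2.
  by apply: (sq _ _ _ A1); clear -r0; lra.
have D0 : 0 < A ^+ 2 + (4 * r) ^+ 2.
  by rewrite exprMn; clear -B1 R1; lra.
clear -D0 w1 w2 R1 R2 B1 B2.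
by rewrite ltr_pdivlMr// ltr_pdivrMr// exprMn; apply/andP; split;
  [clear -w1 R2 B2|clear -w2 R1 B1]; lra.
Qed.

Lemma exists_xi2 : exists2 x : R, is_xi2 x /\ xa <= x <= xb &
  (69 + (70 + 63 / 100) / 100) / 100 < lambda x < (69 + (70 + 68 / 100) / 100) / 100.
Proof.
have [x xx xab] := crit_root; exists x => //.
by rewrite lambdaE; exact: lambda2_bounds.
Qed.

End CriticalPoint.

(** * Norms and exponential rates *)

Section LpBounds.
Context (R : realType).
Let mu := @lebesgue_measure R.

(* The integral of a nonnegative function is a supremum over simple functions,
   so measurability is not needed here. *)
Lemma ge0_le_integralT (f g : R -> \bar R) :
  (forall x, 0 <= f x)%E -> (forall x, f x <= g x)%E ->
  (\int[mu]_x f x <= \int[mu]_x g x)%E.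
Proof.
move=> f0 fg.
have g0 x : (0 <= g x)%E by exact: le_trans (f0 x) (fg x).
rewrite !ge0_integralTE//; apply: le_ereal_sup => _ [h hf <-]; exists h => //= x.
exact: le_trans (hf x) (fg x).
Qed.

Lemma integral_oneDsqrV :
  (\int[mu]_x ((oneDsqr x)^-1)%:E = (pi : R)%:E)%E.
Proof.
rewrite ge0_symfun_integralT//.
- rewrite -set_itvcy integral0y_oneDsqr -EFinM; congr EFin; lra.
- exact: continuous_oneDsqrV.
- by move=> x /=; rewrite /oneDsqr sqrrN.
Qed.

Definition pnorm (p : R) (g : R -> complex R) :=
  Lnorm mu p%:E (fun w => (Normc.normc (g w))%:E).

Lemma normc_ge0 (z : complex R) : 0 <= Normc.normc z.
Proof. by case: z => a b; exact: sqrtr_ge0. Qed.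

Lemma pnormE (p : R) (g : R -> complex R) :
  pnorm p g = ((\int[mu]_x ((Normc.normc (g x)) `^ p)%:E) `^ p^-1)%E.
Proof.
rewrite /pnorm unlock; apply: (congr1 (fun I => (I `^ p^-1)%E)); apply: eq_integral => x _.
by rewrite -poweR_EFin /= ger0_norm// normc_ge0.
Qed.

(** |g|^p is compared with K / (1 + w^2), whose integral is exactly K pi. *)
Lemma pnorm_le (p K : R) (g : R -> complex R) : 0 < p -> 0 <= K ->
  (forall w, Normc.normc (g w) `^ p * (1 + w ^+ 2) <= K) ->
  (pnorm p g <= ((K * pi) `^ p^-1)%:E)%E.
Proof.
move=> p0 K0 gK; rewrite pnormE -poweR_EFin.
have p'0 : 0 <= p^-1 by rewrite invr_ge0 ltW.
have le1 : (\int[mu]_x ((Normc.normc (g x)) `^ p)%:E <= (K * pi)%:E)%E.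
  rewrite EFinM -integral_oneDsqrV -ge0_integralZl//=; first last.
  - apply/measurable_realfun.measurable_EFinP; apply: measurable_realfun.continuous_measurable_fun.
    exact: continuous_oneDsqrV.
  apply: ge0_le_integralT => x; first by rewrite lee_fin powR_ge0.
  rewrite -EFinM lee_fin ler_pdivlMr; first exact: gK.
  exact: lt_le_trans ltr01 (oneDsqr_ge1 x).
have int0 : (0 <= \int[mu]_x ((Normc.normc (g x)) `^ p)%:E)%E.
  by apply: integral_ge0 => x _; rewrite lee_fin powR_ge0.
apply: gt0_ler_poweR => //; rewrite in_itv/= leey andbT//.
exact: le_trans int0 le1.
Qed.

Lemma LpnormC_le (p K : R) (g : R -> complex R) : 0 < p -> 0 <= K ->
  (forall w, Normc.normc (g w) `^ p * (1 + w ^+ 2) <= K) ->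
  LpnormC p g <= (K * pi) `^ p^-1.
Proof.
move=> p0 K0 gK; have := pnorm_le p0 K0 gK; rewrite /LpnormC -/mu -/(pnorm p g).
have : (0 <= pnorm p g)%E by exact: Lnorm_ge0.
by case: (pnorm p g) => [r| |]//=; rewrite ?lee_fin.
Qed.

Lemma LpnormC_ge0 (p : R) (g : R -> complex R) : 0 <= LpnormC p g.
Proof. by apply: fine_ge0; exact: Lnorm_ge0. Qed.

(** The bound with K makes the norm finite: [fine] sends an infinite norm to 0, and then no lower
    bound could hold. *)
Lemma LpnormC_ge (p K c a b : R) (g : R -> complex R) : 0 < p -> 0 <= K ->
  (forall w, Normc.normc (g w) `^ p * (1 + w ^+ 2) <= K) ->
  a < b -> 0 <= c -> (forall w, a <= w <= b -> c <= Normc.normc (g w)) ->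
  c * (b - a) `^ p^-1 <= LpnormC p g.
Proof.
move=> p0 K0 gK ab c0 gc; have := pnorm_le p0 K0 gK.
rewrite /LpnormC -/mu -/(pnorm p g).
have p'0 : 0 <= p^-1 by rewrite invr_ge0 ltW.
have int0 : (0 <= \int[mu]_x ((Normc.normc (g x)) `^ p)%:E)%E.
  by apply: integral_ge0 => x _; rewrite lee_fin powR_ge0.
suff : ((c * (b - a) `^ p^-1)%:E <= pnorm p g)%E.
  by case: (pnorm p g) => [r| |]//=; rewrite ?lee_fin.
have -> : c * (b - a) `^ p^-1 = (c `^ p * (b - a)) `^ p^-1.
  rewrite powRM ?powR_ge0 ?subr_ge0 ?(ltW ab)//.
  by rewrite -powRrM divff ?gt_eqF// powRr1.
rewrite pnormE -poweR_EFin; apply: gt0_ler_poweR => //;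
  rewrite ?in_itv/= ?leey ?andbT//.
  by rewrite lee_fin mulr_ge0 ?powR_ge0 ?subr_ge0 ?(ltW ab).
have -> : ((c `^ p * (b - a))%:E =
    \int[mu]_x ((c `^ p)%:E * (\1_(`[a, b]%classic) x)%:E))%E.
  rewrite ge0_integralZl//=; first last.
  - by rewrite lee_fin powR_ge0.
  - apply/measurable_realfun.measurable_EFinP; exact: measurable_realfun.measurable_indic.
  rewrite integral_indic// setIT.
  rewrite [X in (_ = _ * X)%E](_ : _ = (b - a)%:E) ?EFinM//.
  have : lebesgue_measure (`[a, b] : set R) = (b - a)%:E.
    by rewrite lebesgue_measure_itv/= lte_fin ab.
  exact.
apply: ge0_le_integralT => x; first by rewrite -EFinM lee_fin mulr_ge0 ?powR_ge0.
rewrite -EFinM lee_fin indicE; case: (boolP (x \in _)) => /= xab; last by rewrite mulr0 powR_ge0.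
rewrite mulr1 ge0_ler_powR ?nnegrE ?(ltW p0)// ?normc_ge0//.
by apply: gc; move: xab; rewrite inE/= in_itv.
Qed.

(** For |w| >= X the ratio X / |w| is at most 1, so its power 2p with p > 1 is at most its square,
    which absorbs the weight 1 + w^2. *)
Lemma decay_bound (p K X : R) (g : R -> complex R) : 1 < p -> 0 <= K -> 1 <= X ->
  (forall w, `|w| <= X -> Normc.normc (g w) <= K) ->
  (forall w, X <= `|w| -> Normc.normc (g w) <= K * (X / `|w|) ^+ 2) ->
  forall w, Normc.normc (g w) `^ p * (1 + w ^+ 2) <= K `^ p * (2 * X ^+ 2).
Proof.
move=> p1 K0 X1 gin gout w.
have p0 : 0 < p by exact: lt_trans ltr01 p1.
have X0 : 0 < X by exact: lt_le_trans ltr01 X1.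
have wE : w ^+ 2 = `|w| ^+ 2 by rewrite real_normK// num_real.
have [wX|Xw] := leP `|w| X.
  apply: ler_pM; rewrite ?powR_ge0//.
  - by rewrite addr_ge0// sqr_ge0.
  - by rewrite ge0_ler_powR ?nnegrE ?normc_ge0 ?(ltW p0) ?gin.
  - rewrite wE mulr_natl mulr2n lerD ?lerXn2r ?nnegrE ?(ltW X0)//.
    by rewrite expr_ge1 // ltW.
have w0 : 0 < `|w| by exact: lt_trans X0 Xw.
set y := X / `|w|; have y0 : 0 < y by rewrite divr_gt0.
have y1 : y <= 1 by rewrite ler_pdivrMr// mul1r ltW.
apply: (@le_trans _ _ (K `^ p * y ^+ 2 * (1 + w ^+ 2))).
  apply: ler_wpM2r; first by rewrite addr_ge0// sqr_ge0.
  apply: (@le_trans _ _ ((K * y ^+ 2) `^ p)).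
    rewrite ge0_ler_powR ?nnegrE ?(ltW p0) ?normc_ge0 ?gout ?(ltW Xw)//.
    by rewrite mulr_ge0// sqr_ge0.
  rewrite powRM ?sqr_ge0// ler_wpM2l ?powR_ge0//.
  apply: ge1r_powR; last exact: ltW.
  by rewrite exprn_gt0//= exprn_ile1 ?(ltW y0).
rewrite -mulrA ler_wpM2l ?powR_ge0// mulrDr mulr1 mulr_natl mulr2n lerD//.
- rewrite (@le_trans _ _ 1)// ?exprn_ile1 ?(ltW y0)//.
  by rewrite expr_ge1 // ltW.
- by rewrite wE -exprMn /y divfK ?gt_eqF.
Qed.

Lemma expr_ge_eventually (q K : R) : 1 < q -> \forall m \near \oo, K <= q ^+ m.
Proof.
move=> q1; have q0 : 0 < q by exact: lt_trans ltr01 q1.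
have q'1 : `|q^-1| < 1 by rewrite gtr0_norm ?invr_gt0// invf_lt1.
pose M := `|K| + 1; have M0 : 0 < M by rewrite ltr_wpDl.
have := cvg_expr q'1 => /cvgrPdist_lt /(_ M^-1); rewrite invr_gt0 => /(_ M0).
apply: filterS => m; rewrite /= sub0r normrN gtr0_norm ?exprn_gt0 ?invr_gt0//.
rewrite exprVn ltf_pV2 ?posrE ?exprn_gt0// => /ltW; apply: le_trans.
by rewrite /M (le_trans (ler_norm _))// lerDl.
Qed.

Lemma root_cvg (u : nat -> R) (L : R) : 0 < L ->
  (exists2 C : R, 0 < C & \forall m \near \oo, u m <= C * L ^+ m) ->
  (forall l : R, 0 < l < L -> exists2 c : R, 0 < c &
      \forall m \near \oo, c * l ^+ m <= u m) ->
  (fun m : nat => u m `^ (m%:R^-1)) @ \oo --> L.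
Proof.
move=> L0 [C C0 uC] ul.
have root (x : R) (m : nat) : 0 <= x -> (0 < m)%N -> (x ^+ m) `^ (m%:R^-1) = x.
  move=> x0 m0; rewrite -powR_mulrn// -powRrM divff ?powRr1//.
  by rewrite pnatr_eq0 -lt0n.
have up (e : R) : 0 < e -> \forall m \near \oo, u m `^ (m%:R^-1) <= L + e.
  move=> e0; have [c c0 near_c] := ul (L / 2) ltac:(lra).
  have q1 : 1 < (L + e) / L by rewrite ltr_pdivlMr// mul1r ltrDl.
  near=> m; have m0 : (0 < m)%N by near: m; exact: nbhs_infty_gt.
  (* Real powers are not monotone at negative bases; a negative [u m] is excluded by the lower bound
     of rate L/2. *)
  have [um0|/ltW um0] := leP (u m) 0.
    move: um0; rewrite le_eqVlt => /predU1P[->|um0].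
      by rewrite powR0 ?addr_ge0 ?(ltW L0) ?(ltW e0)// invr_eq0 pnatr_eq0 -lt0n.
    have : c * (L / 2) ^+ m <= u m by near: m.
    have : 0 < c * (L / 2) ^+ m by rewrite mulr_gt0// exprn_gt0// divr_gt0.
    lra.
  rewrite -[leRHS](root _ m)// ?addr_ge0 ?(ltW L0) ?(ltW e0)//.
  rewrite ge0_ler_powR ?nnegrE ?invr_ge0//.
    by rewrite exprn_ge0// addr_ge0 ?(ltW L0) ?(ltW e0).
  apply: (@le_trans _ _ (C * L ^+ m)); first by near: m.
  rewrite -ler_pdivlMr ?exprn_gt0// -expr_div_n.
  by near: m; exact: expr_ge_eventually.
have lo (e : R) : 0 < e < L -> \forall m \near \oo, L - e <= u m `^ (m%:R^-1).
  move=> /andP[e0 eL]; pose l := L - e / 2.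
  have l0 : 0 < L - e by rewrite subr_gt0.
  have lL : 0 < l < L by rewrite /l; lra.
  have [c c0 near_c] := ul l lL.
  have q1 : 1 < l / (L - e) by rewrite ltr_pdivlMr// mul1r /l; lra.
  near=> m; have m0 : (0 < m)%N by near: m; exact: nbhs_infty_gt.
  have le_u : (L - e) ^+ m <= u m.
    apply: (@le_trans _ _ (c * l ^+ m)); last by near: m.
    have : c^-1 <= (l / (L - e)) ^+ m by near: m; exact: expr_ge_eventually.
    rewrite expr_div_n ler_pdivlMr ?exprn_gt0// => h.
    by rewrite mulrC -ler_pdivrMr// mulrC.
  rewrite -[leLHS](root _ m)// ?(ltW l0)//.
  rewrite ge0_ler_powR ?nnegrE ?invr_ge0 ?exprn_ge0 ?(ltW l0)//.
  by apply: le_trans le_u; rewrite exprn_ge0 ?ltW.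
apply/cvgrPdist_le => e e0; pose e' := Num.min e (L / 2).
have e'0 : 0 < e' by rewrite lt_min e0/=; lra.
have e'L : 0 < e' < L by rewrite e'0/= gt_min; apply/orP; right; lra.
have e'e : e' <= e by rewrite ge_min lexx.
near=> m; have h1 : u m `^ (m%:R^-1) <= L + e' by near: m; exact: up.
have h2 : L - e' <= u m `^ (m%:R^-1) by near: m; exact: lo.
by rewrite ler_norml; apply/andP; split; lra.
Unshelve. all: by end_near. Qed.

End LpBounds.

(** * Moduli of complex numbers and convergence of complex products *)

Section Complex.
Context (R : realType).
Implicit Types (z : R[i]) (s t : R).
Local Notation normc := (@Normc.normc R).

Lemma sqr_normc z : normc z ^+ 2 = complex.Re z ^+ 2 + complex.Im z ^+ 2.
Proof. by case: z => a b; rewrite sqr_sqrtr//= addr_ge0 ?sqr_ge0. Qed.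

Lemma normcX z n : normc (z ^+ n) = normc z ^+ n.
Proof.
elim: n => [|n IH]; first by rewrite !expr0 Normc.normc1.
by rewrite !exprS Normc.normcM IH.
Qed.

Lemma normc_real s : normc s%:C = `|s|.
Proof. by rewrite /= expr0n addr0 sqrtr_sqr. Qed.

Lemma normc_imag s : normc (0 +i* s) = `|s|.
Proof. by rewrite /= expr0n add0r sqrtr_sqr. Qed.

Lemma normc_prod (I : Type) (r : seq I) (F : I -> R[i]) :
  normc (\prod_(i <- r) F i) = \prod_(i <- r) normc (F i).
Proof.
by apply: (big_morph _ (@Normc.normcM R)); exact: Normc.normc1.
Qed.

Lemma normc_sum (I : Type) (r : seq I) (F : I -> R[i]) :
  normc (\sum_(i <- r) F i) <= \sum_(i <- r) normc (F i).
Proof.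
elim/big_rec2: _ => [|i y z _ IH]; first by rewrite Normc.normc0.
by apply: le_trans (le_normcD _ _) _; rewrite lerD2l.
Qed.

Lemma ler_Re z : `|complex.Re z| <= normc z.
Proof.
rewrite -(@ler_pXn2r _ 2) ?nnegrE ?normc_ge0// sqr_normc.
by rewrite real_normK ?num_real// lerDl sqr_ge0.
Qed.

Lemma ler_Im z : `|complex.Im z| <= normc z.
Proof.
rewrite -(@ler_pXn2r _ 2) ?nnegrE ?normc_ge0// sqr_normc.
by rewrite real_normK ?num_real// lerDr sqr_ge0.
Qed.

Lemma expi0 : expi 0 = 1 :> R[i].
Proof. by rewrite /expi cos0 sin0. Qed.

Lemma expiD s t : expi (s + t) = expi s * expi t.
Proof.
rewrite /expi cosD sinD; apply/eqP; rewrite eq_complex /= eqxx/=; apply/eqP.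
by ring.
Qed.

Lemma expiX t n : expi t ^+ n = expi (n%:R * t).
Proof.
elim: n => [|n IH]; first by rewrite expr0 mul0r expi0.
by rewrite exprS IH -expiD -natr1 mulrDl mul1r addrC.
Qed.

Lemma normc_expi t : normc (expi t) = 1.
Proof. by rewrite /= cos2Dsin2 sqrtr1. Qed.

Lemma normc_expi_sub1 t : normc (expi t - 1) = 2 * `|sin (t / 2)|.
Proof.
rewrite -[RHS]ger0_norm ?mulr_ge0// -sqrtr_sqr /=.
congr (Num.sqrt _).
have tE : t = (t / 2) *+ 2 by rewrite -mulr_natr; lra.
rewrite {1 2}tE cos_mulr2n sin_mulr2n exprMn real_normK ?num_real//.
have := cos2sin2 (t / 2); move: (cos _) (sin _) => c s c2.
rewrite c2 oppr0 addr0 (_ : (c * s *+ 2) ^+ 2 = 4 * c ^+ 2 * s ^+ 2); last by ring.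
by rewrite c2; ring.
Qed.

Lemma abs_sin_le t : `|sin t| <= `|t|.
Proof.
wlog t0 : t / 0 <= t.
  move=> h; have [|t0] := leP 0 t; first exact: h.
  by rewrite -normrN -sinN -[leRHS]normrN; apply: h; rewrite oppr_ge0 ltW.
have [t1|t1] := leP 1 t.
  by rewrite (le_trans (sin_max t))// ger0_norm.
have [_] := taylor_cos_sin 0 t0; rewrite expr1 mulN1r opprB subr_ge0 /= => h.
have pi2 := pi_ge2 R.
rewrite !ger0_norm// ?sin_ge0_pi//; first by move: h; rewrite double0; lra.
by rewrite t0/=; lra.
Qed.

Lemma cvg_geometric_step (u : nat -> R) (C : R) :
  (forall n, `|u n.+1 - u n| <= C * 2^-1 ^+ n) -> cvgn u.
Proof.
move=> uC.
have -> : u = (fun n => u 0%N + series (telescope u) n).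
  by apply/funext => n; exact: eq_sum_telescope.
apply: is_cvgD; first exact: is_cvg_cst.
apply: normed_cvg; apply: (@series_le_cvg _ _ (geometric C (2^-1))).
- by move=> n; rewrite normr_ge0.
- by move=> n; exact: le_trans (normr_ge0 _) (uC n).
- by move=> n; exact: uC.
- apply: is_cvg_geometric_series; rewrite ger0_norm ?invr_ge0//; lra.
Qed.

(** Consecutive products differ by [P n] times F (n+1) - 1, hence by geometrically small amounts;
    both components converge, and the modulus passes to the limit by continuity. *)
Lemma cvg_prodC (F : nat -> R[i]) (K : R) :
  (forall n, normc (F n) <= 1) ->
  (forall n, normc (F n - 1) <= K * 2^-1 ^+ n) ->
  let P := fun n => \prod_(1 <= l < n.+1) F l in
  (fun n => normc (P n)) @ \oo --> normc (Clim P).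
Proof.
move=> F1 FK P.
have P1 n : normc (P n) <= 1.
  rewrite /P normc_prod; elim: n => [|n IH]; first by rewrite big_geq.
  by rewrite big_nat_recr//= mulr_ile1 ?normc_ge0// prodr_ge0// => i _; exact: normc_ge0.
have PS n : normc (P n.+1 - P n) <= K / 2 * 2^-1 ^+ n.
  rewrite /P big_nat_recr//= -/(P n) -[X in _ - X]mulr1 -mulrBr Normc.normcM.
  apply: (@le_trans _ _ (normc (F n.+1 - 1))); last first.
    by apply: le_trans (FK n.+1) _; rewrite exprS mulrA.
  by rewrite ler_piMl ?normc_ge0.
have cRe : cvgn (fun n => complex.Re (P n)).
  apply: (@cvg_geometric_step _ (K / 2)) => n; apply: le_trans (PS n).
  by apply: le_trans (ler_Re _); case: (P n) (P n.+1) => a b [c d].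
have cIm : cvgn (fun n => complex.Im (P n)).
  apply: (@cvg_geometric_step _ (K / 2)) => n; apply: le_trans (PS n).
  by apply: le_trans (ler_Im _); case: (P n) (P n.+1) => a b [c d].
rewrite /Clim /=.
have -> : (fun n => normc (P n)) =
    (fun n => Num.sqrt (complex.Re (P n) ^+ 2 + complex.Im (P n) ^+ 2)).
  by apply/funext => n; case: (P n).
have h : (complex.Re (P n) ^+ 2 + complex.Im (P n) ^+ 2) @[n --> \oo] -->
    limn (fun n => complex.Re (P n)) ^+ 2 + limn (fun n => complex.Im (P n)) ^+ 2.
  by apply: cvgD; apply: cvgM; exact: cRe || exact: cIm.
exact: (cvg_comp _ _ h (@sqrt_continuous R _)).
Qed.

End Complex.

(** * Daubechies wavelets *)

Section FTC.
Context (R : realType).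
Let mu := @lebesgue_measure R.

Lemma integral_FTC (f F : R -> R) (a b : R) : a <= b -> continuous f ->
  (forall x : R, is_derive x 1 F (f x)) ->
  \int[mu]_(x in `[a, b]) f x = F b - F a.
Proof.
rewrite le_eqVlt => /predU1P[<-|ab] cf dF.
  by rewrite set_itv1 Rintegral_set1 subrr.
have cF : continuous F.
  by move=> x; apply: differentiable_continuous; apply/derivable1_diffP; have [] := dF x.
rewrite /Rintegral (@continuous_FTC2 _ f F)//.
- exact: continuous_subspaceT.
- split.
  + by move=> x _; have [] := dF x.
  + by apply: cvg_at_right_filter; exact: cF.
  + by apply: cvg_at_left_filter; exact: cF.
- by move=> x _; rewrite derive1E; have [_ ->] := dF x.
Qed.

Lemma int0_FTC (f F : R -> R) (t : R) : continuous f ->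
  (forall x : R, is_derive x 1 F (f x)) -> int0 f t = F t - F 0.
Proof.
move=> cf dF; rewrite /int0; case: ifPn => t0; first exact: integral_FTC.
by rewrite integral_FTC ?opprB// ltW// ltNge.
Qed.

End FTC.

Section Mask.
Context (R : realType).
Implicit Types x t : R.

(* The odd primitive of (1 - x^2)^n, by its reduction formula. *)
Fixpoint prim (n : nat) x : R :=
  if n is k.+1 then
    (x * (1 - x ^+ 2) ^+ k.+1 + 2 * k.+1%:R * prim k x) / (2 * k.+1%:R + 1)
  else x.

Lemma deriv_prim n x : is_derive x 1 (prim n) ((1 - x ^+ 2) ^+ n).
Proof.
elim: n => [|n IH]; first by rewrite expr0; exact: did.
change (is_derive x 1 (fun y => (y * (1 - y ^+ 2) ^+ n.+1 + 2 * n.+1%:R * prim n y) / (2 * n.+1%:R + 1)) ((1 - x ^+ 2) ^+ n.+1)).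
deriv.
have n0 : 2 * n.+1%:R + 1 != 0 :> R by rewrite gt_eqF// addr_gt0// mulr_gt0// ltr0n.
rewrite exprS; move: (n.+1%:R) ((1 - x ^+ 2) ^+ n) n0 => N v n0.
by field.
Qed.

Lemma prim0 n : prim n 0 = 0.
Proof. by elim: n => [|n IH] //=; rewrite IH mul0r mulr0 addr0 mul0r. Qed.

Lemma primN n x : prim n (- x) = - prim n x.
Proof.
elim: n => [|n IH] //=; by rewrite IH sqrrN -[RHS]mulNr opprD mulrN [- x * _]mulNr.
Qed.

Lemma prim_nondecr n x y : -1 <= x -> x <= y -> y <= 1 -> prim n x <= prim n y.
Proof.
move=> x1 xy y1; apply: (derive_ge0_le xy (fun z _ => deriv_prim n z)).
move=> z /andP[xz zy]; rewrite exprn_ge0// subr_ge0 -real_normK ?num_real//.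
by rewrite exprn_ile1// ler_norml; apply/andP; split; lra.
Qed.

Lemma prim1_gt0 n : 0 < prim n 1.
Proof.
elim: n => [|n IH] /=; first by [].
by rewrite expr1n subrr exprS mul0r mulr0 add0r divr_gt0 ?addr_gt0 ?mulr_gt0 ?ltr0n.
Qed.

Lemma prim1_le1 n : prim n 1 <= 1.
Proof.
have : 0 <= (1 - prim n 1) - (0 - prim n 0).
  rewrite subr_ge0.
  have dp (x : R) : is_derive x 1 (fun y => y - prim n y) (1 - (1 - x ^+ 2) ^+ n).
    by have dp := deriv_prim n x; deriv.
  apply: (derive_ge0_le ler01 (fun z _ => dp z)) => z /andP[z0 z1].
  have z2 : z ^+ 2 <= 1 by rewrite exprn_ile1 ?(ltW z0) ?(ltW z1).
  have z2' : 0 <= z ^+ 2 by rewrite sqr_ge0.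
  rewrite subr_ge0 exprn_ile1//; lra.
by rewrite prim0; lra.
Qed.

(* [mask2 n (cos t)] is the squared modulus at t of the mask of order n + 1. *)
Definition mask2 n x : R := (1 + prim n x / prim n 1) / 2.

Lemma mask2N n x : mask2 n (- x) = 1 - mask2 n x.
Proof. by rewrite /mask2 primN; field; rewrite gt_eqF// prim1_gt0. Qed.

Lemma mask2_ge0 n x : -1 <= x <= 1 -> 0 <= mask2 n x.
Proof.
move=> /andP[x1 x2]; rewrite /mask2 divr_ge0//.
rewrite -lerBlDl sub0r ler_pdivlMr ?prim1_gt0// mulN1r -primN.
exact: prim_nondecr.
Qed.

Lemma mask2_le1 n x : -1 <= x <= 1 -> mask2 n x <= 1.
Proof.
move=> /andP[x1 x2]; rewrite -subr_ge0 -mask2N mask2_ge0//; apply/andP; split; lra.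
Qed.

Lemma mask2_ge_half n x : 0 <= x <= 1 -> 1 / 2 <= mask2 n x.
Proof.
move=> /andP[x1 x2]; rewrite /mask2 ler_pM2r// lerDl divr_ge0 ?(ltW (prim1_gt0 n))//.
by rewrite -(prim0 n); apply: prim_nondecr => //; lra.
Qed.

(** The difference [D] is positive at 0 and zero at 1, and its derivative has the sign of a
    decreasing affine function, so it first increases and then decreases. *)
Lemma mask2_le n x : 0 <= x <= 1 -> 1 - mask2 n x <= (1 - x ^+ 2) ^+ n.+1.
Proof.
move=> /andP[x0 x1]; have p1 := prim1_gt0 n.
pose D y := (1 - y ^+ 2) ^+ n.+1 - (1 - mask2 n y).
have dD (y : R) : is_derive y 1 D ((1 - y ^+ 2) ^+ n * ((2 * prim n 1)^-1 - 2 * n.+1%:R * y)).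
  have dp := deriv_prim n y.
  rewrite /D /mask2; deriv.
  by field; rewrite gt_eqF.
rewrite -subr_ge0 -/(D x).
have w (z : R) : 0 <= z -> z <= 1 -> 0 <= (1 - z ^+ 2) ^+ n.
  by move=> z0 z1; rewrite exprn_ge0// subr_ge0 exprn_ile1.
have N0 : 0 < n.+1%:R :> R by rewrite ltr0n.
have [le1|lt1] := leP (2 * n.+1%:R * x) (2 * prim n 1)^-1.
- apply: (@le_trans _ _ (D 0)).
    by rewrite /D /mask2 prim0 expr0n subr0 expr1n; lra.
  apply: (derive_ge0_le x0 (fun z _ => dD z)) => z /andP[z0 zx].
  rewrite mulr_ge0 ?w ?(ltW z0) ?(le_trans (ltW zx))// subr_ge0.
  by apply: le_trans le1; rewrite ler_pM2l ?mulr_gt0// ltW.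
- have -> : 0 = D 1.
    by rewrite /D /mask2 expr1n subrr exprS mul0r divff ?gt_eqF//; field.
  rewrite -lerN2.
  have dND (z : R) : is_derive z 1 (fun y => - D y) (- ((1 - z ^+ 2) ^+ n * ((2 * prim n 1)^-1 - 2 * n.+1%:R * z))).
    by apply: dN.
  apply: (derive_ge0_le x1 (fun z _ => dND z)) => z /andP[xz z1].
  rewrite -mulrN mulr_ge0 ?w ?(ltW z1) ?(le_trans x0 (ltW xz))// oppr_ge0 subr_le0.
  by apply: (le_trans (ltW lt1)); rewrite ler_pM2l ?mulr_gt0// ltW.
Qed.

(** The divisor in [D] is chosen so that its derivative is a nonnegative multiple of 1 - y; [D] then
    increases to its value 0 at 1. The lost factor 1/m disappears under the m-th root. *)
Lemma mask2_ge n x : 0 <= x <= 1 ->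
  (1 - x ^+ 2) ^+ n.+1 / (4 * n.+1%:R) <= 1 - mask2 n x.
Proof.
move=> /andP[x0 x1]; have p1 := prim1_gt0 n.
have N0 : 0 < n.+1%:R :> R by rewrite ltr0n.
pose D y := (1 - y ^+ 2) ^+ n.+1 / (4 * n.+1%:R * prim n 1) - (1 - mask2 n y).
have dD (y : R) : is_derive y 1 D ((1 - y ^+ 2) ^+ n / (2 * prim n 1) * (1 - y)).
  have dp := deriv_prim n y.
  rewrite /D /mask2; deriv.
  move: (n.+1%:R) N0 => N N0.
  by field; rewrite !gt_eqF.
apply: (@le_trans _ _ ((1 - x ^+ 2) ^+ n.+1 / (4 * n.+1%:R * prim n 1))).
  rewrite ler_wpM2l ?exprn_ge0 ?subr_ge0 ?exprn_ile1//.
  rewrite lef_pV2 ?posrE ?mulr_gt0// -[leRHS]mulr1 ler_pM2l ?mulr_gt0//.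
  exact: prim1_le1.
rewrite -subr_le0 -/(D x).
have -> : 0 = D 1.
  by rewrite /D /mask2 expr1n subrr exprS !mul0r divff ?gt_eqF//; field.
apply: (derive_ge0_le x1 (fun z _ => dD z)) => z /andP[xz z1].
have z0 : 0 <= z by exact: le_trans x0 (ltW xz).
by rewrite mulr_ge0 ?divr_ge0 ?exprn_ge0 ?mulr_ge0 ?subr_ge0 ?exprn_ile1 ?(ltW z1) ?(ltW p1).
Qed.

(* The m-th root of [mask2] tends to [envelope], which bounds it for all m. *)
Definition envelope x : R := if 0 <= x then 1 else 1 - x ^+ 2.

Lemma mask2_le_envelope n x : -1 <= x <= 1 -> mask2 n x <= envelope x ^+ n.+1.
Proof.
move=> x1; rewrite /envelope; case: ifPn => x0; first by rewrite expr1n mask2_le1.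
rewrite -ltNge in x0; move/andP: x1 => [x1 _].
have := @mask2_le n (- x); rewrite mask2N sqrrN opprB addrC subrK; apply.
by apply/andP; split; lra.
Qed.

(** Here x = cos t, the second argument is cos 2t and (1 + x) / 2 is cos(t/2)^2. The tightest case
    has both cosines negative and amounts to 4 (1 - x)^2 (1 + x) <= 5, whose left side peaks at
    128/27, so 10 is nearly the least constant. *)
Lemma envelope_pair x : -1 <= x <= 1 ->
  envelope x * envelope (2 * x ^+ 2 - 1) <= 10 * (((1 + x) / 2) * x ^+ 2).
Proof.
move=> /andP[x1 x2]; rewrite /envelope.
have [x0|x0] := leP 0 x; have [y0|y0] := leP 0 (2 * x ^+ 2 - 1).
- have : 0 <= x * x ^+ 2 by rewrite mulr_ge0 ?sqr_ge0.
  rewrite mulr1; lra.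
- rewrite mul1r (_ : _ * (_ * _) = 4 * x ^+ 2 * (1 - x ^+ 2) + x ^+ 2 * (1 + x) * (1 + 4 * x)); last by field.
  rewrite (_ : 1 - _ ^+ 2 = 4 * x ^+ 2 * (1 - x ^+ 2)); last by ring.
  by rewrite lerDl !mulr_ge0 ?sqr_ge0//; lra.
- rewrite mulr1 -subr_ge0 (_ : _ - _ = (1 + x) * (5 * x ^+ 2 - (1 - x))); last by field.
  by rewrite mulr_ge0; lra.
- rewrite -subr_ge0 (_ : _ - _ = x ^+ 2 * (1 + x) * ((1 + 2 * x) ^+ 2 - 4 * x ^+ 3)); last by field.
  rewrite mulr_ge0//; first by rewrite mulr_ge0 ?sqr_ge0//; lra.
  rewrite addr_ge0 ?sqr_ge0//.
  have : 0 <= - x * x ^+ 2 by rewrite mulr_ge0 ?sqr_ge0//; lra.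
  by rewrite [x ^+ 3]exprS; lra.
Qed.

(** Since sin^(2n) = (1 - cos^2)^n, a primitive of sin^(2n+1) is [- prim n (cos y)]; oddness of
    [prim] turns its value at pi into the normalizing constant. *)
Lemma normc_mask (m : nat) (H : R -> complex R) t : (0 < m)%N ->
  is_daubechies_mask m H -> Normc.normc (H t) ^+ 2 = mask2 m.-1 (cos t).
Proof.
case: m => // n _ [_ -> _]; rewrite [n.+1.-1]/=.
pose F (y : R) := - prim n (cos y).
have sE : (2 * n.+1).-1 = (2 * n).+1 by rewrite mulnS.
have dF (y : R) : is_derive y 1 F (sin y ^+ (2 * n.+1).-1).
  rewrite /F sE; have dc := dN (dcompose (is_derive_cos y) (deriv_prim n (cos y))).
  apply: (is_derive_eq dc).
  by rewrite -sin2cos2 -exprM mulrN opprK -exprSr.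
have cs : continuous (fun y : R => sin y ^+ (2 * n.+1).-1).
  move=> y; apply: differentiable_continuous; apply/derivable1_diffP.
  by have [] := dX (2 * n.+1).-1 (is_derive_sin y).
rewrite !(int0_FTC _ cs dF) /F cospi cos0 /mask2 primN.
move: (prim n 1) (prim n (cos t)) (prim1_gt0 n) => a b a0.
rewrite !opprK (_ : a + a = 2 * a); last by ring.
by field; rewrite gt_eqF.
Qed.

End Mask.

(** * The infinite product of masks: lower bound near the origin and decay *)

Section MaskProduct.
Context (R : realType) (m : nat) (H : R -> R[i]).
Hypotheses (m0 : (0 < m)%N) (hH : is_daubechies_mask m H).
Implicit Types t w : R.
Local Notation normc := (@Normc.normc R).

Lemma cosI t : -1 <= cos t <= 1.
Proof. by rewrite cos_geN1 cos_le1. Qed.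

Lemma mask_sqr t : normc (H t) ^+ 2 = mask2 m.-1 (cos t).
Proof. exact: normc_mask. Qed.

Lemma mask_le1 t : normc (H t) <= 1.
Proof.
rewrite -(@ler_pXn2r _ 2) ?nnegrE ?normc_ge0// expr1n mask_sqr.
by apply: mask2_le1; exact: cosI.
Qed.

(** The constant comes from the coefficients of the mask and depends on m; it serves the convergence
    of the product for each fixed m, while all uniform estimates use the modulus. *)
Lemma mask_lipschitz : exists2 K, 0 <= K & forall t, normc (H t - 1) <= K * `|t|.
Proof.
have [[L [h hE]] _ H0] := hH.
exists (\sum_(0 <= nu < L.+1) normc (h nu) * nu%:R).
  by apply: sumr_ge0 => i _; rewrite mulr_ge0// normc_ge0.
move=> t; rewrite -H0 !hE -sumrB mulr_suml.
apply: le_trans (normc_sum _ _) _; apply: ler_sum => i _.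
rewrite mulr0 oppr0 expi0 -mulrBr Normc.normcM -mulrA ler_wpM2l ?normc_ge0//.
rewrite normc_expi_sub1.
have := abs_sin_le (- (i%:R * t) / 2).
rewrite normrM normrN normrM normr_nat [`|2^-1|]ger0_norm ?invr_ge0//; lra.
Qed.

Definition mprod w (n : nat) := \prod_(1 <= l < n.+1) H (2 ^- l.+1 * w).

Lemma mprod_cvg w : (fun n => normc (mprod w n)) @ \oo --> normc (Clim (mprod w)).
Proof.
have [K K0 KH] := mask_lipschitz.
apply: (@cvg_prodC _ (fun l => H (2 ^- l.+1 * w)) (K * (2^-1 * `|w|))) => n.
  exact: mask_le1.
apply: le_trans (KH _) _; rewrite -!mulrA ler_wpM2l//.
rewrite normrM ger0_norm ?invr_ge0 ?exprn_ge0// -exprVn exprS -!mulrA.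
by rewrite [_ * `|w|]mulrC.
Qed.

Lemma mprod_sqr w n : normc (mprod w n) ^+ 2 =
  \prod_(1 <= l < n.+1) mask2 m.-1 (cos (2 ^- l.+1 * w)).
Proof.
rewrite /mprod normc_prod -prodrXl.
by apply: eq_bigr => l _; rewrite mask_sqr.
Qed.

Lemma mprod_le1 w n : normc (mprod w n) <= 1.
Proof.
rewrite /mprod normc_prod; elim: n => [|n IH]; first by rewrite big_geq.
by rewrite big_nat_recr//= mulr_ile1 ?normc_ge0 ?mask_le1// prodr_ge0// => i _; exact: normc_ge0.
Qed.

Lemma mprod_nincr w n k : (n <= k)%N -> normc (mprod w k) <= normc (mprod w n).
Proof.
move=> /subnK <-; elim: (k - n)%N => [|j IH] //.
rewrite addSn; apply: le_trans IH.
rewrite /mprod big_nat_recr//= Normc.normcM ler_piMr ?normc_ge0//.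
exact: mask_le1.
Qed.

Lemma phi_le w n : normc (Clim (mprod w)) <= normc (mprod w n).
Proof.
have <- : lim ((fun n => normc (mprod w n)) @ \oo) = normc (Clim (mprod w)).
  by apply: cvg_lim => //; exact: mprod_cvg.
apply: limr_le.
  by apply/cvg_ex; eexists; exact: mprod_cvg.
by exists n => // k /= nk; exact: mprod_nincr.
Qed.

Lemma phi_ge w c : (forall n, c <= normc (mprod w n)) -> c <= normc (Clim (mprod w)).
Proof.
move=> cP; have <- : lim ((fun n => normc (mprod w n)) @ \oo) = normc (Clim (mprod w)).
  by apply: cvg_lim => //; exact: mprod_cvg.
apply: limr_ge.
  by apply/cvg_ex; eexists; exact: mprod_cvg.
by near=> n; exact: cP.
Unshelve. all: by end_near. Qed.

Lemma phi_le1 w : normc (Clim (mprod w)) <= 1.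
Proof. exact: le_trans (phi_le w 0) (mprod_le1 w 0). Qed.

(** The first argument is at most pi/2 in modulus, where the squared mask is at least 1/2. At every
    later argument t it is at least 1 - t^2, uniformly in m, and these t^2 decrease geometrically.
    The resulting bound 1/12 exceeds (1/4)^2. *)
Lemma phi_ge_quarter w : `|w| <= 2 * pi -> 1 / 4 <= normc (Clim (mprod w)).
Proof.
move=> wpi; apply: phi_ge => n.
apply: (@le_trans _ _ (normc (mprod w n.+1))); last exact: mprod_nincr.
rewrite -(@ler_pXn2r _ 2) ?nnegrE ?normc_ge0// mprod_sqr.
have p2 := pi_bounds R.
rewrite big_ltn//.
have h1 : 1 / 2 <= mask2 m.-1 (cos (2 ^- 2 * w)).
  apply: mask2_ge_half; rewrite cos_le1 andbT; apply: cos_ge0_pihalf.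
  by rewrite -ler_norml normrM ger0_norm ?invr_ge0 ?exprn_ge0//; lra.
(* The new factor is at least 1 - 5q/8 with q = 4^-n, because pi^2 / 16 < 5/8. The invariant
   survives since (1/6 + 5q/6)(1 - 5q/8) - (1/6 + 5q/24) = 25 q (1 - q) / 48. *)
have h2 : 1 / 6 + 5 / 6 * (1 / 4) ^+ n <=
    \prod_(2 <= l < n.+2) mask2 m.-1 (cos (2 ^- l.+1 * w)).
  elim: n => [|n IH]; first by rewrite big_geq// expr0; lra.
  rewrite big_nat_recr//=.
  set t := 2 ^- n.+3 * w.
  have tE : t ^+ 2 <= 5 / 8 * (1 / 4) ^+ n.
    rewrite /t exprMn -exprVn -exprM [(n.+3 * 2)%N]mulnC exprM -[w ^+ 2]real_normK ?num_real//.
    have q4 : (2^-1 : R) ^+ 2 = 1 / 4 by field.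
    have -> : 5 / 8 * (1 / 4) ^+ n = (2^-1 ^+ 2) ^+ n.+3 * 40 :> R.
      by rewrite q4 !exprS; field.
    rewrite ler_wpM2l ?exprn_ge0 ?sqr_ge0//.
    apply: (@le_trans _ _ ((2 * pi) ^+ 2)); first by rewrite lerXn2r ?nnegrE ?mulr_ge0 ?pi_ge0.
    by move: p2; move: (pi : R) => P /andP[P1 P2]; nra.
  have t1 : t ^+ 2 <= 5 / 8 by apply: (le_trans tE); rewrite ler_piMr// exprn_ile1; lra.
  have m1 : 1 - 5 / 8 * (1 / 4) ^+ n <= mask2 m.-1 (cos t).
    have c0 : 0 <= cos t <= 1.
      rewrite cos_le1 andbT; apply: cos_ge0_pihalf; rewrite -ler_norml.
      have pih := pihalf_ge1 R; apply: le_trans pih.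
      rewrite -(@ler_pXn2r _ 2) ?nnegrE// real_normK ?num_real//; lra.
    have := mask2_le m.-1 c0; rewrite -sin2cos2 => h.
    suff : (sin t ^+ 2) ^+ m.-1.+1 <= t ^+ 2 by lra.
    apply: (@le_trans _ _ (sin t ^+ 2)).
      rewrite exprS ler_piMr ?sqr_ge0// exprn_ile1 ?sqr_ge0//.
    by rewrite -real_normK ?num_real// -[leRHS]real_normK ?num_real// lerXn2r ?nnegrE// abs_sin_le.
  have q0 : 0 <= (1 / 4 : R) ^+ n by rewrite exprn_ge0.
  have q1 : (1 / 4 : R) ^+ n <= 1 by rewrite exprn_ile1; lra.
  apply: (@le_trans _ _ ((1 / 6 + 5 / 6 * (1 / 4) ^+ n) * (1 - 5 / 8 * (1 / 4) ^+ n))).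
    rewrite exprS; move: ((1 / 4) ^+ n) q0 q1 => q q0 q1.
    by have : 0 <= q * (1 - q) by [rewrite mulr_ge0// subr_ge0]; lra.
  apply: ler_pM => //; lra.
apply: (@le_trans _ _ (1 / 2 * (1 / 6))); first by lra.
apply: ler_pM => //.
by apply: le_trans h2; rewrite lerDl mulr_ge0 ?exprn_ge0.
Qed.


(** Each induction step adds the factors at 2t and t and applies [envelope_pair] to both at once,
    hence the even number of factors. *)
Lemma prod_envelope w n :
  \prod_(1 <= l < n.*2.+1) envelope (cos (2 ^- l.+1 * w)) <=
  10 ^+ n * (\prod_(1 <= l < n.*2.+1) cos (2 ^- l.+2 * w)) ^+ 2.
Proof.
have env0 x : -1 <= x <= 1 -> 0 <= envelope x :> R.
  move=> /andP[x1 x2]; rewrite /envelope; case: ifP => //= _.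
  rewrite subr_ge0 -real_normK ?num_real// exprn_ile1// ler_norml.
  by rewrite x1.
elim: n => [|n IH]; first by rewrite !big_geq// expr0 expr1n mul1r.
rewrite doubleS !(@big_nat_recr _ _ _ n.*2.+2)//= !(@big_nat_recr _ _ _ n.*2.+1)//=.
set E := \prod_(1 <= i < n.*2.+1) envelope _ in IH *; set C := \prod_(_ <= _ < _) _ in IH *.
pose t := 2 ^- n.*2.+3 * w.
have t2 : 2 ^- n.*2.+2 * w = t *+ 2.
  by rewrite /t -mulr_natr -!exprVn [in RHS]exprS; field.
have th : 2 ^- n.*2.+4 * w = t / 2.
  by rewrite /t -!exprVn [in LHS]exprS; field.
rewrite -/t t2 th.
have c2 : cos (t / 2) ^+ 2 = (1 + cos t) / 2.
  have -> : cos t = cos ((t / 2) *+ 2) by congr cos; rewrite -mulr_natr; lra.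
  by rewrite cos_mulr2n; lra.
have := envelope_pair (cosI t).
rewrite (_ : 2 * cos t ^+ 2 - 1 = cos (t *+ 2)); last by rewrite cos_mulr2n; ring.
move=> h.
have -> : 10 ^+ n.+1 * (C * cos t * cos (t / 2)) ^+ 2 =
    (10 ^+ n * C ^+ 2) * (10 * ((1 + cos t) / 2 * cos t ^+ 2)).
  by rewrite !exprMn c2 exprS; ring.
rewrite -mulrA; apply: ler_pM => //.
- by apply: prodr_ge0 => i _; apply: env0; exact: cosI.
- by rewrite mulr_ge0 ?env0 ?cosI.
- by rewrite mulrC.
Qed.

Lemma viete w n : sin (2 ^- n.+2 * w) * \prod_(1 <= l < n.+1) cos (2 ^- l.+2 * w) * 2 ^+ n
  = sin (2 ^- 2 * w).
Proof.
elim: n => [|n IH]; first by rewrite big_geq// expr0 !mulr1.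
rewrite -IH big_nat_recr//= .
have -> : 2 ^- n.+2 * w = (2 ^- n.+3 * w) *+ 2.
  by rewrite -mulr_natr -!exprVn [in RHS]exprS; field.
by rewrite sin_mulr2n [2 ^+ n.+1]exprS; ring.
Qed.

(** After 2n factors Viete's product leaves the sine at |w| / 4^(n+1), a point of [1/4, 1] for this
    n, where the sine is at least 1/8. The squared product of cosines is then at most 64 / 16^n, and
    10^n / 16^n = (5/8)^n. *)
Lemma phi_decay w n : 4 ^+ n <= `|w| <= 4 ^+ n.+1 ->
  normc (Clim (mprod w)) ^+ 2 <= (64 * (5 / 8) ^+ n) ^+ m.
Proof.
move=> /andP[w1 w2].
apply: (@le_trans _ _ (normc (mprod w n.*2) ^+ 2)).
  by rewrite lerXn2r ?nnegrE ?normc_ge0// phi_le.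
rewrite mprod_sqr.
apply: (@le_trans _ _ ((\prod_(1 <= l < n.*2.+1) envelope (cos (2 ^- l.+1 * w))) ^+ m)).
  rewrite -prodrXl; apply: ler_prod => l _; rewrite mask2_ge0 ?cosI//=.
  by rewrite -[in leRHS](prednK m0) mask2_le_envelope ?cosI.
have env0 x : -1 <= x <= 1 -> 0 <= envelope x :> R.
  move=> /andP[x1 x2]; rewrite /envelope; case: ifP => //= _.
  rewrite subr_ge0 -real_normK ?num_real// exprn_ile1// ler_norml.
  by rewrite x1.
have E0 : 0 <= \prod_(1 <= l < n.*2.+1) envelope (cos (2 ^- l.+1 * w)).
  by apply: prodr_ge0 => i _; apply: env0; exact: cosI.
suff E1 : \prod_(1 <= l < n.*2.+1) envelope (cos (2 ^- l.+1 * w)) <= 64 * (5 / 8) ^+ n.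
  by rewrite lerXn2r ?nnegrE// (le_trans E0).
apply: le_trans (prod_envelope w n) _.
have := viete w n.*2.
set C := \prod_(_ <= _ < _) _; set s := sin (2 ^- n.*2.+2 * w) => V.
have four : 2 ^+ n.*2 = 4 ^+ n :> R by rewrite -mul2n exprM; congr (_ ^+ _); ring.
have f0 : 0 < 4 ^+ n :> R by rewrite exprn_gt0.
have sge : 1 / 8 <= `|s|.
  pose u := 2 ^- n.*2.+2 * `|w|.
  have -> : `|s| = `|sin u|.
    rewrite /s /u; have [wp|wn] := leP 0 w; first by rewrite [`|w|]ger0_norm.
    by rewrite [`|w|]ltr0_norm// mulrN sinN normrN.
  have uE : u = `|w| / 4 ^+ n / 4.
    by rewrite /u !exprS four; field; rewrite gt_eqF.
  have u1 : 1 / 4 <= u <= 1.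
    have l1 : 1 <= `|w| / 4 ^+ n by rewrite ler_pdivlMr// mul1r.
    have l2 : `|w| / 4 ^+ n <= 4 by rewrite ler_pdivrMr// -exprS.
    by rewrite uE; apply/andP; split; lra.
  move/andP: u1 => [u1 u2].
  have pih := pihalf_ge1 R; have /andP[p1 p2] := pi_bounds R.
  have := @sin_ge_chord R u; rewrite (le_trans _ u1)// (le_trans u2 pih) => /(_ isT) h.
  apply: le_trans (ler_norm _); apply: le_trans h.
  apply: (@le_trans _ _ (2 / pi * (1 / 4))); last first.
    by rewrite ler_wpM2l// divr_ge0 ?pi_ge0.
  by rewrite mulrAC ler_pdivlMr ?pi_gt0//; lra.
have CV : (s * C * 4 ^+ n) ^+ 2 <= 1.
  rewrite -four V -real_normK ?num_real// exprn_ile1// sin_max //.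
have s2 : 1 / 64 <= s ^+ 2.
  rewrite -real_normK ?num_real// (_ : 1 / 64 = (1 / 8) ^+ 2); last by field.
  by rewrite lerXn2r ?nnegrE.
have CC : C ^+ 2 * (4 ^+ n) ^+ 2 <= 64.
  have : 0 <= (C * 4 ^+ n) ^+ 2 by rewrite sqr_ge0.
  move: CV; rewrite !exprMn -mulrA => CV q0.
  have : (1 / 64) * (C ^+ 2 * (4 ^+ n) ^+ 2) <= s ^+ 2 * (C ^+ 2 * (4 ^+ n) ^+ 2) by rewrite ler_wpM2r.
  by lra.
have e10 : 10 ^+ n = (5 / 8) ^+ n * (4 ^+ n) ^+ 2 :> R.
  by rewrite -exprM mulnC exprM -exprMn; congr (_ ^+ _); field.
rewrite e10 -mulrA [_ ^+ 2 * C ^+ 2]mulrC.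
by rewrite [leRHS]mulrC ler_wpM2l// exprn_ge0.
Qed.

Lemma exists_pow4 w : 1 <= `|w| -> exists n, 4 ^+ n <= `|w| <= 4 ^+ n.+1.
Proof.
move=> w1; have h14 : (1 : R) < 4 by lra.
have [N _ hN] := expr_ge_eventually `|w| h14.
have ex : exists n, `|w| <= 4 ^+ n by exists N; apply: hN => /=.
case: (ex_minnP ex) => -[|n] hn hmin.
  by exists 0%N; rewrite expr0 w1/= (le_trans hn)// expr0 expr1; lra.
exists n; rewrite hn andbT leNgt; apply/negP => /ltW /hmin.
by rewrite ltnn.
Qed.

(** From (5/8)^3 <= 1/4, the twelfth power of the base is at most (64^3 / 4^n)^4 <= (4 * 64^3 /
    |w|)^4, and a square root is taken. Raising m beyond 12 helps if the base is at most 1;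
    otherwise the bound of the product by 1 suffices. *)
Lemma phi_decay2 w : (12 <= m)%N -> 4 * 64 ^+ 3 <= `|w| ->
  normc (Clim (mprod w)) <= (4 * 64 ^+ 3 / `|w|) ^+ 2.
Proof.
move=> m12 w1.
have w1' : 1 <= `|w| by apply: le_trans w1; rewrite !exprS expr0; lra.
have w0 : 0 < `|w| by exact: lt_le_trans w1'.
have [n wn] := exists_pow4 w1'.
have := phi_decay wn; set f := normc _ => fn.
have f1 : f ^+ 2 <= 1 by rewrite exprn_ile1 ?normc_ge0 ?phi_le1.
have a0 : 0 <= 64 * (5 / 8) ^+ n :> R by rewrite mulr_ge0 ?exprn_ge0.
have fn12 : f ^+ 2 <= (64 * (5 / 8) ^+ n) ^+ 12.
  have [a1|a1] := leP (64 * (5 / 8) ^+ n : R) 1.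
    apply: (le_trans fn); rewrite -(subnK m12) exprD ler_piMl ?exprn_ge0//.
    by rewrite exprn_ile1.
  by apply: (le_trans f1); rewrite expr_ge1// ltW.
have a2 : (64 * (5 / 8) ^+ n) ^+ 12 <= (64 ^+ 3 / 4 ^+ n) ^+ 4 :> R.
  rewrite -[12%N]/(3 * 4)%N exprM lerXn2r ?nnegrE ?exprn_ge0 ?divr_ge0 ?exprn_ge0//.
  rewrite exprMn ler_wpM2l ?exprn_ge0// -exprVn -exprM mulnC exprM.
  by rewrite lerXn2r ?nnegrE ?exprn_ge0 ?invr_ge0// !exprS expr0; lra.
have a3 : (64 ^+ 3 / 4 ^+ n) ^+ 4 <= (4 * 64 ^+ 3 / `|w|) ^+ 4 :> R.
  rewrite lerXn2r ?nnegrE ?divr_ge0 ?mulr_ge0 ?exprn_ge0//.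
  rewrite [4 * _]mulrC -[_ * 4 / _]mulrA ler_wpM2l ?exprn_ge0//.
  move/andP: wn => [_ wn].
  by rewrite ler_pdivlMr// mulrC ler_pdivrMr ?exprn_gt0// -exprS.
rewrite -(@ler_pXn2r _ 2) ?nnegrE ?normc_ge0 ?exprn_ge0 ?divr_ge0 ?mulr_ge0 ?exprn_ge0//.
by rewrite -exprM (le_trans fn12)// (le_trans a2).
Qed.

End MaskProduct.

Section Misc.
Context (R : realType).
Implicit Types w : R.
Local Notation normc := (@Normc.normc R).

Lemma normc_ipow w (m : nat) : normc ((0 +i* w) ^ (- m%:Z)) = `|w| ^- m.
Proof. by rewrite -exprz_inv -[_ ^ m%:Z]/(_ ^+ m) normcX Normc.normcV normc_imag exprVn. Qed.

Lemma sqrt2pi_ge1 : 1 <= Num.sqrt (2 * pi) :> R.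
Proof.
have p2 := pi_ge2 R.
by rewrite -[leLHS]sqrtr1 ler_wsqrtr//; lra.
Qed.

Lemma sqrt2piV_le1 : (Num.sqrt (2 * pi))^-1 <= 1 :> R.
Proof. by rewrite invf_le1 ?sqrt2pi_ge1// (lt_le_trans ltr01 sqrt2pi_ge1). Qed.

Lemma sqrt2piV_gt0 : 0 < (Num.sqrt (2 * pi))^-1 :> R.
Proof. by rewrite invr_gt0 (lt_le_trans ltr01 sqrt2pi_ge1). Qed.

Lemma root_div_cvg (u v : nat -> R) (a b : R) : (forall m, 0 <= u m) ->
  (forall m, 0 <= v m) -> b != 0 ->
  (fun m : nat => u m `^ (m%:R^-1)) @ \oo --> a ->
  (fun m : nat => v m `^ (m%:R^-1)) @ \oo --> b ->
  (fun m : nat => (u m / v m) `^ (m%:R^-1)) @ \oo --> a / b.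
Proof.
move=> u0 v0 b0 ua vb.
have -> : (fun m : nat => (u m / v m) `^ (m%:R^-1)) =
    (fun m : nat => u m `^ (m%:R^-1) * (v m `^ (m%:R^-1))^-1).
  apply/funext => m; rewrite powRM ?invr_ge0//; congr (_ * _).
  by rewrite -powR_inv1// -powRrM mulN1r powRN.
by apply: cvgM => //; apply: cvgV.
Qed.

(* Bernoulli: a factor 1/m costs only an arbitrarily small part of the rate. *)
Lemma expr_div_nat_ge (l l' : R) (m : nat) : 0 < l -> l < l' -> (0 < m)%N ->
  (l' / l - 1) * l ^+ m <= l' ^+ m / m%:R.
Proof.
move=> l0 ll' m0; have l'0 : 0 < l' by exact: lt_trans ll'.
have q1 : 1 < l' / l by rewrite ltr_pdivlMr// mul1r.
have mR : 0 < m%:R :> R by rewrite ltr0n.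
have bern : forall n : nat, 1 + n%:R * (l' / l - 1) <= (l' / l) ^+ n.
  elim=> [|n IH]; first by rewrite mul0r addr0 expr0.
  rewrite exprS; apply: (@le_trans _ _ (l' / l * (1 + n%:R * (l' / l - 1)))).
    rewrite -natr1; move: (l' / l) q1 => q q1.
    have : 0 <= (q - 1) * (n%:R * (q - 1)).
      by rewrite !mulr_ge0 ?subr_ge0 ?(ltW q1).
    by lra.
  by rewrite ler_wpM2l// ltW// (lt_trans ltr01).
rewrite ler_pdivlMr// mulrAC -ler_pdivlMr ?exprn_gt0// -expr_div_n.
by apply: le_trans (bern m); rewrite mulrC lerDr.
Qed.

End Misc.

(** * Bounds for the transforms of the Daubechies wavelet and of its m-th primitive *)

Section DaubechiesFT.
Context (R : realType) (m : nat) (H : R -> R[i]).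
Hypotheses (m0 : (0 < m)%N) (hH : is_daubechies_mask m H).
Implicit Types t w : R.
Local Notation normc := (@Normc.normc R).
Let k0 : R := (Num.sqrt (2 * pi))^-1.

Lemma normc_dft w : normc (daubechies_wavelet_ft H w) =
  k0 * normc (H (w / 2 + pi)) * normc (Clim (mprod H w)).
Proof.
by rewrite /daubechies_wavelet_ft !Normc.normcM normc_real ger0_norm.
Qed.

Lemma sqr_mask_shift w :
  normc (H (w / 2 + pi)) ^+ 2 = 1 - mask2 m.-1 (cos (w / 2)).
Proof. by rewrite (mask_sqr m0 hH) cosDpi mask2N. Qed.

Lemma normc_dft_le w : normc (daubechies_wavelet_ft H w) <= normc (H (w / 2 + pi)).
Proof.
rewrite normc_dft -[leRHS]mulr1 ler_pM ?mulr_ge0 ?normc_ge0 ?(ltW (sqrt2piV_gt0 _))//.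
  by rewrite ler_piMl ?normc_ge0// sqrt2piV_le1.
exact: (phi_le1 m0 hH).
Qed.

Lemma normc_dft_le1 w : normc (daubechies_wavelet_ft H w) <= 1.
Proof. exact: le_trans (normc_dft_le w) (mask_le1 m0 hH _). Qed.

Lemma normc_dft_decay w : (12 <= m)%N -> 4 * 64 ^+ 3 <= `|w| ->
  normc (daubechies_wavelet_ft H w) <= (4 * 64 ^+ 3 / `|w|) ^+ 2.
Proof.
move=> m12 wX; rewrite normc_dft; apply: le_trans (phi_decay2 m0 hH m12 wX).
rewrite ler_piMl ?normc_ge0// mulr_ile1 ?normc_ge0 ?sqrt2piV_le1 ?(mask_le1 m0 hH)//.
by rewrite ltW// sqrt2piV_gt0.
Qed.

(** On this interval cos(w/2) <= 0, so the shifted mask has squared modulus at least 1/2 while the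
    product is at least 1/4: no exponential loss occurs, and the rate 1 is attained. *)
Lemma normc_dft_ge w : pi <= w <= 2 * pi ->
  k0 / 8 <= normc (daubechies_wavelet_ft H w).
Proof.
move=> /andP[w1 w2]; have p0 := pi_gt0 R; rewrite normc_dft -mulrA ler_pM2l ?sqrt2piV_gt0//.
rewrite (_ : 8^-1 = 1 / 2 * (1 / 4)); last by field.
apply: ler_pM => //; last first.
  by apply: (phi_ge_quarter m0 hH); rewrite ger0_norm; lra.
rewrite -(@ler_pXn2r _ 2) ?nnegrE ?normc_ge0// sqr_mask_shift -mask2N.
apply: (@le_trans _ _ (1 / 2)); first by lra.
apply: mask2_ge_half; have /andP[c1 c2] := cosI (w / 2).
have : cos (w / 2) <= cos (pi / 2).
  rewrite leNgt ltr_cos ?in_itv/=; first by rewrite -leNgt; lra.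
    by apply/andP; split; lra.
  by apply/andP; split; lra.
by rewrite cos_pihalf => c0; apply/andP; split; lra.
Qed.

Lemma mask_shift_le w : `|w| <= pi -> normc (H (w / 2 + pi)) <= (`|w| / 2) ^+ m.
Proof.
move=> wpi.
rewrite -(@ler_pXn2r _ 2) ?nnegrE ?normc_ge0 ?exprn_ge0 ?divr_ge0// sqr_mask_shift.
have c0 : 0 <= cos (w / 2) <= 1.
  rewrite cos_le1 andbT; apply: cos_ge0_pihalf; rewrite -ler_norml.
  by rewrite normrM [`|2^-1|]ger0_norm ?invr_ge0//; lra.
apply: (le_trans (mask2_le m.-1 c0)); rewrite prednK// -sin2cos2.
have h : sin (w / 2) ^+ 2 <= (`|w| / 2) ^+ 2.
  rewrite -[sin _ ^+ 2]real_normK ?num_real// lerXn2r ?nnegrE ?divr_ge0//.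
  by apply: le_trans (abs_sin_le _) _; rewrite normrM [`|2^-1|]ger0_norm ?invr_ge0.
by rewrite -[leRHS]exprM [(m * 2)%N]mulnC [leRHS]exprM lerXn2r ?nnegrE ?sqr_ge0.
Qed.

Lemma mask_shift_ge w : 0 <= w <= pi ->
  sin (w / 2) ^+ m / (2 * m%:R) <= normc (H (w / 2 + pi)).
Proof.
move=> /andP[w0 wpi].
have s0 : 0 <= sin (w / 2) by apply: sin_ge0_pi; apply/andP; split; lra.
have mR : 1 <= m%:R :> R by rewrite ler1n.
have d0 : 0 <= 2 * m%:R :> R by lra.
rewrite -(@ler_pXn2r _ 2) ?nnegrE ?normc_ge0 ?divr_ge0 ?exprn_ge0//.
rewrite sqr_mask_shift.
have c0 : 0 <= cos (w / 2) <= 1.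
  rewrite cos_le1 andbT; apply: cos_ge0_pihalf; apply/andP; split; lra.
have := mask2_ge m.-1 c0; rewrite prednK// -sin2cos2; apply: le_trans.
rewrite expr_div_n -!exprM mulnC ler_wpM2l ?exprn_ge0//.
rewrite lef_pV2 ?posrE ?exprn_gt0//; first by rewrite exprMn expr2; nra.
all: by lra.
Qed.

Definition dnum w := (0 +i* w) ^ (- m%:Z) * daubechies_wavelet_ft H w.

Lemma normc_dnum w : normc (dnum w) = `|w| ^- m * normc (daubechies_wavelet_ft H w).
Proof. by rewrite /dnum Normc.normcM normc_ipow. Qed.

Lemma dnum_le w : `|w| <= pi -> normc (dnum w) <= (1 / 2) ^+ m.
Proof.
move=> wpi; rewrite normc_dnum.
(* At w = 0 the factor |w|^-m is 0 by the convention 0^-1 = 0. *)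
have [->|w0] := eqVneq w 0.
  by rewrite normr0 expr0n gtn_eqF// invr0 mul0r exprn_ge0.
have w0' : 0 < `|w| by rewrite normr_gt0.
rewrite -exprVn -ler_pdivlMl ?exprn_gt0 ?invr_gt0//.
apply: (le_trans (normc_dft_le w)); apply: (le_trans (mask_shift_le wpi)).
by rewrite -!exprVn invrK -exprMn div1r.
Qed.

Lemma dnum_decay w : (2 <= m)%N -> pi <= `|w| ->
  normc (dnum w) <= (1 / 2) ^+ m * (pi / `|w|) ^+ 2.
Proof.
move=> m2 wpi; have p2 := pi_ge2 R.
have w0 : 0 < `|w| by exact: lt_le_trans (pi_gt0 R) wpi.
rewrite normc_dnum; apply: (@le_trans _ _ (`|w| ^- m)).
  by rewrite ler_piMr ?invr_ge0 ?exprn_ge0// normc_dft_le1.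
have y1 : pi / `|w| <= 1 by rewrite ler_pdivrMr// mul1r.
have y0 : 0 <= pi / `|w| by rewrite divr_ge0// ltW ?pi_gt0.
apply: (@le_trans _ _ ((1 / 2) ^+ m * (pi / `|w|) ^+ m)).
  have z0 : 0 <= 1 / 2 * (pi / `|w|) by lra.
  rewrite -exprMn -exprVn lerXn2r ?nnegrE ?invr_ge0//.
  by rewrite mulrA -[leLHS]mul1r ler_wpM2r ?invr_ge0//; lra.
rewrite ler_wpM2l ?exprn_ge0// -(subnK m2) exprD.
by rewrite ler_piMl ?exprn_ge0// exprn_ile1.
Qed.

(** The supremum 1/2 of sin(w/2) / w is only approached as w tends to 0, hence the shrinking
    windows. The cubic Taylor bound gives sin(w/2) / w >= 1/2 - w^2 / 48, and w^2 <= b because w <=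
    b <= 1. *)
Lemma dnum_ge (b w : R) : 0 < b <= 1 -> b / 2 <= w <= b ->
  k0 / 8 * ((1 / 2 - b / 48) ^+ m / m%:R) <= normc (dnum w).
Proof.
move=> /andP[b0 b1] /andP[w1 w2]; have p2 := pi_ge2 R.
have w0 : 0 < w by lra.
rewrite normc_dnum normc_dft gtr0_norm//.
have ph : 1 / 4 <= normc (Clim (mprod H w)).
  by apply: (phi_ge_quarter m0 hH); rewrite gtr0_norm//; lra.
have hs : sin (w / 2) ^+ m / (2 * m%:R) <= normc (H (w / 2 + pi)).
  by apply: mask_shift_ge; apply/andP; split; lra.
have s0 : 0 <= sin (w / 2) by apply: sin_ge0_pi; apply/andP; split; lra.
have mR : 0 < m%:R :> R by rewrite ltr0n.
have sw : w * (1 / 2 - b / 48) <= sin (w / 2).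
  have h0 : 0 <= w / 2 by lra.
  have [_] := taylor_cos_sin 1 h0; rewrite -signr_odd expr0 mul1r subr_ge0.
  apply: le_trans; rewrite /= !doubleS !double0.
  have w21 : w ^+ 2 <= b by rewrite (le_trans _ w2)// expr2 ler_piMr//; lra.
  have : 0 <= w * (b - w ^+ 2) by rewrite mulr_ge0 ?subr_ge0// ltW.
  by lra.
have t0 : 0 <= 1 / 2 - b / 48 by lra.
apply: (@le_trans _ _ (w ^- m * (k0 * (sin (w / 2) ^+ m / (2 * m%:R)) * (1 / 4)))); last first.
  rewrite ler_wpM2l ?invr_ge0 ?exprn_ge0 ?(ltW w0)//.
  have k00 : 0 <= k0 by rewrite ltW// sqrt2piV_gt0.
  apply: ler_pM => //.
    by rewrite mulr_ge0// divr_ge0 ?exprn_ge0 ?mulr_ge0.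
  by rewrite ler_wpM2l.
have -> : w ^- m * (k0 * (sin (w / 2) ^+ m / (2 * m%:R)) * (1 / 4)) =
    k0 / 8 * ((sin (w / 2) / w) ^+ m / m%:R).
  rewrite expr_div_n; move: (sin _ ^+ m) (w ^+ m) (m%:R) (expf_neq0 m (lt0r_neq0 w0)) mR => S W M Wn M0.
  by field; rewrite Wn gt_eqF.
rewrite ler_pM2l ?divr_gt0 ?sqrt2piV_gt0// ler_pM2r ?invr_gt0//.
by rewrite lerXn2r ?nnegrE ?divr_ge0 ?(ltW w0)// ler_pdivlMr// mulrC.
Qed.

End DaubechiesFT.

Section DaubechiesLimit.
Context (R : realType) (p : R) (hp : 1 < p) (H : nat -> R -> R[i])
  (hH : forall m : nat, (0 < m)%N -> is_daubechies_mask m (H m)).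
Let p0 : 0 < p. Proof. exact: lt_trans ltr01 hp. Qed.

Lemma daubechies_num_cvg :
  (fun m : nat => LpnormC p (dnum m (H m)) `^ (m%:R^-1)) @ \oo --> (1 / 2 : R).
Proof.
have pi1 : 1 <= pi :> R by apply: le_trans (pi_ge2 R); lra.
have K m : (2 <= m)%N -> forall w : R, Normc.normc (dnum m (H m) w) `^ p * (1 + w ^+ 2) <=
    ((1 / 2) ^+ m) `^ p * (2 * pi ^+ 2).
  move=> m2; have m0 : (0 < m)%N by exact: ltnW.
  apply: decay_bound => //.
    by move=> w; apply: dnum_le => //; exact: hH.
  by move=> w; apply: dnum_decay => //; exact: hH.
have K0 m : 0 <= ((1 / 2) ^+ m) `^ p * (2 * pi ^+ 2) :> R.
  by rewrite mulr_ge0 ?powR_ge0// mulr_ge0// sqr_ge0.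
apply: root_cvg; first by lra.
- exists ((2 * pi ^+ 2 * pi) `^ p^-1).
    by rewrite powR_gt0// !mulr_gt0 ?exprn_gt0 ?pi_gt0.
  exists 2%N => // m /= m2; apply: (le_trans (LpnormC_le p0 (K0 m) (K m m2))).
  rewrite -mulrA powRM ?powR_ge0 ?mulr_ge0 ?sqr_ge0 ?pi_ge0//.
  rewrite -powRrM divff ?gt_eqF// powRr1 ?exprn_ge0//.
  by rewrite mulrC.
- move=> l /andP[l0 l2].
  (* Then b/48 is at most a quarter of 1/2 - l, so the rate l' on the window still exceeds l, and
     the gap pays for the factor 1/m. *)
  pose b := Num.min 1 (12 * (1 / 2 - l)).
  have b0 : 0 < b <= 1 by rewrite lt_min ge_min lexx /= ltr01/=; lra.
  have bl : b <= 12 * (1 / 2 - l) by rewrite ge_min lexx orbT.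
  pose l' := 1 / 2 - b / 48.
  have ll' : l < l' by rewrite /l'; lra.
  exists ((Num.sqrt (2 * pi))^-1 / 8 * (l' / l - 1) * (b - b / 2) `^ p^-1).
    rewrite !mulr_gt0 ?sqrt2piV_gt0 ?powR_gt0//.
      by rewrite subr_gt0 ltr_pdivlMr// mul1r.
    by move/andP: b0 => [b0 _]; lra.
  exists 2%N => // m /= m2; have m0 : (0 < m)%N by exact: ltnW.
  have h := @LpnormC_ge R p _ ((Num.sqrt (2 * pi))^-1 / 8 * (l' ^+ m / m%:R)) (b / 2) b _ p0 (K0 m) (K m m2).
  apply: le_trans (h _ _ _).
  + rewrite mulrAC ler_wpM2r ?powR_ge0// -[_ * _ * l ^+ m]mulrA ler_wpM2l ?divr_ge0 ?(ltW (sqrt2piV_gt0 _))//.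
    exact: expr_div_nat_ge.
  + by move/andP: b0 => [b0 _]; lra.
  + rewrite mulr_ge0 ?divr_ge0 ?(ltW (sqrt2piV_gt0 _))// exprn_ge0// /l'.
    by move/andP: b0 => [b0 b1]; lra.
  + by move=> w hw; apply: dnum_ge => //; exact: hH.
Qed.

Lemma daubechies_den_cvg :
  (fun m : nat => LpnormC p (daubechies_wavelet_ft (H m)) `^ (m%:R^-1)) @ \oo --> (1 : R).
Proof.
pose X : R := 4 * 64 ^+ 3.
have X1 : 1 <= X by rewrite /X !exprS expr0; lra.
have K m : (12 <= m)%N -> forall w : R, Normc.normc (daubechies_wavelet_ft (H m) w) `^ p * (1 + w ^+ 2) <=
    1 `^ p * (2 * X ^+ 2).
  move=> m12; have m0 : (0 < m)%N by exact: leq_trans m12.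
  apply: decay_bound => // w.
    by move=> _; apply: (normc_dft_le1 m0 (hH m0)).
  by rewrite mul1r => wX; apply: (normc_dft_decay m0 (hH m0)).
have K0 : 0 <= 1 `^ p * (2 * X ^+ 2) :> R.
  by rewrite mulr_ge0 ?powR_ge0// mulr_ge0// sqr_ge0.
apply: root_cvg; first by lra.
- exists ((1 `^ p * (2 * X ^+ 2) * pi) `^ p^-1).
    by rewrite powR_gt0// !mulr_gt0 ?exprn_gt0 ?pi_gt0 ?powR_gt0// (lt_le_trans ltr01).
  exists 12%N => // m /= m12; rewrite expr1n mulr1.
  exact: LpnormC_le (K m m12).
- move=> l /andP[l0 l1].
  exists ((Num.sqrt (2 * pi))^-1 / 8 * (2 * pi - pi) `^ p^-1).
    rewrite !mulr_gt0 ?sqrt2piV_gt0 ?powR_gt0//.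
    by have := pi_gt0 R; lra.
  exists 12%N => // m /= m12; have m0 : (0 < m)%N by exact: leq_trans m12.
  have h := @LpnormC_ge R p _ ((Num.sqrt (2 * pi))^-1 / 8) pi (2 * pi) _ p0 K0 (K m m12).
  apply: (@le_trans _ _ ((Num.sqrt (2 * pi))^-1 / 8 * (2 * pi - pi) `^ p^-1)).
    rewrite ler_piMr ?mulr_ge0 ?powR_ge0 ?divr_ge0 ?(ltW (sqrt2piV_gt0 _))//.
    by rewrite exprn_ile1 ?(ltW l0) ?(ltW l1).
  apply: h.
  + by have := pi_gt0 R; lra.
  + by rewrite divr_ge0 ?(ltW (sqrt2piV_gt0 _)).
  + by move=> w hw; apply: (normc_dft_ge m0 (hH m0)).
Qed.

Lemma C_daubechies_cvg :
  (fun m : nat => C_daubechies p m (H m) `^ (m%:R^-1)) @ \oo --> (1 / 2 : R).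
Proof.
rewrite -[1 / 2]divr1; apply: root_div_cvg.
- by move=> m; exact: LpnormC_ge0.
- by move=> m; exact: LpnormC_ge0.
- exact: oner_neq0.
- exact: daubechies_num_cvg.
- exact: daubechies_den_cvg.
Qed.

End DaubechiesLimit.

(** * Fourier transforms of splines *)

Section Truncation.
Context (R : realType).
Implicit Types (x t w a b : R).

Lemma dsum (J : Type) (r : seq J) (f : J -> R -> R) (df : J -> R) x :
  (forall i, is_derive x 1 (f i) (df i)) ->
  is_derive x 1 (fun y => \sum_(i <- r) f i y) (\sum_(i <- r) df i).
Proof.
move=> dfi; elim: r => [|i r IH].
  by rewrite big_nil; under eq_fun do rewrite big_nil; exact: dconst.
by rewrite big_cons; under eq_fun do rewrite big_cons; exact: dD.
Qed.

Lemma continuous_sum (J : Type) (r : seq J) (f : J -> R -> R) :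
  (forall i, continuous (f i)) -> continuous (fun y => \sum_(i <- r) f i y).
Proof.
move=> cf; elim: r => [|i r IH] x.
  by under eq_fun do rewrite big_nil; exact: cvg_cst.
by under eq_fun do rewrite big_cons; apply: cvgD; [exact: cf|exact: IH].
Qed.

(** At the knot the difference quotient of the truncation is dominated by that of [u], which tends
    to 0. Truncated powers and primitives can thus be differentiated across their knots without
    cutting the interval of integration. *)
Lemma deriv_trunc (u du : R -> R) t : (forall x, is_derive x 1 u (du x)) ->
  u t = 0 -> du t = 0 -> forall x,
  is_derive x 1 (fun y : R => if t <= y then u y else 0) (if t <= x then du x else 0).
Proof.
move=> dfu ut dut x.
have [tx|xt|<-] := ltgtP t x.
- apply: (near_eq_is_derive _ (dfu x)).
  near=> y; suff -> : t <= y by [].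
  by near: y; exact: lt_le_nbhsr.
- apply: (near_eq_is_derive _ (dconst 0 x)).
  near=> y; suff /negbTE -> : ~~ (t <= y) by [].
  by rewrite -ltNge; near: y; exact: lt_nbhsl.
- rewrite dut.
  have h : (fun h : R => h^-1 *: (((fun y : R => if t <= y then u y else 0) \o shift t) (h *: (1 : R)) -
    (if t <= t then u t else 0))) @ 0^' --> (0 : R).
    have [ex dv] := dfu t; rewrite dut in dv.
    have : (fun h : R => h^-1 *: ((u \o shift t) (h *: (1 : R)) - u t)) @ 0^' --> 'D_1 u t.
      exact: ex.
    rewrite dv.
    move=> /cvgrPdist_le uP; apply/cvgrPdist_le => e e0.
    have := uP e e0; apply: filterS => h /=.
    rewrite lexx ut !subr0 !sub0r !normrN; apply: le_trans.
    by case: ifP => // _; rewrite scaler0 normr0.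
  apply: DeriveDef; first by apply/cvg_ex; exists 0.
  exact: cvg_lim h.
Unshelve. all: by end_near. Qed.

Lemma deriv_tpow k x : is_derive x 1 (@tpow R k.+2) (k.+2%:R * tpow k.+1 x).
Proof.
have d (y : R) : is_derive y 1 (fun z : R => z ^+ k.+2) (k.+2%:R * y ^+ k.+1).
  by deriv; rewrite mulr1.
have := @deriv_trunc (fun z => z ^+ k.+2) (fun z => k.+2%:R * z ^+ k.+1) 0 d.
rewrite !expr0n mulr0 => /(_ erefl erefl x).
by rewrite /tpow; case: ifP => // _; rewrite mulr0.
Qed.

(* A primitive of (x - t)^k cos (x w + th), by parts: cos (a + pi/2) = - sin a. *)
Fixpoint gprim (w t : R) (k : nat) (th x : R) : R :=
  if k is j.+1 then
    ((x - t) ^+ k * sin (x * w + th) + k%:R * gprim w t j (th + pi / 2) x) / w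
  else sin (x * w + th) / w.

Lemma deriv_gprim w t k th x : w != 0 ->
  is_derive x 1 (gprim w t k th) ((x - t) ^+ k * cos (x * w + th)).
Proof.
move=> w0; elim: k th => [|k IH] th.
  rewrite /= expr0 mul1r; deriv.
  by move: (cos _) (sin _) => c s; field.
have dI := IH (th + pi / 2).
change (is_derive x 1 (fun x : R => ((x - t) ^+ k.+1 * sin (x * w + th) + k.+1%:R * gprim w t k (th + pi / 2) x) / w) ((x - t) ^+ k.+1 * cos (x * w + th))).
deriv.
have -> : cos (x * w + (th + pi / 2)) = - sin (x * w + th) by rewrite addrA cosDpihalf.
move: (cos _) (sin _) => c s.
by rewrite [(x - t) ^+ k.+1]exprS; move: ((x - t) ^+ k) (k.+1%:R : R) => v K; field.
Qed.

Lemma gprim_knot w t k th :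
  gprim w t k th t = k`!%:R / w ^+ k.+1 * sin (t * w + th + k%:R * (pi / 2)).
Proof.
elim: k th => [|k IH] th; first by rewrite /= fact0 mul0r addr0 mulrC expr1 mul1r.
rewrite /= IH subrr expr0n mul0r add0r factS natrM [w ^+ k.+2]exprSr invfM.
have -> : t * w + (th + pi / 2) + k%:R * (pi / 2) = t * w + th + k.+1%:R * (pi / 2).
  by rewrite -(natr1 k); move: (pi / 2) => P; ring.
by rewrite !mulrA [LHS]mulrAC.
Qed.

Context (I : finType) (c t : I -> R).

(** In [gprim] the trigonometric factors depend on the point b but not on the knot; what depends on
    the knot is a polynomial in b - t of degree at most k, which the moments annihilate. *)
Lemma gprim_moments w k th (b : R) :
  (forall i, (i <= k)%N -> forall x, \sum_(j : I) c j * (x - t j) ^+ i = 0) ->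
  \sum_(j : I) c j * gprim w (t j) k th b = 0.
Proof.
elim: k th => [|k IH] th mom.
  have := mom 0%N isT b; under eq_bigr do rewrite expr0 mulr1.
  by rewrite /= -mulr_suml => ->; rewrite mul0r.
under eq_bigr => j _ do rewrite /= mulrA mulrDr mulrA [c j * (_ * _)]mulrCA.
rewrite -mulr_suml big_split/= -mulr_suml mom// -mulr_sumr IH.
  by rewrite mul0r mulr0 addr0 mul0r.
by move=> i ik; apply: mom; exact: leqW.
Qed.

(** The index is an arbitrary finite type, so that a double sum can be indexed by pairs; knots may
    coincide. *)
Definition spl k x := \sum_(j : I) c j * tpow k (x - t j).

Lemma spl_out k x a b : (forall j, a <= t j <= b) ->
  (forall y, \sum_(j : I) c j * (y - t j) ^+ k = 0) -> (x < a) || (b < x) ->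
  spl k x = 0.
Proof.
move=> ab mom /orP[xa|bx]; rewrite /spl.
  apply: big1 => j _; have /andP[aj _] := ab j.
  by rewrite /tpow leNgt subr_lt0 (lt_le_trans xa aj) mulr0.
rewrite -[RHS](mom x); apply: eq_bigr => j _; have /andP[_ bj] := ab j.
by rewrite /tpow subr_ge0 (le_trans bj (ltW bx)).
Qed.

Lemma Rintegral_compact (f : R -> R) a b : (forall x, (x < a) || (b < x) -> f x = 0) ->
  \int[lebesgue_measure]_x f x = \int[lebesgue_measure]_(x in `[a, b]) f x.
Proof.
move=> f0; rewrite [RHS]Rintegral_mkcond; apply: eq_Rintegral => x _.
rewrite patchE; case: ifPn => // /negP xab; apply: f0.
apply/negPn/negP; rewrite negb_or -!leNgt => h; apply: xab.
by rewrite inE/= in_itv.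
Qed.

Lemma continuous_tpow k : continuous (@tpow R k.+1).
Proof.
move=> x; case: k => [|k]; last first.
  apply: differentiable_continuous; apply/derivable1_diffP.
  by have [] := deriv_tpow k x.
have -> : @tpow R 1 = fun x => Num.max x 0.
  apply/funext => y; rewrite /tpow; by have [y0|y0] := leP 0 y; rewrite ?expr1.
by apply: continuous_max => //; exact: cvg_cst.
Qed.

Lemma continuous_spl k : continuous (spl k.+1).
Proof.
apply: continuous_sum => j x; apply: cvgM; first exact: cvg_cst.
apply: (@continuous_comp _ _ _ (fun y : R => y - t j) (tpow k.+1)).
  by apply: cvgB; [exact: cvg_id|exact: cvg_cst].
exact: continuous_tpow.
Qed.

Lemma integral_spl_cos k w th a b : w != 0 -> a <= b ->
  (forall j, a <= t j <= b) ->
  (forall i, (i <= k.+1)%N -> forall x, \sum_(j : I) c j * (x - t j) ^+ i = 0) ->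
  \int[lebesgue_measure]_x (spl k.+1 x * cos (x * w + th)) =
  - (k.+1`!%:R / w ^+ k.+2 * \sum_(j : I) c j * sin (t j * w + th + k.+1%:R * (pi / 2))).
Proof.
move=> w0 ab tab mom.
rewrite (@Rintegral_compact _ a b); last first.
  by move=> x xab; rewrite (spl_out tab (mom _ (leqnn _)) xab) mul0r.
(* Subtracting the knot value makes the truncation differentiable at the knot. At b every truncation
   is active, the moments cancel the [gprim] terms at b, and only the knot values survive. *)
pose Psi j y := if t j <= y then gprim w (t j) k.+1 th y - gprim w (t j) k.+1 th (t j) else 0.
have dPsi j (x : R) : is_derive x 1 (Psi j) (tpow k.+1 (x - t j) * cos (x * w + th)).
  have dg (y : R) : is_derive y 1 (fun z => gprim w (t j) k.+1 th z - gprim w (t j) k.+1 th (t j)) ((y - t j) ^+ k.+1 * cos (y * w + th)).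
    have d1 := deriv_gprim (t j) k.+1 th y w0.
    by apply: (is_derive_eq (dD d1 (dconst (- gprim w (t j) k.+1 th (t j)) y))); rewrite addr0.
  have := @deriv_trunc _ _ (t j) dg; rewrite !subrr expr0n mul0r => /(_ erefl erefl x).
  by rewrite /tpow subr_ge0; case: ifP => // _; rewrite mul0r.
pose Phi y := \sum_(j : I) c j * Psi j y.
have dPhi (x : R) : is_derive x 1 Phi (spl k.+1 x * cos (x * w + th)).
  rewrite /spl mulr_suml.
  apply: dsum => j.
  have d1 := dPsi j x.
  by apply: (is_derive_eq (dM (dconst (c j) x) d1)); rewrite mul0r add0r mulrA.
have cf : continuous (fun x => spl k.+1 x * cos (x * w + th)).
  move=> x; apply: cvgM; first exact: continuous_spl.
  apply: (@continuous_comp _ _ _ (fun y : R => y * w + th) cos).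
    by apply: cvgD; [apply: cvgM; [exact: cvg_id|exact: cvg_cst]|exact: cvg_cst].
  exact: continuous_cos.
rewrite (integral_FTC ab cf dPhi).
have -> : Phi a = 0.
  rewrite /Phi; apply: big1 => j _; rewrite /Psi; have /andP[aj _] := tab j.
  case: ifPn => [ja|_]; last by rewrite mulr0.
  have -> : a = t j by apply/eqP; rewrite eq_le aj ja.
  by rewrite subrr mulr0.
rewrite subr0 /Phi.
transitivity (\sum_(j : I) (c j * gprim w (t j) k.+1 th b - k.+1`!%:R / w ^+ k.+2 *
    (c j * sin (t j * w + th + k.+1%:R * (pi / 2))))).
  apply: eq_bigr => j _; rewrite /Psi; have /andP[_ ->] := tab j.
  by rewrite mulrBr gprim_knot [c j * (_ * sin _)]mulrCA.
by rewrite sumrB gprim_moments// sub0r -mulr_sumr.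
Qed.

(** The general formula divides by powers of w, so the value of the transform at 0 is found
    separately; it takes one more vanishing moment. *)
Lemma integral_spl k a b : a <= b -> (forall j, a <= t j <= b) ->
  (forall i, (i <= k.+2)%N -> forall x, \sum_(j : I) c j * (x - t j) ^+ i = 0) ->
  \int[lebesgue_measure]_x spl k.+1 x = 0.
Proof.
move=> ab tab mom; rewrite (@Rintegral_compact _ a b); last first.
  by move=> x xab; rewrite (spl_out tab (mom _ (leqnSn _)) xab).
pose Phi y := \sum_(j : I) c j / k.+2%:R * tpow k.+2 (y - t j).
have dPhi (x : R) : is_derive x 1 Phi (spl k.+1 x).
  rewrite /spl.
  apply: dsum => j.
  have d1 := dcompose (dD (did x) (dconst (- t j) x)) (deriv_tpow k (x - t j)).
  apply: (is_derive_eq (dM (dconst (c j / k.+2%:R) x) d1)).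
  by rewrite mul0r add0r addr0 mulr1 mulrA divfK// pnatr_eq0.
rewrite (integral_FTC ab (@continuous_spl k) dPhi).
have zero x : \sum_(j : I) c j / k.+2%:R * (x - t j) ^+ k.+2 = 0.
  by under eq_bigr do rewrite mulrAC; rewrite -mulr_suml mom// mul0r.
rewrite /Phi.
have -> : \sum_(j : I) c j / k.+2%:R * tpow k.+2 (b - t j) = 0.
  rewrite -[RHS](zero b); apply: eq_bigr => j _; have /andP[_ bj] := tab j.
  by rewrite /tpow subr_ge0 bj.
rewrite sub0r big1 ?oppr0// => j _; have /andP[aj _] := tab j.
rewrite /tpow subr_ge0; case: ifPn => [ja|]; last by rewrite mulr0.
by have -> : a = t j by [apply/eqP; rewrite eq_le aj ja]; rewrite subrr expr0n mulr0.
Qed.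

Lemma sum_expi (th : I -> R) :
  \sum_(j : I) (c j)%:C * expi (th j) =
  (\sum_(j : I) c j * cos (th j)) +i* (\sum_(j : I) c j * sin (th j)).
Proof.
elim/big_rec3: _ => [|j x y z _ ->] //.
by apply/eqP; rewrite eq_complex /= !mul0r subr0 addr0 !eqxx.
Qed.

Lemma normc_fourier_spl k w a b : w != 0 -> a <= b -> (forall j, a <= t j <= b) ->
  (forall i, (i <= k.+1)%N -> forall x, \sum_(j : I) c j * (x - t j) ^+ i = 0) ->
  Normc.normc (fourier (fun x => (spl k.+1 x)%:C) w) =
  (Num.sqrt (2 * pi))^-1 * (k.+1`!%:R / `|w| ^+ k.+2) *
  Normc.normc (\sum_(j : I) (c j)%:C * expi (t j * w)).
Proof.
move=> w0 ab tab mom.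
rewrite /fourier Normc.normcM normc_real ger0_norm ?invr_ge0 ?sqrtr_ge0// -mulrA.
congr (_ * _); rewrite /Cintegral.
have -> : \int[lebesgue_measure]_x complex.Re ((spl k.+1 x)%:C * expi (- (x * w))) =
    \int[lebesgue_measure]_x (spl k.+1 x * cos (x * w + 0)).
  by apply: eq_Rintegral => x _ /=; rewrite mul0r subr0 cosN addr0.
have -> : \int[lebesgue_measure]_x complex.Im ((spl k.+1 x)%:C * expi (- (x * w))) =
    \int[lebesgue_measure]_x (spl k.+1 x * cos (x * w + pi / 2)).
  by apply: eq_Rintegral => x _ /=; rewrite mul0r addr0 sinN cosDpihalf.
rewrite !(integral_spl_cos _ w0 ab tab mom).
set K := k.+1`!%:R / w ^+ k.+2; set S := \sum_(j : I) _; set S' := \sum_(j : I) _.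
(* The k + 1 quarter turns produced by the integrations by parts factor out as a unimodular number.
   Sign and order of the two components do not change the modulus. *)
have E : S' +i* S = expi (k.+1%:R * (pi / 2)) * \sum_(j : I) (c j)%:C * expi (t j * w).
  rewrite mulr_sumr.
  under eq_bigr => j _ do rewrite mulrCA -expiD.
  rewrite sum_expi /S /S'; apply/eqP; rewrite eq_complex /=.
  apply/andP; split; apply/eqP; apply: eq_bigr => j _; congr (_ * _).
    by rewrite [t j * w + _ + _]addrAC sinDpihalf addrC.
  by rewrite addr0 addrC.
have <- : Num.sqrt (S' ^+ 2 + S ^+ 2) = Normc.normc (\sum_(j : I) (c j)%:C * expi (t j * w)).
  by rewrite -[LHS]/(Normc.normc (S' +i* S)) E Normc.normcM normc_expi mul1r.
have -> : k.+1`!%:R / `|w| ^+ k.+2 = `|K|.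
  by rewrite normrM normfV normrX normr_nat.
rewrite -sqrtr_sqr -sqrtrM ?sqr_ge0//= ; congr Num.sqrt.
by rewrite !sqrrN !exprMn; ring.
Qed.

End Truncation.

(** * Backward differences and B-splines *)

Section Differences.
Context (R : realType).
Implicit Types (x a h : R) (f : R -> R).

(** The operator 1 + a T with T the translation by h: one binomial expansion then covers both the
    backward difference and the half-step factors of the two-scale relation. *)
Definition shiftop a h f : R -> R := fun x => f x + a * f (x - h).

Lemma iter_shiftopE n a h f x : iter n (shiftop a h) f x =
  \sum_(0 <= k < n.+1) a ^+ k * 'C(n, k)%:R * f (x - k%:R * h).
Proof.
elim: n x => [|n IH] x.
  by rewrite big_nat1 expr0 mul0r subr0 !mul1r.
rewrite iterS /shiftop !IH [RHS]big_nat_recl//= mul0r subr0.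
under [in RHS]eq_bigr => k _ do rewrite binS natrD mulrDr mulrDl.
rewrite big_split/= addrA; congr (_ + _).
  rewrite [LHS]big_nat_recl//= mul0r subr0 expr0 !bin0 mul1r; congr (_ + _).
  by rewrite [RHS]big_nat_recr//= bin_small// mulr0 mul0r addr0.
rewrite mulr_sumr; apply: eq_bigr => k _.
rewrite exprS -!mulrA; do 3 congr (_ * _).
by congr f; rewrite -natr1; ring.
Qed.

Definition diffop := shiftop (-1) 1.

Lemma deriv_diffop n f df : (forall x, is_derive x 1 f (df x)) ->
  forall x, is_derive x 1 (iter n diffop f) (iter n diffop df x).
Proof.
move=> fd; elim: n => [|n IH] x //=.
have d1 := IH x.
have d2 := dcompose (dD (did x) (dconst (- 1) x)) (IH (x - 1)).
apply: (is_derive_eq (dD d1 (dM (dconst (- 1) x) d2))).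
by rewrite /diffop /shiftop mul0r add0r addr0 mulr1.
Qed.

(** Leibniz rule, short because the second difference of y vanishes. It yields both the recursion
    for B-splines and the vanishing of high differences of polynomials. *)
Lemma diffop_mulx n f x : iter n.+1 diffop (fun y => y * f y) x =
  x * iter n.+1 diffop f x + n.+1%:R * iter n diffop f (x - 1).
Proof.
elim: n x => [|n IH] x.
  by rewrite /= /diffop /shiftop; ring.
have E g z : diffop g z = g z - g (z - 1) by rewrite /diffop /shiftop mulN1r.
have e1 : iter n.+2 diffop f x = iter n.+1 diffop f x - iter n.+1 diffop f (x - 1).
  by rewrite iterS E.
have e2 : iter n.+1 diffop f (x - 1) = iter n diffop f (x - 1) - iter n diffop f (x - 1 - 1).
  by rewrite iterS E.
have e0 : iter n.+2 diffop (fun y => y * f y) x = iter n.+1 diffop (fun y => y * f y) x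
    - iter n.+1 diffop (fun y => y * f y) (x - 1).
  by rewrite iterS E.
rewrite e0 !IH e1 e2 -!natr1.
move: (iter n.+1 diffop f x) (iter n diffop f (x - 1)) (iter n diffop f (x - 1 - 1)).
by move=> A B C; ring.
Qed.

Lemma diffop_scale n c f x : iter n diffop (fun y => c * f y) x = c * iter n diffop f x.
Proof. by elim: n x => [//|n IH] x; rewrite !iterS /diffop /shiftop !IH; ring. Qed.

Lemma diffop_eq0 n f : f =1 (fun=> 0) -> iter n diffop f =1 (fun=> 0).
Proof. by move=> f0; elim: n => [//|n IH] x; rewrite iterS /diffop /shiftop !IH mulr0 addr0. Qed.

Lemma diffop_monomial n j x : (j < n)%N -> iter n diffop (fun y => y ^+ j) x = 0.
Proof.
elim: j n x => [|j IH] [|n] x // jn.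
  rewrite iterSr; apply: diffop_eq0 => y.
  by rewrite /diffop /shiftop !expr0; ring.
under eq_fun do rewrite exprS.
rewrite diffop_mulx IH; last exact: ltnW.
case: n jn => // n jn.
by rewrite IH// !mulr0 addr0.
Qed.

(** n! times the B-spline of order n + 1, so that recursion and refinement carry no factorials. *)
Definition bdiff (n : nat) : R -> R := iter n.+1 diffop (tpow n).

Lemma BsplineE n x : Bspline n.+1 x = (n`!%:R)^-1 * bdiff n x.
Proof.
rewrite /Bspline /bdiff /diffop iter_shiftopE; congr (_ * _).
by apply: eq_bigr => k _; rewrite mulr1.
Qed.

Lemma tpowS n x : tpow n.+1 x = x * tpow n x.
Proof. by rewrite /tpow; case: ifP => _; rewrite ?exprS ?mulr0. Qed.

(** The Cox-de Boor recursion for integer knots, from the Leibniz rule applied to x * (x)_+^n. *)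
Lemma bdiffS n x : bdiff n.+1 x =
  x * bdiff n x + (n.+2%:R - x) * bdiff n (x - 1).
Proof.
rewrite /bdiff.
have -> : @tpow R n.+1 = (fun y => y * tpow n y) by apply/funext => y; exact: tpowS.
rewrite diffop_mulx iterS {1}/diffop /shiftop; ring.
Qed.

(** Sign and support go together in one induction: the weights x and n + 2 - x of the recursion are
    nonnegative on [0, n + 2], and outside it both terms vanish. *)
Lemma bdiff_ge0_supp n : (forall x, 0 <= bdiff n x) /\
  (forall x, (x < 0) || (n.+1%:R <= x) -> bdiff n x = 0).
Proof.
elim: n => [|n [IH0 IHs]].
  have E x : bdiff 0 x = (if 0 <= x then 1 else 0) - (if 1 <= x then 1 else 0).
    rewrite /bdiff /= /diffop /shiftop /tpow mulN1r subr_ge0.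
    by case: ifP => _; case: ifP => _; rewrite ?expr0.
  split=> x; rewrite E.
    by case: ifPn => x0; case: ifPn => x1; rewrite ?subrr ?subr0//; lra.
  by case: ifPn => x0; case: ifPn => x1; rewrite ?subrr ?subr0//; lra.
split=> x; rewrite bdiffS.
  have [xs|] := boolP ((x < 0) || (n.+2%:R <= x)).
    have -> : bdiff n x = 0.
      apply: IHs; case/orP: xs => [->//|xs]; apply/orP; right.
      by apply: le_trans xs; rewrite ler_nat.
    rewrite IHs ?mulr0 ?addr0//; case/orP: xs => xs; apply/orP; [left|right]; first by lra.
    by rewrite -natr1 in xs; lra.
  rewrite negb_or -leNgt -ltNge => /andP[x0 xn].
  by rewrite addr_ge0 ?mulr_ge0 ?IH0// subr_ge0 ltW.
move=> xs.
have -> : bdiff n x = 0.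
  apply: IHs; case/orP: xs => [->//|xs]; apply/orP; right.
  by apply: le_trans xs; rewrite ler_nat.
rewrite IHs ?mulr0 ?addr0//; case/orP: xs => xs; apply/orP; [left|right]; first by lra.
by rewrite -natr1 in xs; lra.
Qed.

(** Partition of unity at the integers: after re-indexing, the recursion gives [bdiff n j] the total
    weight j + (n + 1 - j) = n + 1. *)
Lemma sum_bdiff n J : (n.+1 <= J)%N -> \sum_(j < J) bdiff n j%:R = n`!%:R.
Proof.
have supp m (x : R) := (bdiff_ge0_supp m).2 x.
elim: n J => [|n IH] [//|J] nJ.
  rewrite big_ord_recl big1 ?addr0.
    by rewrite /bdiff /= /diffop /shiftop /tpow lexx expr0 sub0r oppr_ge0 ler10 mulr0 addr0 fact0.
  by move=> j _; apply: supp; rewrite ler_nat orbT.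
have nJ' : (n < J)%N by [].
under eq_bigr do rewrite bdiffS.
rewrite big_split/= [X in _ + X]big_ord_recl/=.
rewrite [X in _ + (X + _)](_ : _ = 0); last first.
  by rewrite supp ?mulr0// sub0r ltrN10.
rewrite add0r big_ord_recr/= [X in _ + X + _](_ : _ = 0); last first.
  by rewrite supp ?mulr0// ler_nat nJ' orbT.
rewrite addr0 -big_split/=.
rewrite factS natrM -(IH J nJ') mulr_sumr; apply: eq_bigr => j _.
have -> : (bump 0 j)%:R - 1 = j%:R :> R by rewrite /bump/= -natr1; ring.
by rewrite /bump/= add1n -!natr1; ring.
Qed.

(* Two-scale relation: 1 - T = (1 + T^(1/2)) (1 - T^(1/2)) for the translation T. *)
Lemma bdiff_refine n x : 2 ^+ n * bdiff n x =
  \sum_(0 <= k < n.+2) 'C(n.+1, k)%:R * bdiff n (2 * x - k%:R).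
Proof.
pose P := shiftop 1 (1 / 2); pose Q := shiftop (-1) (1 / 2).
have PQ f y : diffop f y = P (Q f) y.
  rewrite /diffop /P /Q /shiftop.
  have -> : y - 1 / 2 - 1 / 2 = y - 1 by lra.
  by ring.
have comm f y : P (Q f) y = Q (P f) y.
  by rewrite /P /Q /shiftop; ring.
have PQf f : diffop f = P (Q f) by apply/funext.
have commf f : P (Q f) = Q (P f) by apply/funext.
have PiQ j f : P (iter j Q f) = iter j Q (P f).
  by elim: j => [//|j IH]; rewrite !iterS commf IH.
have it j f : iter j diffop f = iter j P (iter j Q f).
  elim: j => [//|j IH]; rewrite iterS IH PQf.
  rewrite [in RHS]iterSr iterS.
  have PiP i g : P (iter i P g) = iter i P (P g) by rewrite -iterS iterSr.
  have QiP i g : Q (iter i P g) = iter i P (Q g).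
    by elim: i => [//|i IHi]; rewrite !iterS -commf IHi.
  by rewrite QiP -PiP.
have Qt y : 2 ^+ n * iter n.+1 Q (tpow n) y = bdiff n (2 * y).
  rewrite /bdiff /diffop /Q !iter_shiftopE mulr_sumr; apply: eq_bigr => k _.
  rewrite mulrCA; congr (_ * _).
  rewrite (_ : 2 * y - k%:R * 1 = 2 * (y - k%:R * (1 / 2))); last by field.
  by rewrite /tpow pmulr_rge0//; case: ifP => _; rewrite ?mulr0// exprMn.
rewrite {1}/bdiff it /P iter_shiftopE mulr_sumr; apply: eq_bigr => k _.
rewrite mulrCA Qt expr1n mul1r; congr (_ * bdiff n _).
by field.
Qed.

End Differences.

(** * Euler-Frobenius polynomials *)

Lemma sum_even_part (V : comPzRingType) (h : nat -> V) (z : V) J :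
  \sum_(j < J.*2) h j * (z ^+ j + (- z) ^+ j) = 2 * \sum_(i < J) h i.*2 * (z ^+ 2) ^+ i.
Proof.
elim: J => [|J IH]; first by rewrite !big_ord0 mulr0.
rewrite doubleS 2!big_ord_recr /= IH [in RHS]big_ord_recr /=.
move: (\sum_(i < J) _) => S.
have e1 : (- z) ^+ J.*2 = z ^+ J.*2 by rewrite -mul2n exprM sqrrN -exprM.
rewrite [(- z) ^+ J.*2.+1]exprS e1 [z ^+ J.*2.+1]exprS -exprM mul2n.
by move: (z ^+ _) (h _) (h _) => u a b; ring.
Qed.

Section Symbol.
Context (R : realType) (n : nat).
Implicit Types (z : R[i]) (x t : R).
Local Notation normc := (@Normc.normc R).
Let M := n.+1.

Definition bval x : R := bdiff n x / n`!%:R.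

Lemma bval_ge0 x : 0 <= bval x.
Proof. by rewrite divr_ge0// (bdiff_ge0_supp R n).1. Qed.

Lemma bval_out x : (x < 0) || (M%:R <= x) -> bval x = 0.
Proof. by move=> h; rewrite /bval (bdiff_ge0_supp R n).2// mul0r. Qed.

(* The Euler-Frobenius polynomial of order n + 1. *)
Definition symbol z : R[i] := \sum_(j < (M.*2).*2) (bval j%:R)%:C * z ^+ j.

(** The range 4M of summation, far beyond the support [0, M], is what makes this hold:
    multiplication by z^k with k <= M pushes only zero coefficients out of it. *)
Lemma symbol_shift z k : (k <= M)%N ->
  z ^+ k * symbol z = \sum_(j < (M.*2).*2) (bval (j%:R - k%:R))%:C * z ^+ j.
Proof.
elim: k => [|k IH] kM.
  by rewrite expr0 mul1r; apply: eq_bigr => j _; rewrite subr0.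
rewrite exprS -mulrA IH ?(ltnW kM)// mulr_sumr.
have -> : (M.*2).*2 = (M.*2).*2.-1.+1 by [].
rewrite [LHS]big_ord_recr [RHS]big_ord_recl /=.
rewrite [X in _ + X](_ : _ = 0); last first.
  rewrite bval_out ?mul0r ?mulr0//; apply/orP; right.
  rewrite lerBrDr -natrD ler_nat.
  by apply: (@leq_trans (M + M)); [rewrite leq_add2l ltnW|rewrite -ltnS /M !doubleS; lia].
rewrite [X in _ = X + _](_ : _ = 0); last first.
  by rewrite bval_out ?mul0r// sub0r oppr_lt0 ltr0n.
rewrite addr0 add0r; apply: eq_bigr => j _.
rewrite mulrCA -exprS /bump /= add1n; congr (_%:C * _).
by congr bval; rewrite -!natr1; ring.
Qed.

(** The two-scale relation [bdiff_refine] at the points j/2, read as an identity between generating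
    functions. *)
Lemma symbol_refine z : (1 + z) ^+ M * symbol z =
  \sum_(j < (M.*2).*2) 2 ^+ n * (bval (j%:R / 2))%:C * z ^+ j.
Proof.
rewrite exprDn mulr_suml.
under eq_bigr => k _.
  rewrite expr1n mul1r mulrnAl symbol_shift -?sumrMnl; last by rewrite -ltnS.
  over.
rewrite exchange_big /=; apply: eq_bigr => j _.
under eq_bigr do rewrite -mulrnAl.
rewrite -mulr_suml; congr (_ * _).
have -> : 2 ^+ n * (bval (j%:R / 2))%:C = (2 ^+ n * bval (j%:R / 2))%:C :> R[i].
  by rewrite [RHS]rmorphM [X in _ = X * _]rmorphXn /= rmorph_nat.
rewrite /bval mulrA bdiff_refine big_mkord mulr_suml rmorph_sum /=.
apply: eq_bigr => k _; rewrite -rmorphMn /=; congr (_%:C).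
rewrite (_ : 2 * (j%:R / 2) = j%:R); last by field.
by rewrite -mulr_natl mulrA.
Qed.

(** Adding the refinement identities at z and -z keeps the even j, for which j/2 is an integer. *)
Lemma symbol_double z : 2 ^+ M * symbol (z ^+ 2) =
  (1 + z) ^+ M * symbol z + (1 - z) ^+ M * symbol (- z).
Proof.
rewrite !symbol_refine -big_split/=.
under eq_bigr do rewrite -mulrDr.
rewrite (@sum_even_part _ (fun j => 2 ^+ n * (bval (j%:R / 2))%:C) z) /symbol.
rewrite -addnn big_split_ord /= [X in _ * (_ + X)]big1 ?addr0; last first.
  move=> j _; rewrite bval_out ?mul0r//; apply/orP; right.
  by rewrite ler_nat; apply: leq_trans (leq_addr _ _); rewrite -addnn leq_addr.
rewrite [2 ^+ M]exprS -[LHS]mulrA; congr (_ * _); rewrite mulr_sumr; apply: eq_bigr => j _.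
by rewrite -mulrA -[in RHS]muln2 natrM mulfK.
Qed.

Lemma sum_bval J : (M <= J)%N -> \sum_(j < J) bval j%:R = 1.
Proof.
by move=> MJ; rewrite -mulr_suml sum_bdiff// divff// pnatr_eq0 -lt0n fact_gt0.
Qed.

Let MJ : (M <= (M.*2).*2)%N.
Proof. by rewrite -!addnn -!addnA leq_addr. Qed.

Lemma symbol_le1 t : normc (symbol (expi t)) <= 1.
Proof.
apply: (@le_trans _ _ (\sum_(j < (M.*2).*2) bval j%:R)); last by rewrite sum_bval.
apply: le_trans (normc_sum _ _) _; apply: ler_sum => j _.
by rewrite Normc.normcM normc_real normcX normc_expi expr1n mulr1 ger0_norm// bval_ge0.
Qed.

(** The coefficients are nonnegative with sum 1, so the distance to 1 is at most the largest
    exponent times |t|. The crude factor is harmless: t will be divided by 2^N with N tending to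
    infinity. *)
Lemma symbol_near1 t : 1 - (M.*2).*2%:R * `|t| <= normc (symbol (expi t)).
Proof.
have E : normc (symbol (expi t) - 1) <= (M.*2).*2%:R * `|t|.
  have -> : 1 = \sum_(j < (M.*2).*2) (bval j%:R)%:C :> R[i].
    by rewrite -rmorph_sum /= sum_bval.
  rewrite -sumrB; apply: le_trans (normc_sum _ _) _.
  have -> : (M.*2).*2%:R * `|t| = \sum_(j < (M.*2).*2) bval j%:R * ((M.*2).*2%:R * `|t|).
    by rewrite -mulr_suml sum_bval// mul1r.
  apply: ler_sum => j _.
  rewrite -[X in _ - X]mulr1 -mulrBr Normc.normcM normc_real ger0_norm ?bval_ge0//.
  rewrite ler_wpM2l ?bval_ge0// expiX normc_expi_sub1.
  have := abs_sin_le (j%:R * t / 2); rewrite !normrM normr_nat [`|2^-1|]ger0_norm ?invr_ge0// => h.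
  have : j%:R * `|t| <= (M.*2).*2%:R * `|t| by rewrite ler_wpM2r// ler_nat ltnW.
  by lra.
have := le_normcD (symbol (expi t)) (1 - symbol (expi t)).
rewrite addrC subrK Normc.normc1 -[normc (1 - _)]normcN opprB.
by move: E; move: (normc _) (normc _) => a b; lra.
Qed.

Lemma symbolJ t : normc (symbol (expi (- t))) = normc (symbol (expi t)).
Proof.
have conjX (z : R[i]) k : (z ^+ k)^*%C = (z^*%C) ^+ k.
  elim: k => [|k IH]; first by rewrite !expr0 /= oppr0.
  by rewrite !exprS rmorphM /= IH.
have -> : symbol (expi (- t)) = (symbol (expi t))^*%C.
  rewrite /symbol rmorph_sum /=; apply: eq_bigr => j _.
  rewrite [RHS]rmorphM /= conjX /expi cosN sinN; congr (_ * _ ^+ _).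
  by rewrite oppr0.
by case: (symbol _) => a b /=; rewrite sqrrN.
Qed.

(** For n >= 1, Poisson summation identifies it with i^(n+1) times the sum of (t + 2 pi k)^-(n+1)
    over all integers k; splitting that sum by the parity of k explains the doubling relation. *)
Definition symratio t : R[i] := symbol (expi t) / (1 - expi t) ^+ M.

Lemma expi_pi t : expi (t + pi) = - expi t :> R[i].
Proof. by rewrite /expi cosDpi sinDpi; apply/eqP; rewrite eq_complex /= !eqxx. Qed.

Lemma normc_1sub_expi t : 0 <= t <= 2 * pi -> normc (1 - expi t) = 2 * sin (t / 2).
Proof.
move=> /andP[t0 tp]; rewrite -normcN opprB normc_expi_sub1 ger0_norm//.
by apply: sin_ge0_pi; apply/andP; split; lra.
Qed.

Lemma sub_expi_neq0 t : 0 < t < 2 * pi -> 1 - expi t != 0 :> R[i].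
Proof.
move=> /andP[t0 tp]; apply/eqP => h.
have := @normc_1sub_expi t; rewrite h Normc.normc0 (ltW t0) (ltW tp) => /(_ isT) /eqP.
by rewrite eq_sym mulf_eq0 pnatr_eq0/= gt_eqF// sin_gt0_pi//; apply/andP; split; lra.
Qed.

Lemma symratio_double t : 0 < t < pi ->
  2 ^+ M * symratio (2 * t) = symratio t + symratio (t + pi).
Proof.
move=> /andP[t0 tp]; rewrite /symratio.
have n1 : 1 - expi t != 0 :> R[i] by apply: sub_expi_neq0; apply/andP; split; lra.
have n2 : 1 + expi t != 0 :> R[i].
  by rewrite -[expi t]opprK -expi_pi; apply: sub_expi_neq0; apply/andP; split; lra.
have e2 : expi (2 * t) = expi t ^+ 2 :> R[i] by rewrite expiX.
rewrite expi_pi e2 opprK mulrA symbol_double.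
have -> : 1 - expi t ^+ 2 = (1 - expi t) * (1 + expi t) :> R[i] by ring.
move: (expi t) n1 n2 => z n1 n2.
rewrite exprMn mulrDl; congr (_ + _).
  by rewrite [(1 + z) ^+ M * _]mulrC -mulf_div divff ?mulr1 ?expf_neq0.
by rewrite -mulf_div divff ?mul1r ?expf_neq0.
Qed.

Lemma normc_symratio t : 0 < t < 2 * pi ->
  normc (symratio t) = normc (symbol (expi t)) / (2 * sin (t / 2)) ^+ M.
Proof.
move=> /andP[t0 tp]; rewrite /symratio Normc.normcM Normc.normcV normcX normc_1sub_expi//.
by rewrite !ltW.
Qed.

End Symbol.

(** The values lie in an arbitrary commutative ring because the iteration serves twice: for the
    complex [symratio] and for the real function (2 sin(s/2))^-2. *)
Lemma doubling_iter (R : realType) (V : comNzRingType) (F : R -> V) (q : V) :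
  (forall s : R, 0 < s < pi -> q * F (2 * s) = F s + F (s + pi)) ->
  forall N (t : R), 0 < t < 2 * pi ->
  q ^+ N * F t = \sum_(0 <= k < 2 ^ N) F ((t + 2 * pi * k%:R) / 2 ^+ N).
Proof.
move=> dbl N t /andP[t0 t2]; have p0 := pi_gt0 R.
elim: N => [|N IH]; first by rewrite !expr0 mul1r expn0 big_nat1 mulr0 addr0 divr1.
rewrite exprS -mulrA IH mulr_sumr expnS mul2n -addnn.
rewrite [RHS](big_cat_nat (n := 2 ^ N))//= ?leq_addr//.
rewrite [X in _ = _ + X](_ : _ = \sum_(0 <= k < 2 ^ N) F ((t + 2 * pi * (k + 2 ^ N)%:R) / 2 ^+ N.+1)); last first.
  by rewrite -{1}[(2 ^ N)%N]add0n big_addn addnK.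
rewrite -big_split/=.
rewrite big_nat [RHS]big_nat; apply: eq_bigr => k /andP[_ kN].
have K0 : 0 < 2 ^+ N :> R by rewrite exprn_gt0.
have kK : k%:R + 1 <= 2 ^+ N :> R by rewrite natr1 -natrX ler_nat.
have pk : 0 <= 2 * pi * k%:R :> R by rewrite !mulr_ge0// ltW.
have -> : (t + 2 * pi * k%:R) / 2 ^+ N = 2 * ((t + 2 * pi * k%:R) / 2 ^+ N.+1).
  by rewrite exprS invfM; field; rewrite gt_eqF.
rewrite dbl; last first.
  rewrite divr_gt0 ?exprn_gt0//=; last by lra.
  rewrite ltr_pdivrMr ?exprn_gt0// exprS.
  have : pi * (k%:R + 1) <= pi * 2 ^+ N :> R by rewrite ler_pM2l.
  by move: (2 ^+ N) (k%:R) => A B; lra.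
congr (_ + F _); rewrite natrD natrX exprS.
move: (2 ^+ N) K0 (k%:R) (pi : R) => A A0 B P.
by field; rewrite gt_eqF.
Qed.

(** * Two-sided bounds for the Euler-Frobenius polynomial on the unit circle *)

Section SymbolBounds.
Context (R : realType).
Implicit Types (x y t s : R).
Local Notation normc := (@Normc.normc R).

Lemma sin_ge_ends x y : 0 <= x -> x <= y -> y <= pi - x -> sin x <= sin y.
Proof.
move=> x0 xy yx.
have h z : x <= z <= pi / 2 -> sin x <= sin z.
  move=> /andP[z1 z2]; rewrite leNgt ltr_sin ?in_itv/= -?leNgt//.
    by apply/andP; split; lra.
  by apply/andP; split; lra.
have [y2|y2] := leP y (pi / 2); first by apply: h; rewrite xy.
have -> : sin y = sin (pi - y) by rewrite addrC sinDpi sinN opprK.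
by apply: h; apply/andP; split; lra.
Qed.

(** The level-N substitute for x: it equals 2^N |1 - exp(i x / 2^N)| for x in [0, 2^(N+1) pi], which
    is how it enters the denominators. *)
Definition dsine N x : R := 2 ^+ N.+1 * sin (x / 2 ^+ N.+1).

Lemma dsine_le N x : 0 <= x -> dsine N x <= x.
Proof.
move=> x0; have K0 : 0 < 2 ^+ N.+1 :> R by rewrite exprn_gt0.
rewrite /dsine -ler_pdivlMl// [_^-1 * x]mulrC.
have h : 0 <= x / 2 ^+ N.+1 by rewrite divr_ge0// ltW.
by apply: le_trans (ler_norm _) _; apply: le_trans (abs_sin_le _) _; rewrite ger0_norm.
Qed.

Lemma dsine_gt0 N x : 0 < x < 2 ^+ N.+1 * pi -> 0 < dsine N x.
Proof.
move=> /andP[x0 xp]; have K0 : 0 < 2 ^+ N.+1 :> R by rewrite exprn_gt0.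
by rewrite mulr_gt0// sin_gt0_pi// divr_gt0//= ltr_pdivrMr// mulrC.
Qed.

Lemma dsine_ends N x y : 0 <= x -> x <= y -> y <= 2 ^+ N.+1 * pi - x ->
  dsine N x <= dsine N y.
Proof.
move=> x0 xy yx; have K0 : 0 < 2 ^+ N.+1 :> R by rewrite exprn_gt0.
rewrite ler_pM2l// sin_ge_ends ?divr_ge0 ?(ltW K0) ?ler_pM2r ?invr_gt0//.
by rewrite lerBrDr -mulrDl ler_pdivrMr//; move: (2 ^+ N.+1) yx => A; lra.
Qed.

Lemma cvg_geo2 : (fun N : nat => 2 ^- N : R) @ \oo --> (0 : R).
Proof.
have -> : (fun N : nat => 2 ^- N : R) = (fun N => (1 / 2) ^+ N).
  by apply/funext => N; rewrite div1r exprVn.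
by apply: cvg_expr; rewrite ger0_norm; lra.
Qed.

Lemma cvg_dsine x : 0 <= x -> (fun N => dsine N x) @ \oo --> x.
Proof.
move=> x0.
apply: (@squeeze_cvgr _ _ _ _ (fun N => x - x ^+ 3 / 6 * (2 ^- N.+1 * 2 ^- N.+1)) (fun=> x)).
- near=> N; rewrite dsine_le// andbT.
  have K0 : 0 < 2 ^+ N.+1 :> R by rewrite exprn_gt0.
  have h0 : 0 <= x / 2 ^+ N.+1 by rewrite divr_ge0// ltW.
  have [_] := taylor_cos_sin 1 h0; rewrite -signr_odd expr0 mul1r subr_ge0 /= !doubleS !double0 => h.
  rewrite /dsine -ler_pdivrMl//; apply: le_trans h.
  move: (2 ^+ N.+1) K0 => K K0.
  by rewrite le_eqVlt; apply/orP; left; apply/eqP; rewrite /ssum; field; rewrite gt_eqF.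
- rewrite -[X in _ --> X]subr0; apply: cvgB; first exact: cvg_cst.
  have c : (fun N : nat => 2 ^- N.+1 : R) @ \oo --> (0 : R).
    by rewrite (cvg_shiftS (fun N : nat => 2 ^- N : R)); exact: cvg_geo2.
  have -> : 0 = x ^+ 3 / 6 * (0 * 0) :> R by rewrite !mulr0.
  by apply: cvgM; [exact: cvg_cst|apply: cvgM].
- exact: cvg_cst.
Unshelve. all: by end_near. Qed.

(** By 1/sin^2 + 1/cos^2 = 1/(sin^2 cos^2), the function (2 sin(s/2))^-2 satisfies the doubling
    relation with q = 4. This is the finite form of its expansion into the sum of (t + 2 pi
    k)^-2. *)
Lemma sum_dsineV N t : 0 < t < 2 * pi ->
  \sum_(0 <= k < 2 ^ N) (dsine N (t + 2 * pi * k%:R)) ^- 2 = (2 * sin (t / 2)) ^- 2.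
Proof.
move=> t02; pose F s : R := (2 * sin (s / 2)) ^- 2.
have dbl s : 0 < s < pi -> 4 * F (2 * s) = F s + F (s + pi).
  move=> /andP[s0 sp]; rewrite /F.
  have -> : 2 * s / 2 = (s / 2) *+ 2 by rewrite -mulr_natr; field.
  have -> : (s + pi) / 2 = s / 2 + pi / 2 by lra.
  rewrite sinDpihalf sin_mulr2n -mulr_natr.
  have ss : 0 < sin (s / 2) by apply: sin_gt0_pi; apply/andP; split; lra.
  have cc : 0 < cos (s / 2) by apply: cos_gt0_pihalf; apply/andP; split; lra.
  have := cos2Dsin2 (s / 2).
  move: (sin _) ss (cos _) cc => S S0 C C0 E.
  have S0' : S != 0 by rewrite gt_eqF.
  have C0' : C != 0 by rewrite gt_eqF.
  have -> : (2 * S) ^- 2 + (2 * C) ^- 2 = (C ^+ 2 + S ^+ 2) / (4 * S ^+ 2 * C ^+ 2).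
    by field; rewrite S0' C0'.
  by rewrite E; field; rewrite S0' C0'.
have K0 : 2 ^+ N != 0 :> R by rewrite expf_neq0.
have := doubling_iter dbl N t02; rewrite -/(F t) => /(canRL (mulKf _)) ->; last by rewrite expf_neq0.
rewrite mulr_sumr; apply: eq_bigr => k _.
rewrite /F /dsine (_ : (t + 2 * pi * k%:R) / 2 ^+ N / 2 = (t + 2 * pi * k%:R) / 2 ^+ N.+1); last first.
  by rewrite exprS invfM; field; rewrite K0.
move: (sin _) => S; rewrite [2 ^+ N.+1]exprS.
have -> : 4 = 2 ^+ 2 :> R by ring.
by rewrite -exprM mulnC exprM; move: (2 ^+ N) => K; rewrite -invfM -!exprMn; congr (_ ^+ 2)^-1; ring.
Qed.

(** Two of the n + 2 powers are kept for the sum of squares, which is known exactly; the other n are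
    bounded by A. *)
Lemma sum_pow_le i N n (a : nat -> R) A : (i <= N)%N -> 0 <= A ->
  (forall k, (i <= k < N)%N -> 0 <= a k <= A) ->
  \sum_(i <= k < N) a k ^+ n.+2 <= A ^+ n * \sum_(0 <= k < N) a k ^+ 2.
Proof.
move=> iN A0 aA; apply: (@le_trans _ _ (A ^+ n * \sum_(i <= k < N) a k ^+ 2)).
  rewrite mulr_sumr big_nat_cond [leRHS]big_nat_cond; apply: ler_sum => k /andP[/aA /andP[a0 aA'] _].
  by rewrite -addn2 exprD ler_wpM2r ?sqr_ge0// lerXn2r.
rewrite ler_wpM2l ?exprn_ge0// [leRHS](big_cat_nat (n := i))//= lerDr.
by apply: sumr_ge0 => k _; exact: sqr_ge0.
Qed.

Lemma symratio_sum n N t : 0 < t < 2 * pi ->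
  (2 ^+ n.+1) ^+ N * symratio n t = \sum_(0 <= k < 2 ^ N) symratio n ((t + 2 * pi * k%:R) / 2 ^+ N).
Proof. by apply: doubling_iter => s; exact: symratio_double. Qed.

Lemma normc_symratio_node n N k t : 0 < t < 2 * pi -> (k < 2 ^ N)%N ->
  normc (symratio n ((t + 2 * pi * k%:R) / 2 ^+ N)) = (2 ^+ n.+1) ^+ N *
  (normc (symbol n (expi ((t + 2 * pi * k%:R) / 2 ^+ N))) * (dsine N (t + 2 * pi * k%:R))^-1 ^+ n.+1).
Proof.
move=> /andP[t0 t2] kN; have p0 := pi_gt0 R.
have K0 : 0 < 2 ^+ N :> R by rewrite exprn_gt0.
have kK : k%:R + 1 <= 2 ^+ N :> R by rewrite natr1 -natrX ler_nat.
have pk : 0 <= 2 * pi * k%:R :> R by rewrite !mulr_ge0// ltW.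
have h : pi * (k%:R + 1) <= pi * 2 ^+ N :> R by rewrite ler_pM2l.
rewrite normc_symratio; last first.
  rewrite divr_gt0//=; last by lra.
  by rewrite ltr_pdivrMr//; move: (2 ^+ N) (k%:R) h pk => A B; lra.
rewrite [RHS]mulrCA; congr (_ * _).
rewrite /dsine (_ : (t + 2 * pi * k%:R) / 2 ^+ N / 2 = (t + 2 * pi * k%:R) / 2 ^+ N.+1); last first.
  by rewrite exprS invfM; field; rewrite gt_eqF.
move: (sin _) => S; rewrite [2 ^+ N.+1]exprS -exprM mulnC exprM -exprVn -exprMn; congr (_ ^+ n.+1).
rewrite [2 * _]mulrC -mulrA invfM; move: (2 ^+ N) K0 => K K0.
have [->|S0] := eqVneq S 0; first by rewrite !mulr0 invr0 !mul0r mulr0.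
by field; rewrite S0 gt_eqF.
Qed.

Lemma dsine_node_gt0 N k t : 0 < t < 2 * pi -> (k < 2 ^ N)%N ->
  0 < dsine N (t + 2 * pi * k%:R).
Proof.
move=> /andP[t0 t2] kN; have p0 := pi_gt0 R; apply: dsine_gt0.
have pk : 0 <= 2 * pi * k%:R :> R by rewrite !mulr_ge0// ltW.
have kK : k%:R + 1 <= 2 ^+ N :> R by rewrite natr1 -natrX ler_nat.
have h : pi * (k%:R + 1) <= pi * 2 ^+ N :> R by rewrite ler_pM2l.
by rewrite exprS; move: (2 ^+ N) (k%:R) h pk => A B; lra.
Qed.

Lemma normc_symratio_sum n N t (i := 2 ^+ n.+1 ^+ N : R) : 0 < t < 2 * pi ->
  i * normc (symratio n t) =
  normc (\sum_(0 <= k < 2 ^ N) symratio n ((t + 2 * pi * k%:R) / 2 ^+ N)).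
Proof.
move=> t02; rewrite -symratio_sum//.
by rewrite [RHS]Normc.normcM !normcX (_ : 2 = (2 : R)%:C) ?normc_real ?ger0_norm// rmorph_nat.
Qed.

(* The nodes t + 2 pi k with i <= k < 2^N are at distance at least x from the zeros of sine. *)
Lemma symratio_tail n N i t x : 0 < t < 2 * pi -> (i <= 2 ^ N)%N ->
  0 < x -> x <= 2 * pi - t -> x <= t + 2 * pi * i%:R ->
  x < 2 ^+ N.+1 * pi ->
  normc (\sum_(i <= k < 2 ^ N) symratio n.+1 ((t + 2 * pi * k%:R) / 2 ^+ N)) <=
  (2 ^+ n.+2) ^+ N * ((dsine N x)^-1 ^+ n * (2 * sin (t / 2)) ^- 2).
Proof.
move=> t02 iN x0 xt xi xp; have p0 := pi_gt0 R.
apply: le_trans (normc_sum _ _) _.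
rewrite big_nat.
under eq_bigr => k /andP[_ kN] do rewrite normc_symratio_node//.
have Q0 : 0 < (2 ^+ n.+2) ^+ N :> R by rewrite !exprn_gt0.
rewrite -big_nat -mulr_sumr ler_pM2l// -(sum_dsineV N)//.
under [in leRHS]eq_bigr do rewrite -exprVn.
apply: (@le_trans _ _ (\sum_(i <= k < 2 ^ N) (dsine N (t + 2 * pi * k%:R))^-1 ^+ n.+2)).
  rewrite big_nat [leRHS]big_nat; apply: ler_sum => k /andP[_ kN].
  by rewrite ler_piMl ?symbol_le1// exprn_ge0// invr_ge0 ltW// dsine_node_gt0.
have d0 : 0 < dsine N x by apply: dsine_gt0; rewrite x0.
apply: sum_pow_le => //; first by rewrite invr_ge0 ltW.
move=> k /andP[ik kN]; rewrite invr_ge0 ltW ?dsine_node_gt0//=.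
rewrite lef_pV2 ?posrE ?dsine_node_gt0//.
have pk : pi * i%:R <= pi * k%:R :> R by rewrite ler_pM2l// ler_nat.
have kK : k%:R + 1 <= 2 ^+ N :> R by rewrite natr1 -natrX ler_nat.
have h : pi * (k%:R + 1) <= pi * 2 ^+ N :> R by rewrite ler_pM2l.
move: xi; rewrite -![2 * pi * _]mulrA => xi.
by apply: dsine_ends; rewrite ?exprS; [lra|lra|move: (2 ^+ N) h pk => A; lra].
Qed.

(** For t <= pi no node is closer than t to the zeros 0 and 2^(N+1) pi of [dsine N], so
    [symratio_tail] can take all nodes. *)
Lemma normc_symratio_le n N t : 0 < t <= pi ->
  normc (symratio n.+1 t) <= (dsine N t)^-1 ^+ n * (2 * sin (t / 2)) ^- 2.
Proof.
move=> /andP[t0 tp]; have p0 := pi_gt0 R.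
have t2 : 0 < t < 2 * pi by apply/andP; split; lra.
have Q0 : 0 < (2 ^+ n.+2) ^+ N :> R by rewrite !exprn_gt0.
have Kp : pi <= pi * 2 ^+ N :> R by rewrite ler_pMr// exprn_ege1//; lra.
rewrite -(ler_pM2l Q0) normc_symratio_sum//; apply: symratio_tail => //; [lra|lra|].
by rewrite exprS; move: (2 ^+ N) Kp => A; lra.
Qed.

(** The node k = 0 gives the main term, as the symbol is near 1 there and [dsine N t] is at most t.
    All other nodes stay at distance at least 2 pi - t from the zeros of [dsine N] and are
    subtracted as a tail. *)
Lemma normc_symratio_ge n N t : (0 < N)%N -> 0 < t <= pi ->
  (1 - (n.+2.*2).*2%:R * (t * 2 ^- N)) * t^-1 ^+ n.+2 -
    (dsine N (2 * pi - t))^-1 ^+ n * (2 * sin (t / 2)) ^- 2 <= normc (symratio n.+1 t).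
Proof.
move=> N0 /andP[t0 tp]; have p0 := pi_gt0 R.
have t2 : 0 < t < 2 * pi by apply/andP; split; lra.
have Q0 : 0 < (2 ^+ n.+2) ^+ N :> R by rewrite !exprn_gt0.
have K0 : 0 < 2 ^+ N :> R by rewrite exprn_gt0.
have Kp : 2 * pi <= pi * 2 ^+ N :> R.
  by rewrite [2 * _]mulrC ler_pM2l// -(prednK N0) exprS ler_pMr// exprn_ege1//; lra.
have tail : normc (\sum_(1 <= k < 2 ^ N) symratio n.+1 ((t + 2 * pi * k%:R) / 2 ^+ N)) <=
  (2 ^+ n.+2) ^+ N * ((dsine N (2 * pi - t))^-1 ^+ n * (2 * sin (t / 2)) ^- 2).
  apply: symratio_tail => //; rewrite ?expn_gt0 ?mulr1//; [lra|lra|].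
  by rewrite exprS; move: (2 ^+ N) Kp => A; lra.
have head : (2 ^+ n.+2) ^+ N * ((1 - (n.+2.*2).*2%:R * (t * 2 ^- N)) * t^-1 ^+ n.+2) <=
    normc (symratio n.+1 ((t + 2 * pi * 0%:R) / 2 ^+ N)).
  rewrite normc_symratio_node ?expn_gt0// mulr0 addr0 ler_pM2l//.
  have d0 : 0 < dsine N t.
    by apply: dsine_gt0; rewrite t0 exprS/=; move: (2 ^+ N) Kp => A; lra.
  have s1 := symbol_near1 n.+1 (t / 2 ^+ N).
  rewrite ger0_norm in s1; last by rewrite divr_ge0 ?ltW.
  have [neg|nneg] := leP (1 - (n.+2.*2).*2%:R * (t * 2 ^- N)) 0.
    apply: (@le_trans _ _ 0); last by rewrite mulr_ge0 ?normc_ge0 ?exprn_ge0 ?invr_ge0 ?(ltW d0).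
    by rewrite mulr_le0_ge0// exprn_ge0// invr_ge0 ltW.
  apply: ler_pM => //; first exact: ltW.
    by rewrite exprn_ge0// invr_ge0 ltW.
  by rewrite lerXn2r ?nnegrE ?invr_ge0 ?(ltW t0) ?(ltW d0)// lef_pV2 ?posrE// dsine_le// ltW.
rewrite -(ler_pM2l Q0) normc_symratio_sum// big_ltn ?expn_gt0// mulrBr.
move: tail head; set T := \sum_(1 <= k < _) _; set F := symratio n.+1 _.
have := le_normcD (F + T) (- T); rewrite addrK [normc (- T)]normcN.
by move: (normc F) (normc T) (normc (F + T)) (_ * (_ * _)) (_ * (_ * _)) => ? ? ? ? ?; lra.
Qed.

(** The limit of the finite bounds as N grows. The exponent is n although the order is n + 2: two
    powers were spent on the sum of squares. *)
Lemma symbol_le n t : 0 < t <= pi ->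
  normc (symbol n.+1 (expi t)) <= (2 * sin (t / 2) / t) ^+ n.
Proof.
move=> /andP[t0 tp]; have p0 := pi_gt0 R.
have s0 : 0 < 2 * sin (t / 2) by rewrite mulr_gt0// sin_gt0_pi//; apply/andP; split; lra.
have h : normc (symratio n.+1 t) <= t^-1 ^+ n * (2 * sin (t / 2)) ^- 2.
  have c : (fun N => (dsine N t)^-1 ^+ n * (2 * sin (t / 2)) ^- 2) @ \oo --> t^-1 ^+ n * (2 * sin (t / 2)) ^- 2.
    apply: cvgM; last exact: cvg_cst.
    have c1 : (fun N => (dsine N t)^-1) @ \oo --> t^-1.
      by apply: cvgV; [rewrite gt_eqF|apply: cvg_dsine; exact: ltW].
    exact: (continuous_cvg _ (@exprn_continuous R n _) c1).
  apply: (@closed_cvg _ _ _ _ _ (fun y => normc (symratio n.+1 t) <= y) (@closed_ge R _) _ _ c).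
  by near=> N; apply: normc_symratio_le; rewrite t0.
move: h; rewrite normc_symratio; last by apply/andP; split; lra.
move: (normc _) (2 * sin _) s0 => S s s0.
rewrite ler_pdivrMr ?exprn_gt0// => /le_trans; apply.
have sn : s != 0 by rewrite gt_eqF.
by rewrite -[n.+2]add2n exprD mulrA divfK ?expf_neq0// -exprMn mulrC.
Unshelve. all: by end_near. Qed.

Lemma symbol_ge n t : 0 < t <= pi ->
  (2 * sin (t / 2) / t) ^+ n.+2 - (2 * sin (t / 2) / (2 * pi - t)) ^+ n <=
  normc (symbol n.+1 (expi t)).
Proof.
move=> /andP[t0 tp]; have p0 := pi_gt0 R.
have s0 : 0 < 2 * sin (t / 2) by rewrite mulr_gt0// sin_gt0_pi//; apply/andP; split; lra.
have d0 : 0 < 2 * pi - t by lra.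
have h : t^-1 ^+ n.+2 - (2 * pi - t)^-1 ^+ n * (2 * sin (t / 2)) ^- 2 <= normc (symratio n.+1 t).
  have c : (fun N => (1 - (n.+2.*2).*2%:R * (t * 2 ^- N)) * t^-1 ^+ n.+2 -
      (dsine N (2 * pi - t))^-1 ^+ n * (2 * sin (t / 2)) ^- 2) @ \oo -->
      (1 - (n.+2.*2).*2%:R * (t * 0)) * t^-1 ^+ n.+2 -
      (2 * pi - t)^-1 ^+ n * (2 * sin (t / 2)) ^- 2.
    apply: cvgB; apply: cvgM; try exact: cvg_cst.
      apply: cvgB; first exact: cvg_cst.
      by do 2 (apply: cvgM; first exact: cvg_cst); exact: cvg_geo2.
    have c1 : (fun N => (dsine N (2 * pi - t))^-1) @ \oo --> (2 * pi - t)^-1.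
      by apply: cvgV; [rewrite gt_eqF|apply: cvg_dsine; exact: ltW].
    exact: (continuous_cvg _ (@exprn_continuous R n _) c1).
  rewrite !mulr0 subr0 mul1r in c.
  apply: (@closed_cvg _ _ _ _ _ (fun y => y <= normc (symratio n.+1 t)) (@closed_le R _) _ _ c).
  by exists 1%N => // N /= N0; apply: normc_symratio_ge; rewrite ?t0.
move: h; rewrite normc_symratio; last by apply/andP; split; lra.
move: (normc _) (2 * sin _) s0 => S s s0.
rewrite ler_pdivlMr ?exprn_gt0//; apply: le_trans.
have sn : s != 0 by rewrite gt_eqF.
rewrite mulrBl -exprMn [t^-1 * s]mulrC lerD2l lerN2.
by rewrite -[n.+2]add2n exprD mulrA divfK ?expf_neq0// -exprMn mulrC.
Qed.

(** For t <= pi/2 the distance 2 pi - t is at least 3t, so the subtracted term is at most r^n / 9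
    with r = 2 sin(t/2) / t. Since r >= 1/2, this is at most half of r^(n+2). *)
Lemma symbol_ge_half n t : (2 <= n)%N -> 0 < t <= pi / 2 ->
  1 / 2 * (2 * sin (t / 2) / t) ^+ n.+2 <= normc (symbol n.+1 (expi t)).
Proof.
move=> n2 /andP[t0 tp]; have p0 := pi_gt0 R; have p4 : pi <= 4 :> R by have := pi_bounds R; lra.
have h : 0 < t <= pi by apply/andP; split; lra.
apply: le_trans (symbol_ge n h).
have s0 : 0 < 2 * sin (t / 2) by rewrite mulr_gt0// sin_gt0_pi//; apply/andP; split; lra.
have r1 : 2 / 4 <= 2 * sin (t / 2) / t.
  have c : 2 / pi * (t / 2) <= sin (t / 2) by apply: sin_ge_chord; apply/andP; split; lra.
  rewrite ler_pdivlMr//; apply: (@le_trans _ _ (2 * (2 / pi * (t / 2)))); last by lra.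
  rewrite (_ : 2 * (2 / pi * (t / 2)) = 2 / pi * t); last by move: (pi^-1 : R) => P; field.
  by rewrite ler_pM2r// ler_pM2l// lef_pV2 ?posrE.
have r2 : 2 * sin (t / 2) / (2 * pi - t) <= 2 * sin (t / 2) / t / 3.
  by rewrite -[leRHS]mulrA ler_pM2l// -invfM lef_pV2 ?posrE; lra.
have r3 : 0 <= 2 * sin (t / 2) / (2 * pi - t) by rewrite divr_ge0 ?(ltW s0)//; lra.
have r0 : 0 < 2 * sin (t / 2) / t by lra.
move: (2 * sin _ / t) (2 * sin _ / (_ - t)) r0 r1 r2 r3 => r v r0 r1 r2 r3.
have vn : v ^+ n <= r ^+ n * (1 / 9).
  apply: (@le_trans _ _ ((r / 3) ^+ n)); first by rewrite lerXn2r ?nnegrE; lra.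
  rewrite expr_div_n ler_wpM2l ?exprn_ge0 ?(ltW r0)// -(subnK n2) exprD div1r.
  rewrite lef_pV2 ?posrE ?mulr_gt0 ?exprn_gt0//.
  have : 1 <= 3 ^+ (n - 2) :> R by rewrite exprn_ege1//; lra.
  by move: (3 ^+ (n - 2)) => u u1; rewrite expr2; lra.
have rn : 0 <= r ^+ n * (r ^+ 2 - 2 / 9).
  by rewrite mulr_ge0 ?exprn_ge0 ?(ltW r0)//; nra.
rewrite -[n.+2]addn2 exprD.
move: vn rn; move: (r ^+ n) (v ^+ n) (r ^+ 2) => a b c; lra.
Qed.

End SymbolBounds.

(** * Spline wavelets *)

Section SplineTransform.
Context (R : realType).
Implicit Types (x w : R).
Local Notation normc := (@Normc.normc R).

Lemma derive1n_Bspline n j : (j < n)%N ->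
  derive1n j (@Bspline R n.+1) =
  (fun x => ((n - j)`!%:R)^-1 * iter n.+1 (@diffop R) (tpow (n - j)) x).
Proof.
elim: j => [|j IH] jn; first by apply/funext => x; rewrite subn0 /= BsplineE.
rewrite derive1nS IH 1?ltnW//; apply/funext => x.
have [k kE] : exists k, (n - j = k.+2)%N by exists (n - j).-2; lia.
have -> : (n - j.+1 = k.+1)%N by lia.
rewrite kE derive1E.
have d1 (y : R) := deriv_diffop n.+1 (@deriv_tpow R k) y.
have d2 := dM (dconst ((k.+2)`!%:R)^-1 x) (d1 x).
rewrite (@derive_val _ _ _ _ _ _ _ d2) mul0r add0r diffop_scale mulrA.
congr (_ * _); rewrite [in LHS]factS natrM invfM.
by rewrite mulrAC mulVf ?mul1r// pnatr_eq0.
Qed.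

Lemma bval0 n : bval n.+1 (0 : R) = 0.
Proof.
rewrite /bval bdiffS mul0r add0r sub0r (bdiff_ge0_supp R n).2 ?mulr0 ?mul0r//.
by rewrite oppr_lt0 ltr01.
Qed.

Variables (m n : nat) (nE : n.+1 = (2 * m.+2)%N).

(** In a pair, [j.1] is the shift in the definition of the wavelet of order m + 2 and [j.2] the term
    of the differentiated B-spline. The power of 2 in the wavelet cancels against the dilation of
    the truncated powers. *)
Definition wcoef (j : 'I_n * 'I_n.+2) : R :=
  ((m.+1)`!%:R)^-1 * ((-1) ^+ j.1 * bval n j.1.+1%:R * ((-1) ^+ j.2 * 'C(n.+1, j.2)%:R)).
Definition wknot (j : 'I_n * 'I_n.+2) : R := (j.1 + j.2)%:R / 2.

Lemma spline_waveletE x : spline_wavelet m.+2 x = spl wcoef wknot m.+1 x.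
Proof.
rewrite /spline_wavelet -nE /spl [n.+1.-1]/= [m.+2.-1]/=.
rewrite -(pair_bigA _ (fun i j => wcoef (i, j) * tpow m.+1 (x - wknot (i, j)))) big_mkord.
have mn : (m.+2 < n)%N by lia.
apply: eq_bigr => i _.
rewrite [Bspline n.+1 _]BsplineE (derive1n_Bspline mn).
have -> : (n - m.+2 = m.+1)%N by lia.
rewrite /diffop iter_shiftopE big_mkord !mulr_sumr; apply: eq_bigr => k _.
rewrite /wcoef /wknot /bval [(i, k).1]/= [(i, k).2]/=.
have -> : 2 * x - i%:R - k%:R * 1 = 2 * (x - (i + k)%:R / 2) by rewrite natrD; field.
have -> : tpow m.+1 (2 * (x - (i + k)%:R / 2)) = 2 ^+ m.+1 * tpow m.+1 (x - (i + k)%:R / 2).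
  by rewrite /tpow pmulr_rge0//; case: ifP => _; rewrite ?mulr0// exprMn.
have Q0 : 2 ^+ m.+1 != 0 :> R by rewrite expf_neq0// pnatr_eq0.
move: (tpow _ _) (bdiff _ _) (n`!%:R^-1) ((m.+1)`!%:R^-1) ('C(_, _)%:R) (2 ^+ m.+1) Q0 => T B F1 F2 C Q Q0.
by move: ((-1) ^+ i) ((-1) ^+ k) => e1 e2; field.
Qed.

Lemma wknot_bounds j : 0 <= wknot j <= (n + n)%:R.
Proof.
rewrite divr_ge0//= ler_pdivrMr// -natrM ler_nat.
by case: j => -[i hi] [k hk] /=; lia.
Qed.

(** For each fixed shift the inner sum is a difference of order n + 1 of a polynomial of degree at
    most n. *)
Lemma wcoef_moments i : (i < n.+1)%N -> forall x, \sum_j wcoef j * (x - wknot j) ^+ i = 0.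
Proof.
move=> iN x.
rewrite -(pair_bigA _ (fun a b => wcoef (a, b) * (x - wknot (a, b)) ^+ i)) /=.
apply: big1 => a _.
have z : ((m.+1)`!%:R)^-1 * ((-1) ^+ a * bval n a.+1%:R) / 2 ^+ i *
    iter n.+1 (@diffop R) (fun y => y ^+ i) (2 * x - a%:R) = 0.
  by rewrite diffop_monomial ?mulr0.
rewrite -[RHS]z /diffop iter_shiftopE big_mkord mulr_sumr; apply: eq_bigr => k _.
rewrite /wcoef /wknot /=.
have -> : 2 * x - a%:R - k%:R * 1 = 2 * (x - (a + k)%:R / 2) by rewrite natrD; field.
rewrite exprMn.
have Q0 : 2 ^+ i != 0 :> R by rewrite expf_neq0// pnatr_eq0.
move: (_ ^+ i) (bval _ _) (_ ^-1) ('C(_, _)%:R) (2 ^+ i) Q0 => T B F C Q Q0.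
by field.
Qed.

(** The double sum factors: the alternating B-spline values give the symbol at -e, with indices
    shifted by one and hence up to a unimodular factor, and the binomial sum gives (1 - e)^(n+1). *)
Lemma sum_wcoef w : normc (\sum_j (wcoef j)%:C * expi (wknot j * w)) =
  ((m.+1)`!%:R)^-1 * normc (symbol n (- expi (w / 2))) * (2 * `|sin (w / 4)|) ^+ n.+1.
Proof.
set e := expi (w / 2).
have -> : \sum_j (wcoef j)%:C * expi (wknot j * w) =
    (((m.+1)`!%:R)^-1)%:C * (\sum_(a < n) (bval n a.+1%:R)%:C * (- e) ^+ a) * (1 - e) ^+ n.+1.
  rewrite exprDn -mulrA mulr_suml mulr_sumr.
  rewrite -(pair_bigA _ (fun a b => (wcoef (a, b))%:C * expi (wknot (a, b) * w))) /=.
  apply: eq_bigr => a _; rewrite !mulr_sumr; apply: eq_bigr => k _.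
  have -> : expi (wknot (a, k) * w) = e ^+ a * e ^+ k.
    by rewrite -exprD /e expiX /wknot /=; congr expi; ring.
  rewrite expr1n mul1r -[_ *+ 'C(_, _)]mulr_natr -[in (- e) ^+ a]mulN1r -[in (- e) ^+ k]mulN1r !exprMn.
  rewrite /wcoef [(a, k).1]/= [(a, k).2]/=.
  have -> : forall F S1 B S2 C : R, (F * (S1 * B * (S2 * C)))%:C = F%:C * (S1%:C * B%:C * (S2%:C * C%:C)).
    by move=> *; rewrite !rmorphM.
  have sg q : ((-1) ^+ q)%:C = (-1) ^+ q :> R[i] by rewrite rmorphXn rmorphN1.
  rewrite !sg [('C(_, _)%:R)%:C]rmorph_nat.
  by move: (_%:C) (_%:C) ((-1) ^+ a) ((-1) ^+ k) (e ^+ a) (e ^+ k) => F B s1 s2 e1 e2; ring.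
rewrite !Normc.normcM normcX normc_real ger0_norm; last by rewrite invr_ge0.
have -> : normc (1 - e) = 2 * `|sin (w / 4)|.
  by rewrite -normcN opprB normc_expi_sub1; congr (2 * `|sin _|); field.
congr (_ * _ * _).
have -> : symbol n (- e) = - e * \sum_(a < n) (bval n a.+1%:R)%:C * (- e) ^+ a.
  rewrite /symbol.
  have -> : (n.+1.*2.*2 = n.+1 + (n.+1 + n.+1.*2))%N by lia.
  rewrite big_split_ord /= [X in _ + X]big1 ?addr0; last first.
    move=> i _; rewrite bval_out ?mul0r//; apply/orP; right.
    by rewrite ler_nat leq_addr.
  rewrite big_ord_recl (_ : bval n (ord0 : 'I_n.+1)%:R = 0) ?mul0r; last first.
    by have -> : n = n.-1.+1 by [lia]; exact: bval0.
  rewrite add0r mulr_sumr; apply: eq_bigr => i _.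
  by rewrite mulrCA -exprS.
by rewrite [RHS]Normc.normcM normcN normc_expi mul1r.
Qed.

Lemma normc_spline_ft w : w != 0 ->
  normc (fourier (fun x => (spline_wavelet m.+2 x)%:C) w) =
  (Num.sqrt (2 * pi))^-1 * (`|w| ^- m.+2 * (2 * `|sin (w / 4)|) ^+ n.+1) *
  normc (symbol n (- expi (w / 2))).
Proof.
move=> w0; under eq_fun do rewrite spline_waveletE.
have mom i : (i <= m.+1)%N -> forall x, \sum_j wcoef j * (x - wknot j) ^+ i = 0.
  by move=> im; apply: wcoef_moments; lia.
rewrite (normc_fourier_spl w0 _ wknot_bounds mom)// sum_wcoef.
have gen (F k a b c : R) : F != 0 -> k * (F / a) * (F^-1 * b * c) = k * (a^-1 * c) * b.
  move=> F0; have [->|a0] := eqVneq a 0; first by rewrite invr0 !(mul0r, mulr0).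
  by field; rewrite a0 F0.
by apply: (gen ((m.+1)`!%:R)); rewrite pnatr_eq0 -lt0n fact_gt0.
Qed.

Lemma spline_ft0 : normc (fourier (fun x => (spline_wavelet m.+2 x)%:C) 0) = 0.
Proof.
have mom i : (i <= m.+2)%N -> forall x, \sum_j wcoef j * (x - wknot j) ^+ i = 0.
  by move=> im; apply: wcoef_moments; lia.
rewrite /fourier Normc.normcM /Cintegral.
have -> : (fun x : R => complex.Re ((spline_wavelet m.+2 x)%:C * expi (- (x * 0)))) = spl wcoef wknot m.+1.
  by apply/funext => x; rewrite mulr0 oppr0 expi0 mulr1 spline_waveletE.
have -> : (fun x : R => complex.Im ((spline_wavelet m.+2 x)%:C * expi (- (x * 0)))) = fun=> 0.
  by apply/funext => x; rewrite mulr0 oppr0 expi0 mulr1.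
by rewrite (integral_spl _ wknot_bounds mom)// /Rintegral integral0 Normc.normc0 mulr0.
Qed.

End SplineTransform.

(** * Exponential bounds for the transform of the spline wavelet *)

Section SplineBounds.
Context (R : realType) (k n e : nat).
Hypotheses (k2 : (2 <= k)%N) (ek : e = (2 * k)%N) (en : e = n.+2).
Implicit Types (x w : R).
Local Notation normc := (@Normc.normc R).
Let k0 : R := (Num.sqrt (2 * pi))^-1.

Definition spline_ft w := fourier (fun x : R => (spline_wavelet k x)%:C) w.

(** The three factors match those of the transform at |w| = 4 (pi/2 - x): the power of |w|, the
    power of |sin(w/4)| = cos x, and the symbol at the angle 2x. *)
Lemma profile_prod x : profile x = (4 * (pi / 2 - x))^-1 * (2 * cos x) ^+ 2 * (sin x / x) ^+ 2.
Proof.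
rewrite /profile (_ : 2 * x = x *+ 2) ?mulr_natl// sin_mulr2n -[cos x * sin x *+ 2]mulr_natl.
have [->|x0] := eqVneq x 0; first by rewrite sin0 !(mulr0, mul0r, expr0n, invr0).
move: (pi / 2 - x) (sin x) (cos x) => w s c.
have [->|w0] := eqVneq w 0; first by rewrite mul0rn mul0r invr0 !(mul0r, mulr0).
by field; rewrite x0 w0.
Qed.

Let expr_split (a b c : R) :
  (a * b ^+ 2 * c ^+ 2) ^+ k = a ^+ k * b ^+ e * c ^+ e.
Proof. by rewrite [LHS]exprMn [(a * _) ^+ k]exprMn -!exprM ek. Qed.

Lemma symbol_reflect w :
  normc (symbol n.+1 (- expi (w / 2))) = normc (symbol n.+1 (expi (2 * (pi / 2 - `|w| / 4)))).
Proof.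
have -> : 2 * (pi / 2 - `|w| / 4) = pi - `|w| / 2 by lra.
have [w0|w0] := leP 0 w.
  rewrite (ger0_norm w0) -symbolJ; congr (normc (symbol _ _)).
  have -> : - (pi - w / 2) = w / 2 - pi by lra.
  by rewrite -[w / 2 in LHS](subrK pi) expi_pi opprK.
rewrite -expi_pi (ltr0_norm w0); congr (normc (symbol _ (expi _))); lra.
Qed.

Lemma normc_sft w : w != 0 -> normc (spline_ft w) =
  k0 * (`|w| ^- k * (2 * `|sin (w / 4)|) ^+ e) * normc (symbol n.+1 (- expi (w / 2))).
Proof.
move=> w0; rewrite /spline_ft.
have [m mE] : exists m, k = m.+2 by exists k.-2; lia.
have nE : n.+2 = (2 * m.+2)%N by rewrite -mE -ek.
by rewrite mE (normc_spline_ft nE) // en.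
Qed.

Lemma sft_0 : normc (spline_ft 0) = 0.
Proof.
have [m mE] : exists m, k = m.+2 by exists k.-2; lia.
have nE : n.+2 = (2 * m.+2)%N by rewrite -mE -ek.
by rewrite /spline_ft mE (spline_ft0 _ nE).
Qed.

Lemma normc_sft_reflect x : x < pi / 2 ->
  normc (spline_ft (4 * (pi / 2 - x))) = k0 * ((4 * (pi / 2 - x))^-1 ^+ k *
    (2 * `|cos x|) ^+ e) * normc (symbol n.+1 (expi (2 * x))).
Proof.
move=> xp; have w0 : 0 < 4 * (pi / 2 - x) by lra.
have w0' : 4 * (pi / 2 - x) != 0 by rewrite gt_eqF.
rewrite (normc_sft w0') symbol_reflect (gtr0_norm w0).
have -> : 4 * (pi / 2 - x) / 4 = pi / 2 - x by lra.
have -> : pi / 2 - (pi / 2 - x) = x by lra.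
by rewrite -[pi / 2 - x]opprB sinN sinBpihalf opprK -exprVn.
Qed.

Lemma normc_sftN w : normc (spline_ft (- w)) = normc (spline_ft w).
Proof.
have [->|w0] := eqVneq w 0; first by rewrite oppr0.
have w0' : - w != 0 by rewrite oppr_eq0.
rewrite (normc_sft w0') (normc_sft w0) !symbol_reflect normrN.
by rewrite mulNr sinN normrN.
Qed.

Lemma sft_le x : 0 < x < pi / 2 ->
  normc (spline_ft (4 * (pi / 2 - x))) <= pi ^+ 2 / 4 * profile x ^+ k.
Proof.
move=> /andP[x0 xp]; rewrite normc_sft_reflect//; have p0 := pi_gt0 R.
have c0 : 0 < cos x by apply: cos_gt0_pihalf; apply/andP; split; lra.
have s0 : 0 < sin x by apply: sin_gt0_pi; apply/andP; split; lra.
have w0 : 0 < 4 * (pi / 2 - x) by lra.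
have S : normc (symbol n.+1 (expi (2 * x))) <= pi ^+ 2 / 4 * (sin x / x) ^+ e.
  have t : 0 < 2 * x <= pi by apply/andP; split; lra.
  apply: le_trans (symbol_le n t) _.
  have -> : 2 * sin (2 * x / 2) / (2 * x) = sin x / x.
    have -> : 2 * x / 2 = x by lra.
    by rewrite -mulf_div divff ?mul1r.
  rewrite en -[n.+2]add2n exprD mulrA ler_peMl ?exprn_ge0 ?divr_ge0 ?(ltW s0) ?(ltW x0)//.
  (* [symbol_le] has two powers of sin x / x too few; supplying them costs (pi/2)^2, the origin of
     the constant pi^2 / 4. *)
  have h : 1 <= pi / 2 * (sin x / x).
    have c : 2 / pi * x <= sin x by apply: sin_ge_chord; rewrite !ltW.
    rewrite mulrA ler_pdivlMr// mul1r.
    have h := ler_wpM2l (_ : 0 <= pi / 2) c.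
    have pe : pi / 2 * (2 / pi * x) = x by move: (lt0r_neq0 p0); move: (pi : R) => P P0; field.
    by rewrite -[leLHS]pe h//; lra.
  by rewrite (_ : 4 = 2 ^+ 2) -?expr_div_n -?exprMn ?exprn_ege1//; ring.
rewrite gtr0_norm// profile_prod.
apply: (@le_trans _ _ (1 * ((4 * (pi / 2 - x))^-1 ^+ k * (2 * cos x) ^+ e) *
    (pi ^+ 2 / 4 * (sin x / x) ^+ e))).
  have a0 : 0 <= (4 * (pi / 2 - x))^-1 ^+ k * (2 * cos x) ^+ e.
    by rewrite mulr_ge0 ?exprn_ge0 ?invr_ge0 ?(ltW w0)// mulr_ge0// ltW.
  apply: ler_pM => //; first by rewrite mulr_ge0// ltW// sqrt2piV_gt0.
    exact: normc_ge0.
  by rewrite ler_wpM2r// sqrt2piV_le1.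
by rewrite expr_split mul1r mulrCA.
Qed.

Lemma sft_ge x : 0 < x <= pi / 4 ->
  k0 / 2 * profile x ^+ k <= normc (spline_ft (4 * (pi / 2 - x))).
Proof.
move=> /andP[x0 xp]; have p0 := pi_gt0 R; rewrite normc_sft_reflect; last by lra.
have c0 : 0 < cos x by apply: cos_gt0_pihalf; apply/andP; split; lra.
have w0 : 0 < 4 * (pi / 2 - x) by lra.
have t : 0 < 2 * x <= pi / 2 by apply/andP; split; lra.
have n2 : (2 <= n)%N by lia.
have := symbol_ge_half n2 t; rewrite -en.
have -> : 2 * sin (2 * x / 2) / (2 * x) = sin x / x.
  have -> : 2 * x / 2 = x by lra.
  by rewrite -mulf_div divff ?mul1r.
move=> S; rewrite gtr0_norm// profile_prod.
apply: (@le_trans _ _ (k0 * ((4 * (pi / 2 - x))^-1 ^+ k * (2 * cos x) ^+ e) *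
   (1 / 2 * (sin x / x) ^+ e))).
  rewrite expr_split le_eqVlt; apply/orP; left; apply/eqP.
  by move: (_ ^+ k) ((2 * cos x) ^+ _) ((_ / x) ^+ _) => a b c; field.
rewrite ler_wpM2l//.
have a0 : 0 <= (4 * (pi / 2 - x))^-1 ^+ k * (2 * cos x) ^+ e.
  by rewrite mulr_ge0 ?exprn_ge0 ?invr_ge0 ?(ltW w0)// mulr_ge0// ltW.
by rewrite mulr_ge0// ltW// sqrt2piV_gt0.
Qed.

(** Sine and symbol are simply bounded by 1. This serves |w| >= 2 pi, where pi/2 - |w|/4 is no
    longer positive and the rate is at most 2/pi. *)
Lemma sft_far w : w != 0 -> normc (spline_ft w) <= (4 / `|w|) ^+ k.
Proof.
move=> w0; rewrite normc_sft//.
have s1 : (2 * `|sin (w / 4)|) ^+ e <= 4 ^+ k.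
  rewrite ek exprM lerXn2r ?nnegrE ?exprn_ge0 ?mulr_ge0// (_ : 4 = 2 ^+ 2); last by ring.
  rewrite lerXn2r ?nnegrE ?mulr_ge0// ler_piMr// ler_norml.
  by rewrite sin_geN1 sin_le1.
rewrite expr_div_n mulrC [4 ^+ k / _]mulrC -[leRHS]mul1r; apply: ler_pM.
- exact: normc_ge0.
- by rewrite mulr_ge0 ?(ltW (sqrt2piV_gt0 _))// mulr_ge0 ?invr_ge0 ?exprn_ge0 ?mulr_ge0.
- have -> : - expi (w / 2) = expi (w / 2 + pi) :> R[i] by rewrite expi_pi.
  exact: symbol_le1.
rewrite -[leRHS]mul1r; apply: ler_pM.
- by rewrite ltW// sqrt2piV_gt0.
- by rewrite mulr_ge0 ?invr_ge0 ?exprn_ge0 ?mulr_ge0.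
- exact: sqrt2piV_le1.
- by rewrite ler_wpM2l// invr_ge0 exprn_ge0.
Qed.

End SplineBounds.

(** * The limits for the spline wavelet *)

Section SplineLimit.
Context (R : realType) (p : R) (hp : 1 < p).
Implicit Types (x w : R).
Local Notation normc := (@Normc.normc R).
Let k0 : R := (Num.sqrt (2 * pi))^-1.
Let p0 : 0 < p. Proof. exact: lt_trans ltr01 hp. Qed.

(** Shared by numerator and denominator: [f] is the rate as a function of x and [x0] its maximizer.
    The maximum bounds the norm above; continuity gives a rate above any l < f x0 on a window of
    positive length. *)
Lemma Lpnorm_root_cvg (G : nat -> R -> R[i]) (f : R -> R) x0 C : 0 < C ->
  0 < x0 <= pi / 4 -> {for x0, continuous f} -> 0 < f x0 ->
  (forall m, (2 <= m)%N -> forall w, `|w| <= 2 * pi -> normc (G m w) <= C * f x0 ^+ m) ->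
  (forall m, (2 <= m)%N -> forall w, 2 * pi <= `|w| ->
     normc (G m w) <= C * f x0 ^+ m * (2 * pi / `|w|) ^+ 2) ->
  (forall m, (2 <= m)%N -> forall x, 0 < x <= pi / 4 -> 0 <= f x ->
     k0 / 2 * f x ^+ m <= normc (G m (4 * (pi / 2 - x)))) ->
  (fun m : nat => LpnormC p (G m) `^ (m%:R^-1)) @ \oo --> f x0.
Proof.
move=> C0 /andP[x00 x0p] fc L0 near far low; have pi1 : 1 <= 2 * pi :> R by have := pi_ge2 R; lra.
have pi0 := pi_gt0 R.
have CL m : 0 <= C * f x0 ^+ m by rewrite mulr_ge0 ?exprn_ge0 ?ltW.
have K m : (2 <= m)%N -> forall w : R, normc (G m w) `^ p * (1 + w ^+ 2) <=
    (C * f x0 ^+ m) `^ p * (2 * (2 * pi) ^+ 2).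
  move=> m2; apply: decay_bound => //; first exact: near.
  exact: far.
have K0 m : 0 <= (C * f x0 ^+ m) `^ p * (2 * (2 * pi) ^+ 2) :> R.
  by rewrite mulr_ge0 ?powR_ge0// mulr_ge0// sqr_ge0.
apply: root_cvg => //.
- exists ((2 * (2 * pi) ^+ 2 * pi) `^ p^-1 * C).
    by rewrite mulr_gt0// powR_gt0// !mulr_gt0.
  exists 2%N => // m /= m2; apply: (le_trans (LpnormC_le p0 (K0 m) (K m m2))).
  rewrite -[_ * _ * pi]mulrA powRM ?powR_ge0 ?mulr_ge0 ?sqr_ge0 ?(ltW pi0)//.
  rewrite -powRrM divff ?gt_eqF// powRr1//.
  by rewrite mulrC mulrA.
- move=> l /andP[l0 lL].
  (* The window lies to the left of [x0], so it stays in (0, pi/4], where the lower estimate holds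
     even if [x0] is pi/4. *)
  have [d /andP[d0 dx] dl] : exists2 d : R, 0 < d < x0 & forall x, x0 - d <= x <= x0 -> l < f x.
    have : \forall x \near x0, l < f x by exact: (cvgr_gt (f x0) fc).
    move=> /nbhs_ballP[r /= r0 br].
    exists (Num.min (r / 2) (x0 / 2)).
      by rewrite lt_min gt_min !divr_gt0//=; apply/orP; right; lra.
    move=> x /andP[x1 x2]; apply: br; rewrite /ball/= ger0_norm ?subr_ge0//.
    by move: x1; rewrite lerBlDr -lerBlDl => /le_lt_trans; apply; rewrite gt_min; apply/orP; left; lra.
  exists (k0 / 2 * (4 * (pi / 2 - (x0 - d)) - 4 * (pi / 2 - x0)) `^ p^-1).
    by rewrite !mulr_gt0 ?sqrt2piV_gt0 ?powR_gt0//; lra.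
  exists 2%N => // m /= m2.
  rewrite mulrAC; apply: (LpnormC_ge p0 (K0 m) (K m m2)).
  + by lra.
  + by rewrite mulr_ge0 ?divr_ge0 ?(ltW (sqrt2piV_gt0 _))// exprn_ge0// ltW.
  + move=> w /andP[w1 w2].
    have xd : x0 - d <= pi / 2 - w / 4 <= x0 by apply/andP; split; lra.
    have lx := dl _ xd; move/andP: xd => [xd1 xd2].
    have -> : w = 4 * (pi / 2 - (pi / 2 - w / 4)) by lra.
    apply: le_trans (low m m2 _ _ _).
    * rewrite ler_wpM2l ?divr_ge0 ?(ltW (sqrt2piV_gt0 _))//.
      by rewrite lerXn2r ?nnegrE ?(ltW l0) ?(ltW (lt_trans l0 lx)) ?ltW.
    * by apply/andP; split; lra.
    * exact: ltW (lt_trans l0 lx).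
Qed.

Let en m : (2 <= m)%N -> (2 * m = (2 * m).-2.+2)%N. Proof. by lia. Qed.

Lemma sft_abs m w : (2 <= m)%N -> normc (spline_ft m w) = normc (spline_ft m `|w|).
Proof.
move=> m2; have [w0|w0] := leP 0 w; first by rewrite (ger0_norm w0).
rewrite (ltr0_norm w0); exact: (esym (normc_sftN m2 erefl (en m2) w)).
Qed.

Lemma sft_in m w : (2 <= m)%N -> 0 < `|w| < 2 * pi ->
  normc (spline_ft m w) <= pi ^+ 2 / 4 * profile (pi / 2 - `|w| / 4) ^+ m.
Proof.
move=> m2 /andP[w0 w2]; have x0 : 0 < pi / 2 - `|w| / 4 < pi / 2 by apply/andP; split; lra.
have := sft_le m2 erefl (en m2) x0; rewrite (sft_abs w m2).
have {1}-> : 4 * (pi / 2 - (pi / 2 - `|w| / 4)) = `|w| by lra.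
by [].
Qed.

Lemma sft_out m w : (2 <= m)%N -> 2 * pi <= `|w| ->
  normc (spline_ft m w) <= (2 / pi) ^+ m * (2 * pi / `|w|) ^+ m.
Proof.
move=> m2 w2; have pi0 := pi_gt0 R.
have w0 : 0 < `|w| by lra.
have w0' : w != 0 by rewrite -normr_gt0.
apply: (le_trans (sft_far m2 erefl (en m2) w0')).
rewrite -exprMn (_ : 2 / pi * (2 * pi / `|w|) = 4 / `|w|)//.
move: pi0 w0 => /lt0r_neq0 + /lt0r_neq0; move: (pi : R) `|w| => P W P0 W0.
by field; rewrite P0 W0.
Qed.

Lemma pow_ratio_le m w : (2 <= m)%N -> 2 * pi <= `|w| ->
  (2 * pi / `|w|) ^+ m <= (2 * pi / `|w|) ^+ 2.
Proof.
move=> m2 w2; have pi0 := pi_gt0 R.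
have w0 : 0 < `|w| by lra.
rewrite -(subnK m2) exprD ler_piMl ?sqr_ge0//.
by rewrite exprn_ile1// ?ler_pdivrMr ?mul1r// divr_ge0//; lra.
Qed.

(** The condition on 2/pi says that the frequencies |w| >= 2 pi, whose rate is at most 2/pi, do not
    dominate; x2 <= pi/4 places the maximizer where the lower bound for the symbol holds. *)
Lemma spline_den_cvg x2 : is_xi2 x2 -> x2 <= pi / 4 -> 2 / pi <= profile x2 ->
  (fun m : nat => LpnormC p (fourier (fun x => (spline_wavelet m x)%:C)) `^ (m%:R^-1))
    @ \oo --> profile x2.
Proof.
move=> xi2 x4 l2; have [/andP[x0 xp] _] := xi2.
have pi0 := pi_gt0 R; have pi2 := pi_ge2 R.
have l0 : 0 < profile x2 by apply: lt_le_trans l2; rewrite divr_gt0.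
have C1 : 1 <= pi ^+ 2 / 4 :> R by rewrite ler_pdivlMr// mul1r expr2; nra.
have C0 : 0 < pi ^+ 2 / 4 :> R by exact: lt_le_trans C1.
have x2p : 0 < x2 < pi / 2 by rewrite x0.
have far m : (2 <= m)%N -> forall w, 2 * pi <= `|w| ->
    normc (spline_ft m w) <= pi ^+ 2 / 4 * profile x2 ^+ m * (2 * pi / `|w|) ^+ 2.
  move=> m2 w w2; apply: (le_trans (sft_out m2 w2)).
  have y0 : 0 <= 2 * pi / `|w| by rewrite divr_ge0//; lra.
  apply: ler_pM; [by rewrite exprn_ge0// divr_ge0// ltW|by rewrite exprn_ge0| |exact: pow_ratio_le].
  apply: (@le_trans _ _ (profile x2 ^+ m)).
    by rewrite lerXn2r ?nnegrE ?(ltW l0) ?divr_ge0 ?(ltW pi0).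
  by rewrite ler_peMl ?exprn_ge0 ?(ltW l0).
apply: (@Lpnorm_root_cvg (fun m w => spline_ft m w) _ _ _ C0) => //.
- by rewrite x0.
- apply: differentiable_continuous; apply/derivable1_diffP.
  by have [] := deriv_profile x2p.
- move=> m m2 w w2; have [->|w0] := eqVneq w 0.
    by rewrite (sft_0 R m2 erefl (en m2)) mulr_ge0 ?exprn_ge0 ?(ltW l0) ?(ltW C0).
  have w0' : 0 < `|w| by rewrite normr_gt0.
  (* The boundary |w| = 2 pi corresponds to x = 0, outside the open interval of the profile
     estimate, and goes to the far bound. *)
  move: w2; rewrite le_eqVlt => /orP[/eqP wE|w2].
    apply: (le_trans (far m m2 w _)); first by rewrite wE.
    by rewrite wE divff ?expr1n ?mulr1// mulf_neq0// gt_eqF.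
  have wi : 0 < `|w| < 2 * pi by rewrite w0'.
  apply: (le_trans (sft_in m2 wi)).
  have xx : 0 < pi / 2 - `|w| / 4 < pi / 2 by apply/andP; split; lra.
  rewrite ler_wpM2l ?(ltW C0)// lerXn2r ?nnegrE ?(ltW l0)//; last exact: profile_le.
  case/andP: xx => xx1 xx2.
  by rewrite /profile divr_ge0 ?sqr_ge0// mulr_ge0 ?sqr_ge0//; lra.
- by move=> m m2 x xx _; exact: (sft_ge m2 erefl (en m2)).
Qed.

Definition spline_num m w := (0 +i* w) ^ (- m%:Z) * spline_ft m w.

Lemma normc_spline_num m w : normc (spline_num m w) = `|w| ^- m * normc (spline_ft m w).
Proof. by rewrite /spline_num Normc.normcM normc_ipow. Qed.

Let num_profile x := profile x / (4 * (pi / 2 - x)).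

(** The rate is the square of sin(2x) / (4 (pi/2 - x) x), and the bound 4/pi^2 for this quotient is
    the parabola inequality at u = 2x. *)
Lemma num_profile_le x : 0 < x < pi / 2 -> num_profile x <= 16 / pi ^+ 4.
Proof.
move=> /andP[x0 xp]; have pi0 := pi_gt0 R.
have u : 0 <= 2 * x <= pi by apply/andP; split; lra.
have s0 : 0 <= sin (2 * x) by apply: sin_ge0_pi.
have w0 : 0 < pi / 2 - x by lra.
have h : sin (2 * x) / (4 * (pi / 2 - x) * x) <= 4 / pi ^+ 2.
  rewrite ler_pdivrMr ?mulr_gt0//; apply: le_trans (sin_le_parabola u) _.
  rewrite le_eqVlt; apply/orP; left; apply/eqP.
  by move: (lt0r_neq0 pi0); move: (pi : R) => P P0; field.
have -> : num_profile x = (sin (2 * x) / (4 * (pi / 2 - x) * x)) ^+ 2.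
  rewrite /num_profile /profile; move: (lt0r_neq0 w0) (lt0r_neq0 x0).
  by move: (pi / 2 - x) (sin _) => W s W0 X0; field; rewrite W0 X0.
have -> : 16 / pi ^+ 4 = (4 / pi ^+ 2) ^+ 2 :> R.
  by rewrite expr_div_n -exprM; congr (_ / _); ring.
have d0 : 0 <= sin (2 * x) / (4 * (pi / 2 - x) * x).
  by rewrite divr_ge0// !mulr_ge0// ltW.
by rewrite lerXn2r ?nnegrE// (le_trans d0).
Qed.

Lemma num_profile_quarter : num_profile (pi / 4) = 16 / pi ^+ 4.
Proof.
rewrite /num_profile /profile (_ : 2 * (pi / 4) = pi / 2 :> R); last by lra.
rewrite sin_pihalf; move: (lt0r_neq0 (pi_gt0 R)); move: (pi : R) => P P0.
rewrite (_ : P / 2 - P / 4 = P / 4); last by lra.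
by field.
Qed.

Lemma spline_num_cvg :
  (fun m : nat => LpnormC p (spline_num m) `^ (m%:R^-1)) @ \oo --> 16 / pi ^+ 4.
Proof.
have pi0 := pi_gt0 R; have pi2 := pi_ge2 R; have pi4 : pi <= 4 :> R by have := pi_bounds R; lra.
have C1 : 1 <= pi ^+ 2 / 4 :> R by rewrite ler_pdivlMr// mul1r expr2; nra.
have C0 : 0 < pi ^+ 2 / 4 :> R by exact: lt_le_trans C1.
have L0 : 0 < num_profile (pi / 4) by rewrite num_profile_quarter divr_gt0// exprn_gt0.
have q : 0 < (pi / 4 : R) < pi / 2 by apply/andP; split; lra.
have far m : (2 <= m)%N -> forall w, 2 * pi <= `|w| ->
    normc (spline_num m w) <= pi ^+ 2 / 4 * num_profile (pi / 4) ^+ m * (2 * pi / `|w|) ^+ 2.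
  move=> m2 w w2; rewrite normc_spline_num.
  have w0 : 0 < `|w| by lra.
  have y0 : 0 <= 2 * pi / `|w| by rewrite divr_ge0//; lra.
  apply: (@le_trans _ _ ((2 * pi) ^- m * ((2 / pi) ^+ m * (2 * pi / `|w|) ^+ m))).
    apply: ler_pM; rewrite ?invr_ge0 ?exprn_ge0 ?normc_ge0//; last exact: sft_out.
    by rewrite lef_pV2 ?posrE ?exprn_gt0 ?mulr_gt0// lerXn2r ?nnegrE ?mulr_ge0 ?(ltW pi0).
  rewrite mulrA; apply: ler_pM; [|by rewrite exprn_ge0| |exact: pow_ratio_le].
    by rewrite mulr_ge0 ?invr_ge0 ?exprn_ge0 ?divr_ge0 ?mulr_ge0 ?(ltW pi0).
  (* The rate 1/pi^2 of the far region is below 16/pi^4 because pi <= 4. *)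
  have -> : (2 * pi) ^- m * (2 / pi) ^+ m = (pi ^- 2) ^+ m :> R.
    rewrite -exprVn -exprMn; congr (_ ^+ m).
    by move: (lt0r_neq0 pi0); move: (pi : R) => P P0; field.
  apply: (@le_trans _ _ (num_profile (pi / 4) ^+ m)); last by rewrite ler_peMl ?exprn_ge0 ?(ltW L0).
  rewrite lerXn2r ?nnegrE ?(ltW L0) ?invr_ge0 ?sqr_ge0// num_profile_quarter.
  have -> : 16 / pi ^+ 4 = 16 / pi ^+ 2 * pi ^- 2 :> R.
    by move: (lt0r_neq0 pi0); move: (pi : R) => P P0; field.
  rewrite ler_peMl ?invr_ge0 ?sqr_ge0// ler_pdivlMr ?exprn_gt0// mul1r expr2.
  by rewrite (_ : 16 = 4 * 4) ?ler_pM ?(ltW pi0)//; ring.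
rewrite -num_profile_quarter; apply: (Lpnorm_root_cvg C0) => //.
- by apply/andP; split; lra.
- apply: cvgM.
    apply: differentiable_continuous; apply/derivable1_diffP.
    by have [] := deriv_profile q.
  apply: cvgV; first by rewrite mulf_neq0// subr_eq0 gt_eqF//; case/andP: q.
  by apply: cvgM; [exact: cvg_cst|apply: cvgB; [exact: cvg_cst|exact: cvg_id]].
- move=> m m2 w w2; have [->|w0] := eqVneq w 0.
    by rewrite normc_spline_num (sft_0 R m2 erefl (en m2)) mulr0 mulr_ge0 ?exprn_ge0 ?(ltW L0) ?(ltW C0).
  have w0' : 0 < `|w| by rewrite normr_gt0.
  move: w2; rewrite le_eqVlt => /orP[/eqP wE|w2].
    apply: (le_trans (far m m2 w _)); first by rewrite wE.
    by rewrite wE divff ?expr1n ?mulr1// mulf_neq0// gt_eqF.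
  have wi : 0 < `|w| < 2 * pi by rewrite w0'.
  rewrite normc_spline_num; apply: (@le_trans _ _ (`|w| ^- m * (pi ^+ 2 / 4 * profile (pi / 2 - `|w| / 4) ^+ m))).
    by rewrite ler_wpM2l ?invr_ge0 ?exprn_ge0// sft_in.
  have xx : 0 < pi / 2 - `|w| / 4 < pi / 2 by apply/andP; split; lra.
  have -> : `|w| ^- m * (pi ^+ 2 / 4 * profile (pi / 2 - `|w| / 4) ^+ m) =
      pi ^+ 2 / 4 * num_profile (pi / 2 - `|w| / 4) ^+ m.
    rewrite /num_profile.
    have -> : 4 * (pi / 2 - (pi / 2 - `|w| / 4)) = `|w| by lra.
    by rewrite mulrCA [(_ / `|w|) ^+ m]expr_div_n [_ ^- m * _]mulrC.
  rewrite ler_wpM2l ?(ltW C0)// lerXn2r ?nnegrE ?(ltW L0)//; last by rewrite num_profile_quarter num_profile_le.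
  case/andP: xx => xx1 xx2.
  by rewrite /num_profile /profile !divr_ge0 ?sqr_ge0// mulr_ge0 ?sqr_ge0//; lra.
- move=> m m2 x xx _; have [x0 xp] := andP xx.
  rewrite normc_spline_num gtr0_norm; last by lra.
  have -> : k0 / 2 * num_profile x ^+ m = (4 * (pi / 2 - x)) ^- m * (k0 / 2 * profile x ^+ m).
    by rewrite [RHS]mulrCA; congr (_ * _); rewrite /num_profile [(profile x / _) ^+ m]expr_div_n mulrC.
  by rewrite ler_wpM2l ?invr_ge0 ?exprn_ge0 ?(sft_ge m2 erefl (en m2))//; lra.
Qed.

Lemma C_spline_cvg x2 : is_xi2 x2 -> x2 <= pi / 4 -> 2 / pi <= profile x2 ->
  (fun m : nat => C_spline p m `^ (m%:R^-1)) @ \oo --> 16 / pi ^+ 4 / profile x2.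
Proof.
move=> xi2 x4 l2; apply: root_div_cvg.
- by move=> m; exact: LpnormC_ge0.
- by move=> m; exact: LpnormC_ge0.
- by rewrite gt_eqF// (lt_le_trans _ l2)// divr_gt0 ?pi_gt0.
- exact: spline_num_cvg.
- exact: spline_den_cvg.
Qed.

End SplineLimit.

(** * Numerical values and the conclusion *)

Section Decimals.
Context (R : realType).

Lemma decimal_cons d ds : decimal R (d :: ds) = (d%:R + decimal R ds) / 10.
Proof.
rewrite /decimal /= big_nat_recl//= expr1 mulrDl mulr_suml; congr (_ + _).
by apply: eq_bigr => i _; rewrite [10 ^+ i.+2]exprSr invfM mulrA.
Qed.

Lemma decimal_nil : decimal R [::] = 0.
Proof. by rewrite /decimal big_geq. Qed.

(** The quotient lies just below 0.47128, so these five digits are its rounding and not a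
    truncation; the tolerance is half a unit of the last digit. *)
Lemma lambda_quotient (l : R) :
  (69 + (70 + 63 / 100) / 100) / 100 < l < (69 + (70 + 68 / 100) / 100) / 100 ->
  `|32 / (l * pi ^+ 4) - decimal R [:: 4; 7; 1; 2; 8]%N| <= 5 * 10 ^- 6.
Proof.
move=> /andP[l1 l2]; have /andP[p1 p2] := pi_bounds R.
have pi0 := pi_gt0 R.
pose q1 : R := 9 + (86 + 96 / 100) / 100; pose q2 : R := 9 + (86 + (96 + 10 / 100) / 100) / 100.
have h1 : q1 <= pi ^+ 2.
  rewrite expr2; apply: (@le_trans _ _ ((314 + (15 + (92 + 65 / 100) / 100) / 100) / 100 * ((314 + (15 + (92 + 65 / 100) / 100) / 100) / 100))); first by rewrite /q1; lra.
  by apply: ler_pM; [lra|lra|exact: ltW|exact: ltW].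
have h2 : pi ^+ 2 <= q2.
  rewrite expr2; apply: (@le_trans _ _ ((314 + (15 + (92 + 66 / 100) / 100) / 100) / 100 * ((314 + (15 + (92 + 66 / 100) / 100) / 100) / 100))); last by rewrite /q2; lra.
  exact: ler_pM (ltW pi0) (ltW pi0) (ltW p2) (ltW p2).
have q10 : 0 <= q1 by rewrite /q1; lra.
have P1 : q1 ^+ 2 <= pi ^+ 4 :> R by rewrite (exprM pi 2 2) lerXn2r ?nnegrE ?sqr_ge0.
have P2 : pi ^+ 4 <= q2 ^+ 2 :> R.
  by rewrite (exprM pi 2 2) lerXn2r ?nnegrE ?sqr_ge0// (le_trans (sqr_ge0 _) h2).
have L1 : (69 + (70 + 63 / 100) / 100) / 100 * q1 ^+ 2 <= l * pi ^+ 4.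
  by apply: ler_pM; rewrite ?sqr_ge0 ?(ltW l1)//; lra.
have L2 : l * pi ^+ 4 <= (69 + (70 + 68 / 100) / 100) / 100 * q2 ^+ 2.
  by apply: ler_pM; rewrite ?exprn_ge0 ?(ltW pi0) ?(ltW l2)//; lra.
move: L1 L2; rewrite /q1 /q2 !expr2; move: (l * pi ^+ 4) => L L1 L2.
have L0 : 0 < L by clear -L1; lra.
have u1 : (47 + (12 + 75 / 100) / 100) / 100 <= 32 / L.
  by rewrite ler_pdivlMr//; clear -L2; lra.
have u2 : 32 / L <= (47 + (12 + 85 / 100) / 100) / 100.
  by rewrite ler_pdivrMr//; clear -L1; lra.
rewrite !decimal_cons decimal_nil ler_norml !exprS expr0; clear -u1 u2.
by apply/andP; split; lra.
Qed.

End Decimals.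

Theorem corollary5 (R : realType) (p : R) (hp : 1 < p)
    (H : nat -> R -> complex R)
    (hH : forall m : nat, (0 < m)%N -> is_daubechies_mask m (H m)) :
  exists xi2 : R, unique (@is_xi2 R) xi2 /\
    let lambda2 := lambda xi2 in
    [/\ decimal R [:: 2; 8; 5; 3]%N <= xi2
          < decimal R [:: 2; 8; 5; 3]%N + 10 ^- 4,
        decimal R [:: 6; 9; 7; 0; 6]%N <= lambda2
          < decimal R [:: 6; 9; 7; 0; 6]%N + 10 ^- 5
      & `|32 / (lambda2 * pi ^+ 4) - decimal R [:: 4; 7; 1; 2; 8]%N|
          <= 5 * 10 ^- 6] /\
    [/\ (fun m : nat => C_daubechies p m (H m) `^ (m%:R^-1)) @ \oo
          --> (1 / 2 : R),
        (fun m : nat => C_spline p m `^ (m%:R^-1)) @ \oo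
          --> 16 / (lambda2 * pi ^+ 4)
      & (fun m : nat =>
           (C_spline p m / C_daubechies p m (H m)) `^ (m%:R^-1)) @ \oo
          --> 32 / (lambda2 * pi ^+ 4)].
Proof.
have [x [xx /andP[xa xb]] lx] := exists_xi2 R.
have /andP[p1 p2] := pi_bounds R; have /andP[l1 l2] := lx.
exists x; split; first by split=> // y; exact: xi2_unique.
have x4 : x <= pi / 4 by clear -xb p1; lra.
(* Numerically 2/pi is about 0.637, while lambda_2 is about 0.697. *)
have lpi : 2 / pi <= profile x.
  rewrite -lambdaE; apply: le_trans (ltW l1).
  by rewrite ler_pdivrMr ?pi_gt0//; clear -p1; lra.
have cS : (fun m : nat => C_spline p m `^ (m%:R^-1)) @ \oo --> 16 / (lambda x * pi ^+ 4).
  have -> : 16 / (lambda x * pi ^+ 4) = 16 / pi ^+ 4 / profile x.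
    by rewrite lambdaE invfM mulrCA mulrC [16 * _]mulrC.
  exact: C_spline_cvg.
have cD := C_daubechies_cvg hp hH.
move=> lambda2; split; split=> //.
- by rewrite !decimal_cons decimal_nil !exprS expr0; clear -xa xb; apply/andP; split; lra.
- by rewrite !decimal_cons decimal_nil !exprS expr0 /lambda2; clear -l1 l2; apply/andP; split; lra.
- exact: lambda_quotient.
have -> : 32 / (lambda2 * pi ^+ 4) = 16 / (lambda x * pi ^+ 4) / (1 / 2).
  by rewrite -/lambda2; move: (_ * pi ^+ 4)^-1 => I; field.
apply: root_div_cvg => //.
- by move=> m; rewrite /C_spline /Cft divr_ge0 ?LpnormC_ge0.
- by move=> m; rewrite /C_daubechies /Cft divr_ge0 ?LpnormC_ge0.
Qed.
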